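(* Let $d\ge1$, let $h$ be the ballistic deposition process on $\mathbb{Z}^d$, and let $w(t,x):=h(t,x)-h(t,0)$. Consider the process $\{w(t,\cdot)\}_{t\ge0}$ with initial state $w(0,x)=x_1$ for all $x\in\mathbb{Z}^d$, where $x_1$ is the first coordinate of $x$. With this initial state, the process satisfies $$\sup_{T\ge1}\frac1T\int_0^T\mathbb{E}|w(t,e_1)|\,dt<\infty.$$ If it is further true that, with this initial state, $$\lim_{R\to\infty}\sup_{T\ge1}\frac1T\int_0^T\mathbb{E}\bigl(|w(t,e_1)|\,1_{\{|w(t,e_1)|\ge R\}}\bigr)dt=0,$$ then there exists more than one invariant probability measure for the Markov process $\{w(t,\cdot)\}_{t\ge0}$.
   Context: Let $\Omega := \mathbb{Z}^{\mathbb{Z}^d}$ with the product topology ($\mathbb{Z}$ discrete) and its Borel $\sigma$-algebra; $e_1,\ldots,e_d$ are the standard basis vectors. Ballistic deposition: at each site $x\in\mathbb{Z}^d$ there is an independent Poisson clock of rate $1$ on $[0,\infty)$. Given an initial condition $h(0,\cdot)\in\Omega$, whenever the clock at $x$ rings at time $t$, the height at $x$ is instantaneously updated to $\max\{\max_{1\le i\le d}h(t,x\pm e_i),\,h(t,x)+1\}$ (inner maximum over all $i$ and both signs), which is the value of $h(s,x)$ for $s\in(t,t']$, $t'$ being the next ringing time at $x$. Precisely: for finite $D\subseteq\mathbb{Z}^d$ one performs only the updates at sites of $D$, in temporal order; the resulting heights are nondecreasing in $D$, and $h(t,x)$ is the limit as $D\uparrow\mathbb{Z}^d$, which is almost surely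 finite. The process $\{w(t,\cdot)\}_{t\ge0}$ is a time-homogeneous Markov process on $\Omega$ (its law depends on $h(0,\cdot)$ only through $w(0,\cdot)$). An invariant probability measure is a probability measure $\mu$ on $\Omega$ such that if $w(0,\cdot)$ has law $\mu$ (independent of the clocks), then $w(t,\cdot)$ has law $\mu$ for every $t\ge0$. *)

(* Defs.v *)
From HB Require Import structures.
From mathcomp Require Import all_boot all_order all_algebra.
From mathcomp Require Import finmap.
From mathcomp Require Import all_classical all_reals all_analysis.
From mathcomp Require Import summability.

Set Implicit Arguments.
Unset Strict Implicit.
Unset Printing Implicit Defensive.

Import Order.TTheory GRing.Theory Num.Theory.
Import numFieldNormedType.Exports.

Local Open Scope classical_set_scope.
Local Open Scope ring_scope.

(* The discrete topology on Z, declared as for nat in nat_topology.v. *)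
HB.instance Definition _ := isPointed.Build int 0.
HB.instance Definition _ := hasNbhs.Build int principal_filter.
HB.instance Definition _ := Discrete_ofNbhs.Build int erefl.

Notation site d := 'rV[int]_d.

Definition unit_vec d (i : 'I_d) : site d := delta_mx 0 i.

(* The space Z^(Z^d) with the Borel sigma-algebra of its product topology. *)
Definition height_space d : measurableType _ :=
  g_sigma_algebraType (@open {ptws site d -> int}).

Section deposition.
Variables (R : realType) (d : nat).

(* In this section [r x n] is the time of the (n+1)-st ring of the clock at x,
   for a fixed realization of the clocks. *)
Implicit Types (r : site d -> nat -> R) (eta : site d -> int) (x : site d).

(* The default value of the iterated maximum supplies the term [eta x + 1]. *)
Definition new_height eta x : int :=
  \big[Num.max/eta x + 1]_(i < d)
    Num.max (eta (x + unit_vec i)) (eta (x - unit_vec i)).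

Definition update eta x : site d -> int :=
  fun y => if y == x then new_height eta x else eta y.

(* Rings at sites of D during [0, t), in temporal order.  A ring at time t
   itself only affects the heights after time t.  If infinitely many rings
   occur (a null event), [fset_set] is empty. *)
Definition rings_before r (D : {fset site d}) (t : R) : seq (site d * nat) :=
  sort (fun p q => r p.1 p.2 <= r q.1 q.2)
    (fset_set [set p | p.1 \in D /\ 0 <= r p.1 p.2 < t]).

Definition finite_height r eta (D : {fset site d}) (t : R) : site d -> int :=
  foldl (fun zeta p => update zeta p.1) eta (rings_before r D t).

(* [totally] is the filter of the finite subsets of Z^d directed by inclusion.
   On the null event where the limit fails to exist, [lim] is a default value. *)
Definition height r eta (t : R) x : int :=
  lim ((fun D => finite_height r eta D t x) @ totally).

Definition rel_height r eta (t : R) x : int :=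
  height r eta t x - height r eta t 0.

End deposition.

Section randomness.
Context (R : realType) (disp : measure_display) (T : measurableType disp).
Variables (P : probability T R) (d : nat) (tau : T -> site d -> nat -> R).

Definition rings_in x (a b : R) (om : T) : set nat :=
  [set n | a <= tau om x n < b].

(* Independent Poisson processes of rate 1: over pairwise disjoint cells
   {x_i} x [a_i, b_i) the numbers of rings are independent, with Poisson laws
   of parameters b_i - a_i.  The case m = 1 gives the marginal laws, equal
   sites the independence of the increments of one clock, and different sites
   the independence of the clocks. *)
Record poisson_clocks : Prop := PoissonClocks {
  clock_measurable : forall x n, measurable_fun setT (fun om => tau om x n) ;
  clock_ge0 : forall om x n, 0 <= tau om x n ;
  clock_lt : forall om x n, tau om x n < tau om x n.+1 ;
  clock_law : forall (m : nat) (x : 'I_m -> site d) (a b : 'I_m -> R)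
      (k : 'I_m -> nat),
    (forall i, 0 <= a i < b i) ->
    (forall i j, i != j -> x i = x j -> b i <= a j \/ b j <= a i) ->
    P [set om | forall i, (rings_in (x i) (a i) (b i) om #= `I_(k i))%card] =
      (\prod_(i < m) poisson_pmf (b i - a i) (k i))%:E }.

(* The product measure [mu \x P] makes the initial state independent of the
   clocks.  The instance t = 0 forces mu-almost every state to vanish at the
   origin, so that under mu the initial heights are w(0, .). *)
Definition invariant_measure (mu : probability (height_space d) R) : Prop :=
  forall t : R, 0 <= t -> forall A : set (height_space d), measurable A ->
    pushforward (mu \x P)%E
      (fun p : height_space d * T => rel_height (tau p.2) p.1 t : height_space d)
      A = mu A.

End randomness.

Definition time_average (R : realType) (f : R -> \bar R) (S : R) : \bar R :=
  (S^-1%:E * \int[lebesgue_measure]_(t in `[0%R, S]) f t)%E.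

Definition sup_time_average (R : realType) (f : R -> \bar R) : \bar R :=
  ereal_sup [set time_average f S | S in [set S : R | 1 <= S]].

(* Main.v *)
Require Import Defs.
From HB Require Import structures.
From mathcomp Require Import all_boot all_order all_algebra.
From mathcomp Require Import finmap.
From mathcomp Require Import all_classical all_reals all_analysis.
From mathcomp Require Import summability measurable_realfun.
From mathcomp Require Import zify ring lra.

Set Implicit Arguments.
Unset Strict Implicit.
Unset Printing Implicit Defensive.

Import Order.TTheory GRing.Theory Num.Theory.
Import numFieldNormedType.Exports.

Local Open Scope classical_set_scope.
Local Open Scope ring_scope.

(* A Cesaro limit of the law of w(t, .) along a generalized limit exists, because
   E|w(t, e_1)| is controlled by the growth E h(t + 1, 0) - E h(t, 0) of the mean
   height, whose time averages are bounded; such a limit is invariant.  By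
   translation invariance w(t, e_1) has mean one, and uniform integrability passes
   this asymmetry on to the limit, so that the limit differs from its image under
   the reflection of the first coordinate, which is invariant too.  Infinitely many
   clocks are handled through backward chains of influence: up to a small
   probability the heights in a finite window at time t depend only on the numbers
   of rings in finitely many cells of a fine space-time grid. *)

(** * Backward chains of influence *)

(** [poisson_clocks] prescribes only the laws of ring counts in cells, so every probabilistic fact
    has to become one about finitely many counts. Once each time slab holds at most one ring, the
    counts determine the temporal order. Growth controls increments because a ring at 0 within unit
    time after t lifts the height there to at least h(t, e_i), independently of the past. This
    bounds only the positive part; the inequality E h(t, e_i) >= E h(t, 0) extends the bound to the
    absolute value. The generalized limit is an ultrafilter limit: it treats all local events at
    once, but gives only a finitely additive law. Tightness restores countable additivity one
    coordinate at a time, and the measure is realized as an image of the uniform law on [0, 1].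
    Invariance survives the limit because a transition is, up to a small error, a finite combination
    of local events of the initial state. By translation, reflection acts on the law of w(e_1) as a
    change of sign. If the limit were its own reflection, the increment truncated to [-k, k] would
    have mean 0; uniform integrability gives it mean at least 1/2. *)

Section lists.
Variable d : nat.
Implicit Types (x y z : site d) (eta : site d -> int) (l p : seq (site d)).

(** The site itself belongs to the list since an update also reads the old height there; hence
    chains of influence may stay in place. The lock keeps simplification from unfolding the list. *)
Definition adj x : seq (site d) :=
  locked (x :: flatten [seq [:: x + unit_vec i; x - unit_vec i] | i <- enum 'I_d]).

Lemma size_adj x : size (adj x) = (2 * d).+1.
Proof.
rewrite /adj -lock /= size_flatten /shape -map_comp /=.
rewrite (@eq_map _ _ _ (fun=> 2%N)) //.
by rewrite sumnE big_map big_const_seq count_predT size_enum_ord iter_addn_0.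
Qed.

Lemma adj_refl x : x \in adj x. Proof. by rewrite /adj -lock mem_head. Qed.

Lemma adj_add x i : x + unit_vec i \in adj x.
Proof.
rewrite /adj -lock inE; apply/orP; right; apply/flatten_mapP; exists i.
  by rewrite mem_enum.
by rewrite !inE eqxx.
Qed.

Lemma adj_sub x i : x - unit_vec i \in adj x.
Proof.
rewrite /adj -lock inE; apply/orP; right; apply/flatten_mapP; exists i.
  by rewrite mem_enum.
by rewrite !inE eqxx orbT.
Qed.

Lemma adjP x z : z \in adj x ->
  [\/ z = x, exists i, z = x + unit_vec i | exists i, z = x - unit_vec i].
Proof.
rewrite /adj -lock inE => /orP[/eqP->|/flatten_mapP[i _]]; first by constructor 1.
by rewrite !inE => /orP[/eqP->|/eqP->];
  [constructor 2; exists i|constructor 3; exists i].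
Qed.

Lemma new_height_self eta x : eta x + 1 <= new_height eta x.
Proof. by rewrite /new_height bigmax_idl le_max lexx. Qed.

Lemma new_height_ge eta x z : z \in adj x -> eta z <= new_height eta x.
Proof.
case/adjP => [->|[i ->]|[i ->]].
- by apply: le_trans (new_height_self eta x); rewrite lerDl.
- by rewrite /new_height (bigD1 i) //= !le_max lexx.
- by rewrite /new_height (bigD1 i) //= !le_max lexx orbT.
Qed.

Lemma new_height_cases eta x : new_height eta x = eta x + 1 \/
  exists2 z, z \in adj x & new_height eta x = eta z.
Proof.
rewrite /new_height; elim/big_ind : _ => [|u v hu hv|i _].
- by left.
- by rewrite /Num.max; case: ifP.
- right; rewrite /Num.max; case: ifP => _.
    by exists (x - unit_vec i); rewrite ?adj_sub.
  by exists (x + unit_vec i); rewrite ?adj_add.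
Qed.

Lemma eq_new_height eta eta' x : {in adj x, eta =1 eta'} ->
  new_height eta x = new_height eta' x.
Proof.
move=> e; rewrite /new_height e ?adj_refl//; apply: eq_bigr => i _.
by rewrite !e ?adj_add ?adj_sub.
Qed.

Definition evolve eta l := foldl (@update d) eta l.

Lemma evolve_rcons eta l y : evolve eta (rcons l y) = update (evolve eta l) y.
Proof. exact: foldl_rcons. Qed.

Lemma evolve_cat eta l1 l2 :
  evolve eta (l1 ++ l2) = evolve (evolve eta l1) l2.
Proof. exact: foldl_cat. Qed.

Lemma le_update eta y x : eta x <= update eta y x.
Proof.
rewrite /update; case: eqP => // ->.
by apply: le_trans (new_height_self _ _); rewrite lerDl.
Qed.

Lemma le_evolve eta l x : eta x <= evolve eta l x.
Proof.
elim/last_ind: l => // l y IH; rewrite evolve_rcons.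
exact: le_trans IH (le_update _ _ _).
Qed.

Lemma evolve_notin eta l x : x \notin l -> evolve eta l x = eta x.
Proof.
elim/last_ind: l => // l y IH; rewrite mem_rcons inE negb_or => /andP[xy xl].
by rewrite evolve_rcons /update (negbTE xy) IH.
Qed.

Lemma evolve_adj eta l x z : x \in l -> z \in adj x -> eta z <= evolve eta l x.
Proof.
move=> + zx; elim/last_ind: l => // l y IH; rewrite mem_rcons inE evolve_rcons.
case/orP => [/eqP<-|xl]; last exact: le_trans (IH xl) (le_update _ _ _).
rewrite /update eqxx; apply: le_trans (new_height_ge _ zx).
exact: le_evolve.
Qed.

Lemma new_height_shift (c : int) eta x :
  new_height (fun y => eta y + c) x = new_height eta x + c.
Proof.
rewrite /new_height.
apply: (big_rec2 (fun u v => u = v + c)) => [|i u v _ ->]; first by rewrite addrAC.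
by rewrite !addr_maxl.
Qed.

Lemma evolve_shift (c : int) eta l x :
  evolve (fun y => eta y + c) l x = evolve eta l x + c.
Proof.
elim/last_ind: l x => // l y IH x; rewrite !evolve_rcons /update; case: eqP => // _.
by rewrite -new_height_shift; apply: eq_new_height => z _; exact: IH.
Qed.

(* Backward chains of influence: [chain p x] says that p starts at x and makes
   nearest neighbour steps or stays.  A chain matters when its sites ring in
   the reverse order, i.e. [subseq p (rev l)]. *)
Fixpoint chain p x : bool :=
  if p is y :: p' then (y == x) && has (chain p') (adj x) else true.

Definition has_chain n l x :=
  exists p, [/\ size p = n, chain p x & subseq p (rev l)].

Lemma has_chain_rcons n l x y : has_chain n l x -> has_chain n (rcons l y) x.
Proof.
move=> [p [sp cp pl]]; exists p; split => //; rewrite rev_rcons.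
by apply: subseq_trans pl _; exact: subseq_cons.
Qed.

Lemma has_chain_step n l x z : z \in adj x -> has_chain n l z ->
  has_chain n.+1 (rcons l x) x.
Proof.
move=> zx [p [sp cp pl]]; exists (x :: p).
have hz : has (chain p) (adj x) by apply/hasP; exists z.
by split; [rewrite /= sp|rewrite /chain -/chain eqxx|rewrite rev_rcons /= eqxx].
Qed.

Fixpoint reach n x : seq (site d) :=
  if n is n'.+1 then x :: flatten [seq reach n' z | z <- adj x] else [:: x].

Lemma reach_refl n x : x \in reach n x.
Proof. by case: n => [|n] /=; rewrite inE eqxx. Qed.

(** Induction on the last update: an update at [x] reads only [adj x], and a chain from one of those
    sites becomes longer by one link when [x] is put in front. So the recursion stops before depth
    [n]. For [n = 0] the premise is contradictory, the empty chain being always present. *)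
Lemma evolve_local n l (B : pred (site d)) eta x :
  ~ has_chain n l x -> {subset reach n x <= B} ->
  evolve eta l x = evolve eta [seq y <- l | B y] x.
Proof.
elim/last_ind: l n x => [//|l y IH] n x nc sB.
have nc0 : ~ has_chain n l x by move=> h; apply: nc; exact: has_chain_rcons.
rewrite filter_rcons evolve_rcons.
have [yx|yx] := eqVneq x y; last first.
  case: (B y); rewrite ?evolve_rcons /update (negbTE yx); exact: IH nc0 sB.
rewrite -yx; have -> : B x by exact/sB/reach_refl.
rewrite evolve_rcons /update eqxx; apply: eq_new_height => z zx.
case: n nc sB {nc0} => [|n] nc sB.
  by case: nc; exists [::]; split => //; exact: sub0seq.
apply: (IH n) => [hz|u uz]; first by apply: nc; rewrite -yx; exact: has_chain_step hz.
by apply: sB; rewrite inE; apply/orP; right; apply/flatten_mapP; exists z.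
Qed.

(** The recursion of [evolve_local], followed down to the initial state instead of the list of
    updates. *)
Lemma evolve_dep n l eta eta' x :
  ~ has_chain n l x -> {in reach n x, eta =1 eta'} ->
  evolve eta l x = evolve eta' l x.
Proof.
elim/last_ind: l n x => [|l y IH] n x nc e; first by rewrite /= e ?reach_refl.
have nc0 : ~ has_chain n l x by move=> h; apply: nc; exact: has_chain_rcons.
rewrite !evolve_rcons /update; have [yx|yx] := eqVneq x y; last exact: IH nc0 e.
rewrite -yx; apply: eq_new_height => z zx.
case: n nc e {nc0} => [|n] nc e.
  by case: nc; exists [::]; split => //; exact: sub0seq.
apply: (IH n) => [hz|u uz]; first by apply: nc; rewrite -yx; exact: has_chain_step hz.
by apply: e; rewrite inE; apply/orP; right; apply/flatten_mapP; exists z.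
Qed.

(** Following backwards the site that realizes the maximum gives a chain whose links each account
    for at most one unit of height: staying adds one, and a step costs at most one by the Lipschitz
    bound on [eta]. As long chains are unlikely, this bounds the mean height. *)
Lemma evolve_le_chain l eta x :
  (forall u v, v \in adj u -> eta v <= eta u + 1) ->
  exists2 n, has_chain n l x & evolve eta l x <= eta x + n%:Z.
Proof.
move=> lip; elim/last_ind: l x => [|l y IH] x.
  by exists 0%N; rewrite ?addr0//; exists [::].
rewrite evolve_rcons /update; case: eqP => [->|_]; last first.
  by have [n nc le] := IH x; exists n => //; exact: has_chain_rcons.
have [e|[z zy e]] := new_height_cases (evolve eta l) y.
  have [n nc le] := IH y; exists n.+1.
    by apply: has_chain_step nc; exact: adj_refl.
  by rewrite e; lia.
have [n nc le] := IH z; exists n.+1; first exact: has_chain_step nc.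
by have := lip y z zy; rewrite e; lia.
Qed.

End lists.

(** * Rings in temporal order and space-time cells *)

Section ring_lists.
Variables (R : realType) (d : nat).
Implicit Types (r : site d -> nat -> R) (x y z : site d) (D : {fset site d}).

Definition ring_le r : rel (site d * nat) := fun p q => r p.1 p.2 <= r q.1 q.2.

Definition ring_set r D (t : R) : set (site d * nat) :=
  [set p | p.1 \in D /\ 0 <= r p.1 p.2 < t].

Definition nrings r x (a b : R) : nat :=
  #|` fset_set [set n | a <= r x n < b]|.

Definition locally_finite r := forall x (t : R), finite_set [set n | 0 <= r x n < t].

Lemma locally_finite_sub r x a b : locally_finite r -> 0 <= a ->
  finite_set [set n | a <= r x n < b].
Proof.
move=> fr a0; apply: sub_finite_set (fr x b) => n /= /andP[an ->].
by rewrite (le_trans a0 an).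
Qed.

Lemma ring_le_total r : total (ring_le r). Proof. by move=> p q; exact: le_total. Qed.

Lemma ring_le_trans r : transitive (ring_le r).
Proof. by move=> p q s; exact: le_trans. Qed.

Lemma finite_ring_set r D t : locally_finite r -> finite_set (ring_set r D t).
Proof.
move=> fr; apply: (@sub_finite_set _ _
    (\bigcup_(x in [set` D]) ((pair x) @` [set n | 0 <= r x n < t]))).
  by move=> [x n] [/= xD rn]; exists x => //; exists n.
apply: bigcup_finite; first exact: finite_fset.
by move=> x _; apply: finite_image; exact: fr.
Qed.

Lemma mem_rings_before r D t p : locally_finite r ->
  (p \in rings_before r D t) = ((p.1 \in D) && (0 <= r p.1 p.2 < t)).
Proof.
move=> fr; rewrite mem_sort in_fset_set; last exact: finite_ring_set.
by apply/idP/idP => [/set_mem[-> //]|/andP[? ?]]; apply/mem_set.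
Qed.

Lemma uniq_rings_before r D t : uniq (rings_before r D t).
Proof. by rewrite sort_uniq fset_uniq. Qed.

Lemma sorted_rings_before r D t : sorted (ring_le r) (rings_before r D t).
Proof. exact: (sort_sorted (@ring_le_total r)). Qed.

(** A sorted list without ties is determined by its elements; hence restricting the rings in space
    or in time commutes with sorting. *)
Lemma filter_rings_before r D t a (s : seq (site d * nat)) :
  uniq s -> {in s &, antisymmetric (ring_le r)} -> sorted (ring_le r) s ->
  (forall p, (p \in rings_before r D t) && a p = (p \in s)) ->
  [seq p <- rings_before r D t | a p] = s.
Proof.
move=> us anti ss e.
have pe : perm_eq [seq p <- rings_before r D t | a p] s.
  apply: uniq_perm => //; first by rewrite filter_uniq// uniq_rings_before.
  by move=> p; rewrite mem_filter andbC e.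
apply: (@sorted_eq_in _ (ring_le r)) (pe) => //.
- by move=> p q v _ _ _; exact: ring_le_trans.
- by move=> p q; rewrite !(perm_mem pe); exact: anti.
- apply: sorted_filter; [exact: ring_le_trans|exact: sorted_rings_before].
Qed.

Lemma filter_rings_subset r D D' t : locally_finite r -> (D `<=` D')%fset ->
  {in rings_before r D t &, antisymmetric (ring_le r)} ->
  [seq p <- rings_before r D' t | p.1 \in D] = rings_before r D t.
Proof.
move=> fr /fsubsetP DD' anti; apply: filter_rings_before => //.
- exact: uniq_rings_before.
- exact: sorted_rings_before.
- move=> p; rewrite !mem_rings_before//.
  by case pD: (p.1 \in D); [rewrite (DD' _ pD) andbT|rewrite andbF].
Qed.

Lemma count_nrings r x a b (q : seq (site d * nat)) :
  finite_set [set n | a <= r x n < b] -> uniq q ->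
  (count (fun p => (p.1 == x) && (a <= r p.1 p.2 < b)%R) q <= nrings r x a b)%N.
Proof.
move=> fi uq; rewrite -size_filter /nrings; set s := [seq _ <- q | _].
rewrite -(size_map snd); apply: uniq_leq_size.
  rewrite map_inj_in_uniq ?filter_uniq// => -[x1 n1] [x2 n2].
  by rewrite !mem_filter /= => /andP[/andP[/eqP-> _] _] /andP[/andP[/eqP-> _] _] ->.
move=> n /mapP[[x1 n1]]; rewrite mem_filter /= => /andP[/andP[/eqP-> h] _] ->.
by rewrite in_fset_set//; apply/mem_set.
Qed.

(* A cell (x, i) stands for {x} x [u i, u (i+1)). *)
Definition cell_count r (u : nat -> R) (c : site d * nat) : nat :=
  nrings r c.1 (u c.2) (u c.2.+1).

Definition covers r u (F : seq (site d * nat)) : Prop :=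
  forall c, c \in F -> (count_mem c F <= cell_count r u c)%N.

(* The cell sequences visited by backward chains of length n from x through the
   slabs i < k. *)
Fixpoint cell_chains n x k : seq (seq (site d * nat)) :=
  if n is n'.+1 then
    flatten [seq [seq (x, i) :: f | f <-
      flatten [seq cell_chains n' z i.+1 | z <- adj x]] | i <- iota 0 k]
  else [:: [::]].

Lemma cell_chainsE n x k : cell_chains n.+1 x k =
  flatten [seq [seq (x, i) :: f | f <-
    flatten [seq cell_chains n z i.+1 | z <- adj x]] | i <- iota 0 k].
Proof. by []. Qed.

Lemma cell_chainsS n x k f : f \in cell_chains n.+1 x k ->
  exists i z g, [/\ (i < k)%N, z \in adj x, g \in cell_chains n z i.+1 &
    f = (x, i) :: g].
Proof.
rewrite cell_chainsE => fc; case: (flatten_mapP fc) => i; rewrite mem_iota add0n leq0n => ik /mapP[g gc ->].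
by case: (flatten_mapP gc) => z zx gz; exists i, z, g.
Qed.

Lemma cell_chains_cons n x k i z g : (i < k)%N -> z \in adj x ->
  g \in cell_chains n z i.+1 -> (x, i) :: g \in cell_chains n.+1 x k.
Proof.
move=> ik zx gz; rewrite cell_chainsE; apply/flatten_mapP; exists i; first by rewrite mem_iota.
by apply: map_f; apply/flatten_mapP; exists z.
Qed.

Lemma size_cell_chain n x k f : f \in cell_chains n x k -> size f = n.
Proof.
elim: n x k f => [|n IH] x k f; first by rewrite inE => /eqP->.
by move=> /cell_chainsS[i [z [g [_ _ /IH <- ->]]]].
Qed.

Lemma cell_chain_lt n x k f : f \in cell_chains n x k ->
  forall c, c \in f -> (c.2 < k)%N.
Proof.
elim: n x k f => [|n IH] x k f; first by rewrite inE => /eqP->.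
move=> /cell_chainsS[i [z [g [ik zx gz ->]]]] c; rewrite inE => /orP[/eqP->//|].
by move=> /(IH _ _ _ gz); move: ik; rewrite -ltnS; lia.
Qed.

(** The slab numbers along a chain do not increase, and there are at most 2 ^ (n + k) such sequences
    below k: the induction step is the geometric sum of 2 ^ (n + i + 1) over i < k. *)
Lemma size_cell_chains n x k :
  (size (cell_chains n x k) <= (2 * d).+1 ^ n * 2 ^ (n + k))%N.
Proof.
elim: n x k => [|n IH] x k; first by rewrite /= expn0 mul1n expn_gt0.
rewrite cell_chainsE size_flatten /shape -map_comp sumnE big_map.
apply: (@leq_trans (\sum_(i <- iota 0 k) (2 * d).+1 * ((2 * d).+1 ^ n * 2 ^ (n + i.+1)))).
  apply: leq_sum => i _; rewrite /comp size_map size_flatten /shape -map_comp sumnE big_map.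
  rewrite -[X in (_ <= X * _)%N](size_adj x) -sum1_size big_distrl /=; apply: leq_sum => z _.
  by rewrite mul1n; exact: IH.
elim: k => [|k IHk]; first by rewrite big_nil.
have -> : iota 0 k.+1 = iota 0 k ++ [:: k] by rewrite -addn1 iotaD.
rewrite big_cat big_seq1 /=.
move: IHk; rewrite !addSn !addnS !expnS; set a := (2 ^ (n + k))%N; set b := ((2 * d).+1 ^ n)%N.
by move: (\sum_(i <- _) _)%N => S0; nia.
Qed.

End ring_lists.

Section chains_and_grids.
Variables (R : realType) (d : nat).
Implicit Types (r : site d -> nat -> R) (x y z : site d) (D : {fset site d}).

Lemma count_map_pred (T1 T2 : Type) (f : T1 -> T2) (a : pred T2) (b : pred T1) s :
  (forall v, a (f v) = b v) -> count a (map f s) = count b s.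
Proof. by move=> e; rewrite count_map; apply: eq_count => v; rewrite /= e. Qed.

(** Chains depend on the order of the rings; this trades the order for ring counts. Reverse temporal
    order makes the slab numbers non-increasing, and distinct rings in one cell are accounted for by
    its multiplicity. *)
Lemma has_chain_covers r D (t delta : R) n x k : locally_finite r ->
  0 < delta -> t <= k%:R * delta ->
  has_chain n (map fst (rings_before r D t)) x ->
  exists2 F, F \in cell_chains n x k & covers r (fun i => i%:R * delta) F.
Proof.
move=> fr d0 tk [p [<- cp]]; rewrite -map_rev => /subseqP[m _].
(* The mask recovers, from the sites of the chain, the rings themselves, hence their times and their
   distinctness. *)
rewrite -map_mask; set q := mask m _ => pE.
pose slab (v : site d * nat) := Num.truncn (r v.1 v.2 / delta).
have qL v : v \in q -> v \in rings_before r D t.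
  by move=> /mem_mask; rewrite mem_rev.
have q0 v : v \in q -> 0 <= r v.1 v.2 < t.
  by move/qL; rewrite mem_rings_before// => /andP[].
have slabP v i : 0 <= r v.1 v.2 ->
    (slab v == i) = (i%:R * delta <= r v.1 v.2 < i.+1%:R * delta).
  move=> v0; rewrite -ler_pdivlMr// -ltr_pdivrMr//; apply/eqP/idP.
    by move<-; apply: truncn_itv; rewrite divr_ge0// ltW.
  exact: truncn_def.
have slabk v : v \in q -> (slab v < k)%N.
  move=> /q0/andP[v0 vt]; rewrite -(ltr_nat R).
  have/eqP := erefl (slab v); rewrite slabP// => /andP[h _].
  by rewrite -(ltr_pM2r d0) (le_lt_trans h)// (lt_le_trans vt).
have uq : uniq q.
  by apply: mask_uniq; rewrite rev_uniq uniq_rings_before.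
have sq : sorted (fun v w => ring_le r w v) q.
  apply: sorted_mask; first by move=> a b c h1 h2; exact: ring_le_trans h2 h1.
  by rewrite rev_sorted; exact: sorted_rings_before.
exists [seq (v.1, slab v) | v <- q].
  have : all (fun v => slab v < k)%N q by apply/allP.
  move: cp; rewrite pE size_map; clear pE.
  elim: (q) sq x k {tk slabk uq qL q0} => [|v q' IH] sq x k //=.
  move=> /andP[/eqP vx /hasP[z zx cz]] /andP[vk _].
  rewrite vx; apply: cell_chains_cons zx _ => //.
  apply: IH cz _; first exact: path_sorted sq.
  apply/allP => w wq; rewrite ltnS; apply: le_truncn.
  rewrite ler_pM2r ?invr_gt0//.
  move: sq => /=; rewrite (path_sortedE (leT := fun v w => ring_le r w v)).
    by move=> /andP[/allP/(_ _ wq)].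
  by move=> a b c h1 h2; exact: ring_le_trans h2 h1.
move=> [y i] _; rewrite /cell_count.
rewrite (count_map_pred (b := fun v => (v.1 == y) && (slab v == i))); last first.
  by move=> v; rewrite /= xpair_eqE.
rewrite (@eq_in_count _ _
  (fun v => (v.1 == y) && (i%:R * delta <= r v.1 v.2 < i.+1%:R * delta))).
  apply: count_nrings => //; apply: locally_finite_sub => //.
  by rewrite mulr_ge0// ltW.
by move=> v /q0/andP[v0 _] /=; rewrite slabP.
Qed.

(* Inside one slab the order of the rings is arbitrary. *)
Definition grid_list r (u : nat -> R) (D : seq (site d)) (k0 k1 : nat) : seq (site d) :=
  flatten [seq flatten [seq nseq (cell_count r u (x, i)) x | x <- D]
          | i <- iota k0 k1].

Lemma grid_listD r u D k0 k1 k2 :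
  grid_list r u D k0 (k1 + k2) = grid_list r u D k0 k1 ++ grid_list r u D (k0 + k1) k2.
Proof. by rewrite /grid_list iotaD map_cat flatten_cat. Qed.

(** At most one ring in [D] per slab: since [covers] counts multiplicity, the case x = y excludes
    two rings of one clock, and distinct x, y exclude one ring at each. *)
Definition sparse r (u : nat -> R) (D : seq (site d)) k :=
  forall i, (i < k)%N -> forall x y, x \in D -> y \in D ->
    ~ covers r u [:: (x, i); (y, i)].

Definition increasing_upto (u : nat -> R) k :=
  0 <= u 0%N /\ forall i, (i < k)%N -> u i < u i.+1.

Lemma increasing_upto_le u k i j : increasing_upto u k ->
  (i <= j <= k)%N -> u i <= u j.
Proof.
move=> [_ ui] /andP[]; elim: j => [|j IH]; first by rewrite leqn0 => /eqP->.
rewrite leq_eqVlt => /orP[/eqP->//|ij] jk.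
by apply: le_trans (IH ij (ltnW jk)) _; exact/ltW/ui.
Qed.

Lemma sparse_inj r u D k i (p q : site d * nat) :
  locally_finite r -> increasing_upto u k ->
  sparse r u D k -> (i < k)%N ->
  p.1 \in D -> q.1 \in D -> u i <= r p.1 p.2 < u i.+1 ->
  u i <= r q.1 q.2 < u i.+1 -> p = q.
Proof.
move=> fr iu sp ik pD qD hp hq; apply/eqP/negPn/negP => pq.
apply: (sp i ik p.1 q.1 pD qD) => -[x j] xj.
have ij : j = i by move: xj; rewrite !inE !xpair_eqE => /orP[]/andP[_ /eqP].
subst j; rewrite /cell_count /=.
have ui0 : 0 <= u i by apply: le_trans iu.1 (increasing_upto_le iu _); rewrite leq0n ltnW.
have := @count_nrings R d r x (u i) (u i.+1) [:: p; q] (locally_finite_sub _ _ fr ui0).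
rewrite /= inE pq => /(_ isT); rewrite !hp !hq !andbT !xpair_eqE eqxx !andbT.
by [].
Qed.

(** With at most one ring per slab the arbitrary order inside a slab does no harm, so counts alone
    reproduce the list of updated sites. For the same reason no two rings coincide. *)
Lemma grid_list_rings r u (D : {fset site d}) k :
  locally_finite r -> increasing_upto u k -> u 0%N = 0 -> sparse r u D k ->
  map fst (rings_before r D (u k)) = grid_list r u D 0 k /\
  {in rings_before r D (u k) &, antisymmetric (ring_le r)}.
Proof.
move=> fr iu u0 sp.
have slab p : 0 <= r p.1 p.2 < u k ->
    exists2 i, (i < k)%N & u i <= r p.1 p.2 < u i.+1.
  elim: k {sp} iu => [|k IH] iu; first by rewrite u0; lra.
  move=> /andP[p0 pk]; have [puk|puk] := ltP (r p.1 p.2) (u k).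
    have [||i ik h] := IH; last by exists i => //; exact: ltnW.
      by split=> [|i ik]; [exact: iu.1|apply: iu.2; exact: ltnW].
    by rewrite p0.
  by exists k => //; rewrite puk.
split; last first.
  move=> p q; rewrite !mem_rings_before// => /andP[pD hp] /andP[qD hq].
  rewrite /ring_le => /le_anti epq.
  have [i ik hi] := slab p hp.
  by apply: (sparse_inj fr iu sp ik pD qD hi); rewrite -epq.
suff H j : (j <= k)%N ->
    map fst [seq p <- rings_before r D (u k) | r p.1 p.2 < u j] = grid_list r u D 0 j.
  rewrite -H//; congr (map _ _); symmetry; apply/all_filterP/allP => p.
  by rewrite mem_rings_before// => /and3P[].
elim: j => [_|j IH jk].
  rewrite u0 (@eq_in_filter _ _ pred0) ?filter_pred0// => p.
  by rewrite mem_rings_before// => /and3P[_ p0 _]; rewrite ltNge p0.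
have -> : grid_list r u D 0 j.+1 = grid_list r u D 0 j ++ grid_list r u D j 1.
  by have := grid_listD r u D 0 j 1; rewrite addn1.
rewrite -IH ?(ltnW jk)//.
set L := rings_before r D (u k).
have -> : [seq p <- L | r p.1 p.2 < u j.+1] = [seq p <- L | r p.1 p.2 < u j] ++
    [seq p <- L | u j <= r p.1 p.2 < u j.+1].
  have: sorted (ring_le r) L by exact: sorted_rings_before.
  have uj := iu.2 _ jk.
  elim: (L) => //= p s IHs; rewrite (path_sortedE (@ring_le_trans _ _ r)) => /andP[pa ss].
  have [pj|pj] := ltP (r p.1 p.2) (u j) => /=.
    by rewrite (lt_trans pj uj) IHs.
  have -> : [seq p0 <- s | r p0.1 p0.2 < u j] = [::].
    rewrite (@eq_in_filter _ _ pred0) ?filter_pred0// => v vs /=.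
    by rewrite ltNge (le_trans pj)//; exact: (allP pa).
  rewrite /=; have -> : [seq p0 <- s | r p0.1 p0.2 < u j.+1] =
      [seq p0 <- s | u j <= r p0.1 p0.2 < u j.+1].
    apply: eq_in_filter => v vs; rewrite (le_trans pj)//; exact: (allP pa).
  by case: ifP.
rewrite map_cat; congr (_ ++ _); rewrite /grid_list /= cats0.
have uj0 : 0 <= u j by apply: le_trans iu.1 (increasing_upto_le iu _); rewrite leq0n ltnW.
have ujk : u j.+1 <= u k by apply: (increasing_upto_le iu); rewrite jk leqnn.
set Lj := [seq p <- L | _].
have memLj p : (p \in Lj) = (p.1 \in D) && (u j <= r p.1 p.2 < u j.+1).
  rewrite mem_filter mem_rings_before// andbC -andbA; congr (_ && _).
  apply/andP/idP => [[]//|h]; split => //; move/andP: h => [h1 h2].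
  by rewrite (le_trans uj0 h1) (lt_le_trans h2).
have eqLj p q : p \in Lj -> q \in Lj -> p = q.
  by rewrite !memLj => /andP[pD hp] /andP[qD hq]; exact: sparse_inj fr iu sp jk pD qD hp hq.
have uLj : uniq Lj by rewrite filter_uniq// uniq_rings_before.
have cnt x : x \in D -> cell_count r u (x, j) = count_mem x (map fst Lj).
  move=> xD; apply/eqP; rewrite eqn_leq; apply/andP; split; last first.
    rewrite count_map /cell_count /=.
    rewrite (@eq_in_count _ _ (fun p => (p.1 == x) && (u j <= r p.1 p.2 < u j.+1))).
      by apply: count_nrings => //; exact: locally_finite_sub.
    by move=> p; rewrite memLj /= => /andP[_ ->]; rewrite andbT.
  rewrite /cell_count /nrings /= count_map -size_filter.
  rewrite -(size_map (pair x)); apply: uniq_leq_size.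
    by rewrite map_inj_uniq ?fset_uniq// => ? ? [].
  move=> p /mapP[n]; rewrite in_fset_set; last exact: locally_finite_sub.
  by move=> /set_mem /= hn ->; rewrite mem_filter /= eqxx memLj /= xD.
transitivity (flatten [seq nseq (count_mem x (map fst Lj)) x | x <- D]); last first.
  by congr flatten; apply/eq_in_map => x xD; rewrite cnt.
have flat0 a (s : seq (site d)) : a \notin s ->
    flatten [seq nseq (a == x) x | x <- s] = [::].
  by elim: s => //= x s IHs; rewrite inE negb_or => /andP[/negbTE-> /IHs].
have flat1 a : a \in D -> flatten [seq nseq (a == x) x | x <- D] = [:: a].
  have := fset_uniq D; rewrite -[a \in D]/(a \in enum_fset D).
  elim: (enum_fset D) => //= x s IHs /andP[xs us].
  by rewrite inE; case: eqVneq => [->|_] /= h; [rewrite flat0|exact: IHs].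
(* The slab holds no ring, one ring, or at least two, which sparsity excludes. *)
case: (Lj) uLj eqLj memLj => [|p [|q s]] /= uLj eqLj memLj.
- by elim: (enum_fset D) => //= x s ->.
- rewrite -(flat1 p.1); last by move: (memLj p); rewrite inE eqxx => /esym/andP[-> _].
  by congr flatten; apply: eq_map => x; rewrite addn0.
- by move: uLj; rewrite (eqLj p q) ?inE ?eqxx ?orbT.
Qed.

End chains_and_grids.

(** * Infinite-volume heights for a fixed realization of the clocks *)

Section limit_heights.
Variables (R : realType) (d : nat).
Implicit Types (r : site d -> nat -> R) (x y z : site d) (D : {fset site d}).
Implicit Type eta : site d -> int.

Definition ring_sites r D t : seq (site d) := map fst (rings_before r D t).

Lemma finite_heightE r eta D t :
  finite_height r eta D t = evolve eta (ring_sites r D t).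
Proof.
rewrite /finite_height /evolve /ring_sites.
by elim: (rings_before r D t) eta => //= p s IH eta.
Qed.

(** The topology of the integers is discrete, so convergence along finite sets means being
    eventually constant. *)
Lemma cvg_totally_int (f : {fset site d} -> int) (v : int) :
  (f @ totally --> v) <-> exists D0, forall D, (D0 `<=` D)%fset -> f D = v.
Proof.
split=> [/(_ [set v])|[D0 h] A].
  case; first by [].
  by move=> D0 _ h; exists D0 => D /h.
by move=> /= Av; exists D0 => // D /h /= ->; exact: Av.
Qed.

Lemma height_eq r eta D0 t x v :
  (forall D, (D0 `<=` D)%fset -> finite_height r eta D t x = v) ->
  height r eta t x = v.
Proof.
move=> h; have := (cvg_totally_int (fun D => finite_height r eta D t x) v).2
  (ex_intro _ D0 h).
exact: (@cvg_lim _ (@discrete_hausdorff _) _ _ totally_filter).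
Qed.

Definition no_ties r := forall p q : site d * nat, r p.1 p.2 = r q.1 q.2 -> p = q.

(* Mesh of the reference grid: backward chains of length n have expected number
   at most 2 ^ k / 4 ^ n in k slabs of this length. *)
Definition mesh : R := ((2 * d).+1%:R * 8%:R)^-1.

Lemma mesh_gt0 : 0 < mesh. Proof. by rewrite invr_gt0 mulr_gt0// ltr0n. Qed.

Definition ref_grid (i : nat) : R := i%:R * mesh.

Definition unreached r n x k :=
  forall F, F \in cell_chains n x k -> ~ covers r ref_grid F.

(** All pathwise facts are proved under this deterministic condition, which is later shown to hold
    almost surely. *)
Record regular r : Prop := Regular {
  regular_finite : locally_finite r;
  regular_ties : no_ties r;
  regular_unreached : forall x k, exists n, unreached r n x k }.

Lemma no_ties_anti r D t : no_ties r ->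
  {in rings_before r D t &, antisymmetric (ring_le r)}.
Proof. by move=> nt p q _ _ /le_anti/nt. Qed.

Lemma unreached_no_chain r D t n x k : locally_finite r -> t <= k%:R * mesh ->
  unreached r n x k -> ~ has_chain n (ring_sites r D t) x.
Proof.
move=> fr tk un hc; have [F hF cF] := has_chain_covers fr mesh_gt0 tk hc.
exact: un hF cF.
Qed.

(** A larger set of sites only adds updates outside [reach n x], and in the absence of a chain of
    length [n] these can be filtered out by [evolve_local]; so the finite heights are constant
    beyond [D]. *)
Lemma height_local r eta D t n x k : locally_finite r ->
  {in rings_before r D t &, antisymmetric (ring_le r)} -> t <= k%:R * mesh ->
  unreached r n x k -> {subset reach n x <= D} ->
  height r eta t x = evolve eta (ring_sites r D t) x.
Proof.
move=> fr anti tk un sD; apply: (@height_eq _ _ D) => D' DD'.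
rewrite finite_heightE (@evolve_local _ n _ (mem D))//.
  rewrite /ring_sites filter_map -(filter_rings_subset fr DD')//.
exact: unreached_no_chain fr tk un.
Qed.

Lemma exists_slabs (t : R) : exists k : nat, t <= k%:R * mesh.
Proof.
exists (Num.truncn (t / mesh)).+1.
rewrite -ler_pdivrMr ?mesh_gt0//; have [h|/ltW h] := leP 0 (t / mesh).
  by have /andP[_ /ltW] := truncn_itv h.
exact: le_trans h _.
Qed.

(** One [D0] serves all initial states at once, so that two of them can be compared on the same list
    of updates, as in [height_addc]. *)
Lemma regular_height r (xs : seq (site d)) t : regular r ->
  exists D0 : {fset site d}, forall D, (D0 `<=` D)%fset ->
  forall eta, {in xs, height r eta t =1 evolve eta (ring_sites r D t)}.
Proof.
move=> [fr nt un]; have [k tk] := exists_slabs t.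
elim: xs => [|x xs [D0 IH]]; first by exists fset0.
have [n xn] := un x k; exists (D0 `|` [fset y in reach n x])%fset => D.
rewrite fsubUset => /andP[/IH h /fsubsetP sD] eta y; rewrite inE.
case: eqP => [->_|_ /=]; last exact: h.
apply: height_local tk xn _ => //; first exact: no_ties_anti.
by move=> z zx; apply: sD; rewrite inE.
Qed.

Lemma ring_sites_split r D s t : regular r -> s <= t -> exists2 l,
  ring_sites r D t = ring_sites r D s ++ l &
  forall x, x \in l <-> x \in D /\ exists n, 0 <= r x n /\ s <= r x n < t.
Proof.
move=> [fr nt _] st; set L := rings_before r D t.
exists (map fst [seq p <- L | s <= r p.1 p.2]); last first.
  move=> x; split=> [/mapP[[y n]]|[xD [n [h0 /andP[h1 h2]]]]].
    rewrite mem_filter mem_rings_before// => /= /and4P[h1 h2 h3 h4] ->.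
    by split => //; exists n; split => //; rewrite h1.
  by apply/mapP; exists (x, n); rewrite // mem_filter mem_rings_before//= h1 xD h0.
rewrite /ring_sites -map_cat -/L; congr (map _ _).
have -> : rings_before r D s = [seq p <- L | r p.1 p.2 < s].
  symmetry; apply: filter_rings_before.
  - exact: uniq_rings_before.
  - exact: no_ties_anti.
  - exact: sorted_rings_before.
  - move=> p; rewrite !mem_rings_before// -!andbA; case: (p.1 \in D) => //=.
    case: (0 <= r p.1 p.2) => //=; rewrite andbC.
    by case: (ltP (r p.1 p.2) s) => //= ps; rewrite (lt_le_trans ps st).
have: sorted (ring_le r) L by exact: sorted_rings_before.
elim: (L) => //= p q IH; rewrite (path_sortedE (@ring_le_trans _ _ r)) => /andP[pa sq].
have [ps|ps] /= := ltP (r p.1 p.2) s; first by rewrite -IH.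
rewrite (@eq_in_filter _ _ pred0) ?filter_pred0/=.
  congr (_ :: _); symmetry; apply/all_filterP/allP => v vq.
  by apply: le_trans ps _; exact: (allP pa).
move=> v vq /=; apply/negbTE; rewrite -leNgt; apply: le_trans ps _; exact: (allP pa).
Qed.

Lemma regular_height2 r eta s t x y : regular r -> s <= t -> exists D l,
  [/\ x \in D, height r eta s y = evolve eta (ring_sites r D s) y,
      height r eta t x = evolve (evolve eta (ring_sites r D s)) l x &
      forall z, z \in l <-> z \in D /\ exists n, 0 <= r z n /\ s <= r z n < t].
Proof.
move=> gr st; have [D1 h1] := regular_height [:: y] s gr.
have [D2 h2] := regular_height [:: x] t gr.
pose D := (D1 `|` D2 `|` [fset x])%fset.
have [l lE lP] := ring_sites_split D gr st; exists D, l; split => //.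
- by rewrite !inE eqxx orbT.
- by rewrite (h1 D) ?inE// /D -fsetUA fsubsetUl.
- by rewrite (h2 D) ?inE ?lE ?evolve_cat// /D fsetUAC fsubsetUr.
Qed.

Lemma height_mono r eta s t x : regular r -> s <= t ->
  height r eta s x <= height r eta t x.
Proof.
move=> gr st; have [D [l [_ -> -> _]]] := regular_height2 eta x x gr st.
exact: le_evolve.
Qed.

Lemma height_still r eta s t x : regular r -> s <= t ->
  (forall n, ~ (s <= r x n < t)) -> height r eta t x = height r eta s x.
Proof.
move=> gr st nr; have [D [l [_ -> -> lP]]] := regular_height2 eta x x gr st.
by rewrite evolve_notin//; apply/negP => /lP[_ [n [_ /nr]]].
Qed.

Lemma height_ring r eta t x z n : regular r -> 0 <= r x n < t -> z \in adj x ->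
  eta z <= height r eta t x.
Proof.
move=> gr hn zx; have [D0 h] := regular_height [:: x] t gr.
rewrite (h _ (fsubsetUl D0 [fset x]%fset)) ?inE//; apply: evolve_adj => //.
apply/mapP; exists (x, n); rewrite // mem_rings_before//= ?hn ?andbT; last exact: regular_finite.
by rewrite !inE eqxx orbT.
Qed.

Lemma height_ge r eta t x : regular r -> eta x <= height r eta t x.
Proof.
move=> gr; have [D /(_ D (fsubset_refl _) eta x)->] := regular_height [:: x] t gr.
  exact: le_evolve.
by rewrite inE.
Qed.

Lemma height_addc r eta t x (c : int) : regular r ->
  height r (fun y => eta y + c) t x = height r eta t x + c.
Proof.
move=> gr; have [D /(_ D (fsubset_refl _)) h] := regular_height [:: x] t gr.
by rewrite !h ?inE// evolve_shift.
Qed.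

Lemma height_unreached r eta t x n k : regular r -> t <= k%:R * mesh ->
  (forall u v, v \in adj u -> eta v <= eta u + 1) ->
  unreached r n x k -> height r eta t x < eta x + n%:Z.
Proof.
move=> gr tk lip un.
have [D /(_ D (fsubset_refl _) eta x)->] := regular_height [:: x] t gr; last by rewrite inE.
have [m hm] := evolve_le_chain (ring_sites r D t) x lip.
move=> /le_lt_trans; apply; rewrite ltrD2l ltz_nat ltnNge; apply/negP => nm.
(* The chain found has length at least [n]; its first [n] sites form a chain of length exactly [n],
   which [unreached] excludes. *)
apply: (unreached_no_chain (regular_finite gr) tk un (D := D)).
case: hm => p [pm cp pl]; exists (take n p); split.
- by rewrite size_takel ?pm.
- elim: n p x cp {un nm pm pl} => [|n IH] [|y p] x //= /andP[-> /hasP[z zx cz]] /=.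
  by apply/hasP; exists z => //; exact: IH.
- by apply: subseq_trans pl; exact: take_subseq.
Qed.

Lemma new_height_sym (s : site d -> site d) eta x :
  (forall z, z \in adj (s x) <-> exists2 y, y \in adj x & z = s y) ->
  new_height (eta \o s) x = new_height eta (s x).
Proof.
move=> sadj; apply: le_anti; apply/andP; split.
  have [->|[z zx ->]] := new_height_cases (eta \o s) x; first exact: new_height_self.
  by apply: new_height_ge; apply/sadj; exists z.
have [->|[z /sadj[y yx ->] ->]] := new_height_cases eta (s x).
  exact: (new_height_self (eta \o s)).
exact: (new_height_ge (eta \o s) yx).
Qed.

(** An automorphism of the lattice graph carries updates to updates, so moving the clocks and the
    initial state by [s] moves the heights. *)
Lemma height_sym r (s s' : site d -> site d) eta t x : cancel s s' -> cancel s' s ->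
  (forall x z, z \in adj (s x) <-> exists2 y, y \in adj x & z = s y) ->
  regular r -> regular (fun y => r (s y)) ->
  height (fun y => r (s y)) (eta \o s) t x = height r eta t (s x).
Proof.
move=> ss' s's sadj gr gr'.
have [D1 h1] := regular_height [:: x] t gr'.
have [D2 h2] := regular_height [:: s x] t gr.
(* The image of this set under [s] contains [D2], so both limits are attained on matching finite
   sets. *)
pose D := (D1 `|` [fset s' y | y in D2])%fset.
rewrite (h1 D) ?inE ?fsubsetUl// (h2 [fset s y | y in D]%fset) ?inE//; last first.
  apply/fsubsetP => y yD; apply/imfsetP; exists (s' y) => //=.
  by rewrite !inE; apply/orP; right; apply/imfsetP; exists y.
have -> : ring_sites r [fset s y | y in D]%fset t =
    map s (ring_sites (fun y => r (s y)) D t).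
  rewrite /ring_sites -map_comp.
  rewrite [RHS](_ : _ = map fst (map (fun p => (s p.1, p.2))
    (rings_before (fun y => r (s y)) D t))); last by rewrite -map_comp.
  congr (map _ _); apply: (@sorted_eq_in _ (ring_le r)).
  - by move=> p q v _ _ _; exact: ring_le_trans.
  - exact: no_ties_anti (regular_ties gr).
  - exact: sorted_rings_before.
  - rewrite sorted_map; exact: sorted_rings_before.
  - apply: uniq_perm; first exact: uniq_rings_before.
      rewrite map_inj_uniq ?uniq_rings_before// => -[a m] [b n] /= [/(can_inj ss')-> ->//].
    move=> [y n]; rewrite mem_rings_before /=; last exact: regular_finite gr.
    apply/idP/mapP => [/andP[/imfsetP[/= v vD ->] h]|[[v m]]].
      exists (v, n) => //; rewrite mem_rings_before /= ?vD//; exact: regular_finite gr'.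
    rewrite mem_rings_before /=; last exact: regular_finite gr'.
    move=> /andP[vD h] [-> ->]; rewrite h andbT; apply/imfsetP; exists v => //.
elim/last_ind: (ring_sites _ _ _) x {h1 h2} => //= l y IH x.
rewrite map_rcons !evolve_rcons /update (inj_eq (can_inj ss')); case: eqP => // _.
rewrite -new_height_sym //; apply: eq_new_height => z _ /=; exact: IH.
Qed.

End limit_heights.

(** * Measurability and laws of countably valued variables *)

Section countable_valued.
Context {disp : measure_display} {T : measurableType disp}.

Lemma bigcup_count (K : countType) (F : K -> set T) :
  \bigcup_k F k = \bigcup_n (oapp F set0 (pickle_inv n)).
Proof.
apply/seteqP; split => o [k _ ko].
  by exists (choice.pickle k) => //; rewrite pickleK_inv.
by case: (pickle_inv k) ko => // k' ?; exists k'.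
Qed.

Lemma measurable_exists (K : countType) (F : K -> set T) :
  (forall k, measurable (F k)) -> measurable [set o | exists k, F k o].
Proof.
move=> mF; rewrite (_ : [set o | _] = \bigcup_k F k); last first.
  by apply/seteqP; split => [w [k ko]|w [k _ ko]]; exists k.
by rewrite bigcup_count; apply: bigcupT_measurable => n; case: (pickle_inv n) => [k|] /=.
Qed.

Lemma measurable_not (A : set T) : measurable A -> measurable [set o | ~ A o].
Proof. exact: measurableC. Qed.

Lemma measurable_forall (K : countType) (F : K -> set T) :
  (forall k, measurable (F k)) -> measurable [set o | forall k, F k o].
Proof.
move=> mF; rewrite (_ : [set o | _] = [set o | ~ exists k, ~ F k o]).
  by apply/measurable_not/measurable_exists => k; exact/measurable_not.
apply/seteqP; split => o h; first by case=> k; apply; exact: h.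
by move=> k; apply: contrapT => ?; apply: h; exists k.
Qed.

Lemma measurable_and (A B : set T) : measurable A -> measurable B ->
  measurable [set o | A o /\ B o].
Proof. exact: measurableI. Qed.

Lemma measurable_or (A B : set T) : measurable A -> measurable B ->
  measurable [set o | A o \/ B o].
Proof. exact: measurableU. Qed.

Lemma measurable_prop (Q : Prop) : measurable [set _ : T | Q].
Proof.
have [q|q] := pselect Q.
  by rewrite (_ : [set _ | _] = setT)//; apply/seteqP; split.
by rewrite (_ : [set _ | _] = set0)//; apply/seteqP; split.
Qed.

Lemma measurable_imply (A B : set T) : measurable A -> measurable B ->
  measurable [set o | A o -> B o].
Proof.
move=> mA mB; rewrite (_ : [set o | _] = [set o | ~ A o \/ B o]).
  by apply: measurable_or => //; exact: measurable_not.
apply/seteqP; split => o /=; last by case.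
by move=> h; have [a|a] := pselect (A o); [right; exact: h|left].
Qed.

Lemma measurable_has (K : eqType) (s : seq K) (F : K -> set T) :
  (forall k, k \in s -> measurable (F k)) ->
  measurable [set o | exists2 k, k \in s & F k o].
Proof.
move=> mF; rewrite (_ : [set o | _] = \bigcup_(k in [set` s]) F k).
  by apply: fin_bigcup_measurable => //; exact: finite_seq.
by apply/seteqP; split => o [k ks ko]; exists k.
Qed.

(** Meant for countably many values, where level sets suffice; this spares a sigma-algebra on each
    of the discrete types involved (lists, finite sets, counts, integers). *)
Definition dmeas (K : Type) (X : T -> K) :=
  forall k, measurable [set o | X o = k].

Lemma dmeas_set (K : countType) (X : T -> K) (B : set K) : dmeas X ->
  measurable [set o | B (X o)].
Proof.
move=> mX; rewrite (_ : [set o | _] = [set o | exists k, B k /\ X o = k]).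
  apply: measurable_exists => k; apply: measurable_and; [exact: measurable_prop|exact: mX].
by apply/seteqP; split => o /= => [?|[k [? ->]]//]; exists (X o).
Qed.

Lemma dmeas_comp (K : countType) (K' : Type) (f : K -> K') (X : T -> K) :
  dmeas X -> dmeas (fun o => f (X o)).
Proof. by move=> mX k; exact: (dmeas_set [set k' | f k' = k]). Qed.

(** Splitting over the countably many values of [X] reduces a construction that depends on [X] to
    the one with [X] frozen, for instance the evolution along a random list of updates. *)
Lemma dmeas_bind (K : countType) (K' : Type) (X : T -> K) (Y : K -> T -> K') :
  dmeas X -> (forall k, dmeas (Y k)) -> dmeas (fun o => Y (X o) o).
Proof.
move=> mX mY k'.
rewrite (_ : [set o | _] = [set o | exists k, X o = k /\ Y k o = k']).
  by apply: measurable_exists => k; apply: measurable_and; [exact: mX|exact: mY].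
by apply/seteqP; split => o /= => [?|[k [<-]//]]; exists (X o).
Qed.

Lemma dmeas_cst (K : Type) (k : K) : dmeas (fun=> k).
Proof. by move=> k'; exact: measurable_prop. Qed.

Lemma dmeas_op (K1 K2 : countType) (K' : Type) (f : K1 -> K2 -> K') X Y :
  dmeas X -> dmeas Y -> dmeas (fun o => f (X o) (Y o)).
Proof.
move=> mX mY; apply: (dmeas_bind (Y := fun k o => f k (Y o))) => // k.
exact: dmeas_comp.
Qed.

Lemma dmeas_asbool (A : set T) : measurable A -> dmeas (fun o => `[< A o >]).
Proof.
move=> mA b; rewrite (_ : [set o | _] = [set o | A o <-> b]); last first.
  apply/seteqP; split => o /=; first by move=> <-; split => /asboolP.
  by move=> h; apply/asboolP/idP => /h.
apply: measurable_and; apply: measurable_imply => //; exact: measurable_prop.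
Qed.

Lemma dmeas_seq (I : eqType) (K : countType) (s : seq I) (X : I -> T -> K) :
  (forall i, i \in s -> dmeas (X i)) -> dmeas (fun o => [seq X i o | i <- s]).
Proof.
elim: s => [|i s IH] mX /=; first exact: dmeas_cst.
apply: dmeas_op; first by apply: mX; rewrite inE eqxx.
by apply: IH => j js; apply: mX; rewrite inE js orbT.
Qed.

Lemma dmeas_eq (K : Type) (X Y : T -> K) : X =1 Y -> dmeas X -> dmeas Y.
Proof. by move=> /funext->. Qed.

End countable_valued.

Section laws.
Local Open Scope ereal_scope.
Context (R : realType).

Lemma law_sum {d1 : measure_display} {T1 : measurableType d1}
  (m1 : {measure set T1 -> \bar R}) (K : countType) (X : T1 -> K) (B : set K) : dmeas X ->
  m1 [set o | B (X o)] = \sum_(n <oo)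
    oapp (fun k => if k \in B then m1 [set o | X o = k] else 0) 0 (pickle_inv n).
Proof.
move=> mX.
have -> : [set o | B (X o)] = \bigcup_k [set o | B k /\ X o = k].
  by apply/seteqP; split => o /= => [?|[k _ [? ->]]//]; exists (X o).
rewrite bigcup_count measure_semi_bigcup.
- apply: eq_eseriesr => n _; case: (pickle_inv n) => [k|] /=; last by rewrite measure0.
  case: ifPn => [/set_mem Bk|/negP Bk].
    by congr (m1 _); apply/seteqP; split => o /= [].
  rewrite (_ : [set o | _] = set0) ?measure0//.
  by apply/seteqP; split => o //= [/mem_set/Bk].
- move=> n; case: (pickle_inv n) => [k|] //=; apply: measurable_and; [exact: measurable_prop|exact: mX].
- move=> i j _ _ [w []].
  have := @pickle_invK K i; have := @pickle_invK K j.
  case: (pickle_inv i) (pickle_inv j) => [k1|//] [k2|//] /= <- <- [_ <-] [_ <-].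
  by [].
- apply: bigcupT_measurable => n; case: (pickle_inv n) => [k|] //=.
  by apply: measurable_and; [exact: measurable_prop|exact: mX].
Qed.

Lemma law_eq {d1 : measure_display} {T1 : measurableType d1}
    (m1 : {measure set T1 -> \bar R}) {d2 : measure_display} {T2 : measurableType d2}
    (m2 : {measure set T2 -> \bar R}) (K : countType) (X1 : T1 -> K) (X2 : T2 -> K) :
  dmeas X1 -> dmeas X2 ->
  (forall k, m1 [set o | X1 o = k] = m2 [set o | X2 o = k]) ->
  forall B, m1 [set o | B (X1 o)] = m2 [set o | B (X2 o)].
Proof.
move=> mX1 mX2 e B; rewrite !law_sum//; apply: eq_eseriesr => n _; case: (pickle_inv n) => //= k.
by rewrite e.
Qed.

End laws.

Section clock_laws.
Context (R : realType) (disp : measure_display) (T : measurableType disp).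
Variables (P : probability T R) (d : nat) (tau : T -> site d -> nat -> R).
Hypothesis clocks : poisson_clocks P tau.

Lemma measurable_ring_time x n a b :
  measurable [set om | a <= tau om x n < b].
Proof.
rewrite (_ : [set om | _] = setT `&` (fun om => tau om x n) @^-1` `[a, b[%classic).
  by apply: (clock_measurable clocks) => //; exact: measurable_itv.
by apply/seteqP; split => om /=; rewrite ?in_itv //= => -[].
Qed.

(** Equinumerosity quantifies over functions; the same event is a countable union over the finite
    sets [F] of ring indices. *)
Lemma measurable_rings_card x a b k :
  measurable [set om | (rings_in tau x a b om #= `I_k)%card].
Proof.
rewrite (_ : [set om | _] = [set om | exists F : {fset nat},
    #|` F|%fset = k /\ forall n, (a <= tau om x n < b) <-> n \in F]).
  apply: measurable_exists => F; apply: measurable_and; first exact: measurable_prop.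
  apply: measurable_forall => n; apply: measurable_and; apply: measurable_imply;
    solve [exact: measurable_ring_time|exact: measurable_prop].
apply/seteqP; split => om /=.
  move=> h; have fi : finite_set (rings_in tau x a b om) by apply/finite_setP; exists k.
  exists (fset_set (rings_in tau x a b om)); split; first exact: card_fset_set.
  move=> n; rewrite in_fset_set//; split => [h1|/set_mem//]; exact/mem_set.
move=> [F [<- h]]; rewrite (_ : rings_in _ _ _ _ _ = [set` F]).
  by apply/card_eq_fsetP.
by apply/seteqP; split => n /=; rewrite /rings_in /= => /h.
Qed.

Lemma dmeas_nrings x a b : dmeas (fun om => nrings (tau om) x a b).
Proof.
have hk om k : (rings_in tau x a b om #= `I_k)%card -> nrings (tau om) x a b = k.
  exact: card_fset_set.
have h0 om : ~ finite_set (rings_in tau x a b om) -> nrings (tau om) x a b = 0%N.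
  by move=> nf; rewrite /nrings /fset_set; case: pselect.
move=> k; rewrite (_ : [set om | _] = [set om |
  (rings_in tau x a b om #= `I_k)%card \/
  (k = 0%N /\ forall j, ~ (rings_in tau x a b om #= `I_j)%card)]).
  apply: measurable_or; first exact: measurable_rings_card.
  apply: measurable_and; first exact: measurable_prop.
  apply: measurable_forall => j; apply: measurable_not; exact: measurable_rings_card.
apply/seteqP; split => om /=; last first.
  case=> [/hk//|[-> nf]]; apply: h0 => /finite_setP[j]; exact: nf.
have [/finite_setP[j hj]|nf] := pselect (finite_set (rings_in tau x a b om)).
  by rewrite (hk _ _ hj) => <-; left.
rewrite h0// => <-; right; split => // j hj; apply: nf; apply/finite_setP.
by exists j.
Qed.

Lemma dmeas_cell_count u c : dmeas (fun om => cell_count (tau om) u c).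
Proof. exact: dmeas_nrings. Qed.

Lemma poisson_total (a : R) : 0 < a ->
  (\sum_(k <oo) (poisson_pmf a k)%:E = 1)%E.
Proof.
move=> a0; have := @probability_setT _ _ R (poisson_prob a 0%N).
rewrite /= /poisson_prob a0 => <-.
rewrite nneseries_esumT; first reflexivity.
by move=> n; exact: poisson_pmf_ge0.
Qed.

(** The Poisson weights sum to one, which leaves no mass for infinitely many rings. *)
Lemma finite_rings x a b : 0 <= a < b ->
  P [set om | finite_set (rings_in tau x a b om)] = 1%E.
Proof.
move=> ab.
rewrite (_ : [set om | _] = \bigcup_k [set om | (rings_in tau x a b om #= `I_k)%card]).
  rewrite measure_semi_bigcup.
  - rewrite -(poisson_total (a := b - a)) ?subr_gt0; last by case/andP: ab.
    apply: eq_eseriesr => k _.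
    have := @clock_law _ _ _ _ _ _ clocks 1 (fun=> x) (fun=> a) (fun=> b) (fun=> k).
    rewrite big_ord1 => <-//.
    + by congr (P _); apply/seteqP; split => om /= h //; exact: h ord0.
    + by move=> i j; rewrite (ord1 i) (ord1 j) eqxx.
  - by move=> k; exact: measurable_rings_card.
  - move=> i j _ _ [om [/= hi hj]]; apply/card_eq_II.
    by apply: card_eq_trans hj; rewrite card_eq_sym.
  - by apply: bigcupT_measurable => k; exact: measurable_rings_card.
apply/seteqP; split => om /=; first by move=> /finite_setP[k]; exists k.
by move=> [k _ hk]; apply/finite_setP; exists k.
Qed.

Lemma measurable_finite_rings x a b :
  measurable [set om | finite_set (rings_in tau x a b om)].
Proof.
rewrite (_ : [set om | _] = [set om | exists k, (rings_in tau x a b om #= `I_k)%card]).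
  by apply: measurable_exists => k; exact: measurable_rings_card.
by apply/seteqP; split => om /= => [/finite_setP|?]//; apply/finite_setP.
Qed.

Definition infinite_rings : set T :=
  [set om | exists xm : site d * nat,
     ~ finite_set (rings_in tau xm.1 0 xm.2.+1%:R om)].

Lemma infinite_rings_negligible : P.-negligible infinite_rings.
Proof.
exists infinite_rings; split => //.
  by apply: measurable_exists => xm; apply: measurable_not; exact: measurable_finite_rings.
apply/negligibleP.
  by apply: measurable_exists => xm; apply: measurable_not; exact: measurable_finite_rings.
rewrite (_ : infinite_rings = \bigcup_xm
    [set om | ~ finite_set (rings_in tau xm.1 0 xm.2.+1%:R om)]); last first.
  by apply/seteqP; split => [om [xm h]|om [xm _ h]]; exists xm.
rewrite bigcup_count; apply: negligible_bigcup => n.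
case: (pickle_inv n) => [xm|] /=; last exact: negligible_set0.
apply/negligibleP; first by apply: measurable_not; exact: measurable_finite_rings.
transitivity (P (~` [set om | finite_set (rings_in tau xm.1 0 xm.2.+1%:R om)])) => //.
rewrite probability_setC; last exact: measurable_finite_rings.
by rewrite finite_rings ?subee// lexx ltr0n.
Qed.

Lemma infinite_ringsP om : ~ infinite_rings om -> locally_finite (tau om).
Proof.
move=> nf x t; apply: contrapT => h; apply: nf.
exists (x, Num.truncn t) => hf; apply: h.
apply: sub_finite_set hf => n /= /andP[h0 ht]; rewrite /rings_in /= h0 /=.
by apply: lt_trans ht _; exact: truncnS_gt.
Qed.

End clock_laws.

Section ae_measure.
Local Open Scope ereal_scope.
Context (R : realType) (disp : measure_display) (T : measurableType disp).
Variable m : {measure set T -> \bar R}.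

Lemma negligible_le (A B N : set T) : measurable A -> measurable B ->
  m.-negligible N -> (forall o, ~ N o -> A o -> B o) -> m A <= m B.
Proof.
move=> mA mB [N' [mN' N'0 NN']] AB; rewrite -(measureU0 mB mN' N'0).
apply: le_measure; rewrite ?inE//; first exact: measurableU.
move=> o Ao; have [h|h] := pselect (N o); [right; exact: NN'|left; exact: AB].
Qed.

Lemma negligible_eq (A B N : set T) : measurable A -> measurable B ->
  m.-negligible N -> (forall o, ~ N o -> A o <-> B o) -> m A = m B.
Proof.
move=> mA mB hN AB; apply/eqP; rewrite eq_le; apply/andP; split;
  by apply: negligible_le hN _ => // o /AB[].
Qed.

Lemma le_or (A B C : set T) : measurable A -> measurable B -> measurable C ->
  (forall o, A o -> B o \/ C o) -> m A <= m B + m C.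
Proof.
move=> mA mB mC ABC; apply: (@le_trans _ _ (m (B `|` C))); last exact: measureU2.
by apply: le_measure; rewrite ?inE//; exact: measurableU.
Qed.

Lemma le_has (K : eqType) (s : seq K) (F : K -> set T) (b : \bar R) :
  (forall k, k \in s -> measurable (F k)) -> (forall k, k \in s -> m (F k) <= b) ->
  m [set o | exists2 k, k \in s & F k o] <= \sum_(k <- s) b.
Proof.
elim: s => [|k s IH] mF Fb.
  rewrite big_nil (_ : [set o | _] = set0) ?measure0//.
  by apply/seteqP; split => o // [].
rewrite big_cons. apply: (@le_trans _ _ (m (F k) + m [set o | exists2 k, k \in s & F k o])).
  apply: le_or => //.
  - exact: measurable_has.
  - by apply: mF; rewrite inE eqxx.
  - by apply: measurable_has => j js; apply: mF; rewrite inE js orbT.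
  - move=> o [j]; rewrite inE => /orP[/eqP->|js]; [by left|by right; exists j].
apply: leeD; first by apply: Fb; rewrite inE eqxx.
by apply: IH => j js; [apply: mF|apply: Fb]; rewrite inE js orbT.
Qed.

End ae_measure.

(** * Joint laws of ring counts *)

Section count_laws.
Context (R : realType) (disp : measure_display) (T : measurableType disp).
Variables (P : probability T R) (d : nat) (tau : T -> site d -> nat -> R).
Hypothesis clocks : poisson_clocks P tau.
Implicit Types (u : nat -> R) (cs F : seq (site d * nat)) (ks ms : seq nat).

Definition counts u cs (om : T) : seq nat := [seq cell_count (tau om) u c | c <- cs].

Lemma dmeas_counts u cs : dmeas (counts u cs).
Proof. by apply: dmeas_seq => c _; exact: (dmeas_cell_count clocks). Qed.

Definition pmf_prod u cs ks : R :=
  \prod_(p <- zip cs ks) poisson_pmf (u p.1.2.+1 - u p.1.2) p.2.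

Definition below k cs := all (fun c : site d * nat => (c.2 < k)%N) cs.

(** Distinct cells at one site lie in different slabs, so [clock_law] applies. It speaks of
    equinumerous sets, which amounts to equality of counts off the null event of infinitely many
    rings. *)
Lemma law_counts u K cs ks : increasing_upto u K -> uniq cs -> below K cs ->
  P [set om | counts u cs om = ks] =
  (if size ks == size cs then pmf_prod u cs ks else 0)%:E.
Proof.
move=> iu ucs /allP bcs; case: eqP => [sk|sk]; last first.
  rewrite (_ : [set om | _] = set0) ?measure0//.
  by apply/seteqP; split => // om /= h; apply: sk; rewrite -h size_map.
case: cs ucs bcs sk => [|c0 cs0] ucs bcs sk.
  case: ks sk => // _; rewrite /pmf_prod big_nil (_ : [set om | _] = setT).
    exact: probability_setT.
  by apply/seteqP; split.
set cs := c0 :: cs0 in ucs bcs sk *; set m := size cs.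
pose C (i : 'I_m) := nth c0 cs i.
have Ccs i : C i \in cs by exact: mem_nth.
have ui0 i : (i <= K)%N -> 0 <= u i.
  by move=> iK; apply: le_trans iu.1 (increasing_upto_le iu _); rewrite leq0n.
have c1 i : 0 <= u (C i).2 < u (C i).2.+1.
  have ci := bcs _ (Ccs i).
  by rewrite iu.2// ui0// ltnW.
have c2 i j : i != j -> (C i).1 = (C j).1 ->
    u (C i).2.+1 <= u (C j).2 \/ u (C j).2.+1 <= u (C i).2.
  move=> ij e; have : (C i).2 != (C j).2.
      apply: contra ij => /eqP e2; rewrite -(inj_eq val_inj) /=.
      rewrite -(nth_uniq c0 (ltn_ord i) (ltn_ord j) ucs); apply/eqP.
      by move: e e2; rewrite /C; case: (nth c0 cs i) (nth c0 cs j) => [? ?] [? ?] /= -> ->.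
    rewrite neq_ltn => /orP[h|h]; [left|right]; apply: (increasing_upto_le iu);
      by rewrite h ltnW// bcs.
rewrite (_ : pmf_prod u cs ks = \prod_(i < m)
    poisson_pmf (u (C i).2.+1 - u (C i).2) (nth 0%N ks i)); last first.
  rewrite /pmf_prod (big_nth (c0, 0%N)) size1_zip ?sk// big_mkord.
  by apply: eq_bigr => i _; rewrite nth_zip ?sk.
rewrite -(@clock_law _ _ _ _ _ _ clocks m _ _ _ _ c1 c2).
apply: (negligible_eq (N := infinite_rings tau)).
  - exact: dmeas_counts.
  - apply: measurable_forall => i; exact: (measurable_rings_card clocks).
  - exact: (infinite_rings_negligible clocks).
  - move=> om /infinite_ringsP lf.
    have h i : (rings_in tau (C i).1 (u (C i).2) (u (C i).2.+1) om
       #= `I_(cell_count (tau om) u (C i)))%card.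
      have fi : finite_set (rings_in tau (C i).1 (u (C i).2) (u (C i).2.+1) om).
        by apply: locally_finite_sub => //; apply: ui0; rewrite ltnW// bcs.
      by case/finite_setP: (fi) => k hk; rewrite /cell_count /nrings (card_fset_set hk).
    split=> [E i|E].
      rewrite (_ : nth 0%N ks i = cell_count (tau om) u (C i)); first exact: h.
      by rewrite -E (nth_map c0).
    apply: (@eq_from_nth _ 0%N); first by rewrite size_map sk.
    rewrite size_map => i im; rewrite (nth_map c0)//.
    apply/card_eq_II; apply: card_eq_trans (E (Ordinal im)).
    by apply: card_esym; exact: (h (Ordinal im)).
Qed.

(** Removing j of the k rings: a ^ j <= delta ^ j and k! >= (k - j)!. *)
Lemma poisson_pmf_shift (a delta : R) k j : 0 < a -> a <= delta -> (j <= k)%N ->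
  poisson_pmf a k <= delta ^+ j * poisson_pmf a (k - j).
Proof.
move=> a0 ad jk; rewrite /poisson_pmf a0 -{1}(subnKC jk) exprD !mulrA.
rewrite ler_pM2r ?expR_gt0//; apply: ler_pM.
- by rewrite mulr_ge0// exprn_ge0// ltW.
- by rewrite invr_ge0.
- rewrite ler_pM2r ?exprn_gt0//; apply: lerXn2r; rewrite ?nnegrE ?(ltW a0)//.
  exact: le_trans (ltW a0) ad.
- rewrite lef_pV2 ?posrE ?ltr0n ?fact_gt0// ler_nat.
  by apply: leq_fact; rewrite leq_subr.
Qed.

Lemma pmf_prod_shift u K (delta : R) cs ks ms : increasing_upto u K -> below K cs ->
  (forall i, (i < K)%N -> u i.+1 - u i <= delta) -> 0 <= delta ->
  size ks = size cs -> size ms = size cs ->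
  all2 leq ms ks ->
  pmf_prod u cs ks <= delta ^+ sumn ms * pmf_prod u cs [seq (p.1 - p.2)%N | p <- zip ks ms].
Proof.
move=> iu + ud d0; elim: cs ks ms => [|c cs IH] [|k ks] [|j ms] //=.
  by rewrite /pmf_prod /= !big_nil expr0 mulr1.
move=> /andP[cK bK] [sk] [sm] /andP[jk le].
have pp ks' : 0 <= pmf_prod u cs ks'.
  by apply: prodr_ge0 => p _; exact: poisson_pmf_ge0.
rewrite /pmf_prod /= !big_cons exprD mulrACA; apply: ler_pM.
- exact: poisson_pmf_ge0.
- exact: pp.
- by apply: poisson_pmf_shift => //; [rewrite subr_gt0 iu.2|exact: ud].
- exact: IH.
Qed.

(** Count vectors that dominate the multiplicities are lowered by them. By [pmf_prod_shift] this
    costs a factor [delta] per required ring, and since lowering is injective the new vectors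
    describe disjoint events, whose probabilities add up to at most one. *)
Lemma covers_le u K (delta : R) F : increasing_upto u K -> below K F ->
  (forall i, (i < K)%N -> u i.+1 - u i <= delta) -> 0 <= delta ->
  (P [set om | covers (tau om) u F] <= (delta ^+ size F)%:E)%E.
Proof.
move=> iu bF ud d0; set cs := undup F; set ms := [seq count_mem c F | c <- cs].
have ucs : uniq cs by exact: undup_uniq.
have bcs : below K cs by apply/allP => c; rewrite mem_undup => /(allP bF).
have sms : sumn ms = size F.
  rewrite -(perm_size (perm_count_undup F)) size_flatten /shape -map_comp.
  by congr sumn; apply: eq_map => c /=; rewrite size_nseq.
pose B := [set ks | size ks = size cs /\ all2 leq ms ks].
rewrite (_ : [set om | _] = [set om | B (counts u cs om)]); last first.
  have hc om cs' : all2 leq [seq count_mem c F | c <- cs'] (counts u cs' om) =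
      all (fun c => count_mem c F <= cell_count (tau om) u c)%N cs'.
    by elim: cs' => //= c cs' ->.
  apply/seteqP; split => om /=; rewrite /B /= size_map hc.
    by move=> h; split => //; apply/allP => c; rewrite mem_undup => /h.
  by move=> [_ /allP h] c; rewrite -mem_undup => /h.
pose sub ks := [seq (p.1 - p.2)%N | p <- zip ks ms].
have size_sub ks : size ks = size cs -> size (sub ks) = size cs.
  by move=> h; rewrite size_map size1_zip// h size_map.
have law_le ks : B ks -> (P [set om | counts u cs om = ks] <=
    (delta ^+ size F)%:E * P [set om | counts u cs om = sub ks])%E.
  move=> [sk le]; rewrite !(law_counts _ iu)// size_sub// sk eqxx -EFinM lee_fin.
  rewrite -sms; apply: (pmf_prod_shift iu bcs ud d0 sk _ le).
  by rewrite /ms size_map.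
have sub_inj k1 k2 : B k1 -> B k2 -> sub k1 = sub k2 -> k1 = k2.
  have : size ms = size cs by rewrite size_map.
  rewrite /B /sub /= => <- [s1 h1] [s2 h2].
  elim: (ms) k1 k2 s1 s2 h1 h2 => [|j ms' IH] [|a k1] [|b k2] //=.
  move=> [s1] [s2] /andP[ja h1] /andP[jb h2] [e1 e2]; congr (_ :: _); last exact: IH.
  by move: e1 ja jb; lia.
rewrite (law_sum P B (dmeas_counts u cs)).
pose G n := oapp (fun ks => [set om | B ks /\ counts u cs om = sub ks]) set0 (pickle_inv n).
have mG n : measurable (G n).
  rewrite /G; case: (pickle_inv n) => [ks|] //=; apply: measurable_and.
    exact: measurable_prop.
  exact: dmeas_counts.
apply: (@le_trans _ _ (\sum_(n <oo) (delta ^+ size F)%:E * P (G n))%E).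
  apply: lee_nneseries => n _.
    by case: (pickle_inv n) => //= ks; case: ifP.
  rewrite /G; case: (pickle_inv n) => [ks|] /=; last by rewrite measure0 mule0.
  case: ifPn => [/set_mem Bk|_]; last by rewrite mule_ge0// lee_fin exprn_ge0.
  rewrite (_ : [set om | B ks /\ _] = [set om | counts u cs om = sub ks]); first exact: law_le.
  by apply/seteqP; split => om /= [].
rewrite nneseriesZl// -[leRHS]mule1; apply: lee_wpmul2l.
  by rewrite lee_fin exprn_ge0.
rewrite -measure_semi_bigcup//.
- by apply: probability_le1; exact: bigcupT_measurable.
- move=> i j _ _ [w []]; rewrite /G.
  have := @pickle_invK (seq nat) i; have := @pickle_invK (seq nat) j.
  case: (pickle_inv i) (pickle_inv j) => [k1|//] [k2|//] /= <- <- [B1 ->] [B2 /sub_inj->//].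
- exact: bigcupT_measurable.
Qed.

End count_laws.

(** * Almost sure regularity *)

Section almost_sure_regularity.
Context (R : realType) (disp : measure_display) (T : measurableType disp).
Variables (P : probability T R) (d : nat) (tau : T -> site d -> nat -> R).
Hypothesis clocks : poisson_clocks P tau.
Implicit Types (u : nat -> R) (D : {fset site d}).

Lemma measurable_covers u F : measurable [set om | covers (tau om) u F].
Proof.
apply: measurable_forall => c; apply: measurable_imply; first exact: measurable_prop.
exact: (dmeas_set (fun k => (count_mem c F <= k)%N) (dmeas_cell_count clocks u c)).
Qed.

Lemma ref_grid_increasing k : increasing_upto (@ref_grid R d) k.
Proof.
split=> [|i _]; first by rewrite /ref_grid mul0r.
by rewrite /ref_grid ltr_pM2r ?mesh_gt0// ltr_nat.
Qed.

Definition reached n x k : set T := [set om | exists2 F, F \in cell_chains n x k &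
  covers (tau om) (@ref_grid R d) F].

Lemma measurable_reached n x k : measurable (reached n x k).
Proof. by apply: measurable_has => F _; exact: measurable_covers. Qed.

Lemma reached_le n x k : (P (reached n x k) <= (2 ^+ k / 4 ^+ n)%:E)%E.
Proof.
have h : (P (reached n x k) <= \sum_(F <- cell_chains n x k) ((@mesh R d) ^+ n)%:E)%E.
  apply: le_has => F Fc; first exact: measurable_covers.
  rewrite -(size_cell_chain Fc); apply: covers_le => //.
  - exact: (ref_grid_increasing k).
  - by apply/allP => c cF; exact: cell_chain_lt Fc _ cF.
  - by move=> i _; rewrite /ref_grid -mulrBl -natrB// subSnn mul1r.
  - exact/ltW/mesh_gt0.
apply: le_trans h _; rewrite sumEFin lee_fin big_const_seq count_predT iter_addr_0.
rewrite -[X in X <= _]mulr_natl.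
apply: (@le_trans _ _ (((2 * d).+1 ^ n * 2 ^ (n + k))%:R * @mesh R d ^+ n)).
  rewrite ler_pM2r ?exprn_gt0 ?mesh_gt0// ler_nat; exact: size_cell_chains.
rewrite natrM !natrX /mesh exprVn exprMn exprD le_eqVlt; apply/orP; left; apply/eqP.
have -> : (8 : R) ^+ n = 2 ^+ n * 4 ^+ n.
  by rewrite -exprMn; congr (_ ^+ _); rewrite -natrM.
have a0 : ((2 * d).+1%:R : R) ^+ n != 0 by rewrite expf_neq0 ?pnatr_eq0.
have b0 : (2 : R) ^+ n != 0 by rewrite expf_neq0 ?pnatr_eq0.
have c0 : (4 : R) ^+ n != 0 by rewrite expf_neq0 ?pnatr_eq0.
by field; rewrite a0 b0 c0.
Qed.

Definition not_sparse u D k : set T := [set om | ~ sparse (tau om) u D k].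

Lemma measurable_not_sparse u D k : measurable (not_sparse u D k).
Proof.
apply: measurable_not; apply: measurable_forall => i.
apply: measurable_imply; first exact: measurable_prop.
apply: measurable_forall => x; apply: measurable_forall => y.
do 2 (apply: measurable_imply; first exact: measurable_prop).
apply: measurable_not; exact: measurable_covers.
Qed.

(** Two rings in one slab cost [delta ^+ 2] for each pair of sites. With a number of slabs of order
    1 / delta, the union bound vanishes as the grid is refined. *)
Lemma not_sparse_le u D k (delta : R) : increasing_upto u k -> 0 <= delta ->
  (forall i, (i < k)%N -> u i.+1 - u i <= delta) ->
  (P (not_sparse u D k) <= (k%:R * (#|` D|%:R ^+ 2 * delta ^+ 2))%:E)%E.
Proof.
move=> iu d0 ud.
pose s := [seq (i, xy) | i <- iota 0 k, xy <- [seq (x, y) | x <- D, y <- D]].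
pose G (v : nat * (site d * site d)) :=
  [set om | covers (tau om) u [:: (v.2.1, v.1); (v.2.2, v.1)]].
rewrite (_ : not_sparse u D k = [set om | exists2 v, v \in s & G v om]).
  apply: le_trans (@le_has _ _ _ _ _ s G (delta ^+ 2)%:E _ _) _.
  - by move=> v _; exact: measurable_covers.
  - move=> [i [x y]] /allpairsP[[j xy] /= [+ _ [-> _]]]; rewrite mem_iota /= => jk.
    apply: (covers_le clocks iu (F := [:: _; _])) => //.
    by rewrite /below /= jk.
  - rewrite sumEFin lee_fin big_const_seq count_predT iter_addr_0.
    by rewrite !size_allpairs size_iota -[X in X <= _]mulr_natl !natrM !expr2 !mulrA.
apply/seteqP; split => om /=.
  move=> h; apply: contrapT => h2; apply: h => i ik x y xD yD c; apply: h2.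
  exists (i, (x, y)) => //; apply/allpairsP; exists (i, (x, y)); split => //=.
    by rewrite mem_iota.
  by apply/allpairsP; exists (x, y).
move=> [[i [x y]] /allpairsP[[j xy] /= [ji + [-> ->]]]].
move=> /allpairsP[[x' y'] /= [xD yD ->]] c h; move: ji; rewrite mem_iota /= => jk.
exact: h jk _ _ xD yD c.
Qed.

Definition fine_grid u D k (e : R) := exists2 delta : R, 0 <= delta /\
  (forall i, (i < k)%N -> u i.+1 - u i <= delta)
  & k%:R * (#|` D|%:R ^+ 2 * delta ^+ 2) <= e.

Lemma fine_not_sparse u D k e : increasing_upto u k -> fine_grid u D k e ->
  (P (not_sparse u D k) <= e%:E)%E.
Proof.
move=> iu [delta [d0 ud] le]; apply: le_trans (not_sparse_le D iu d0 ud) _.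
by rewrite lee_fin.
Qed.

Lemma fine_grid_sub u D k k0 k1 e (s : R) : fine_grid u D k e -> (k0 + k1 <= k)%N ->
  fine_grid (fun i => u (k0 + i)%N - s) D k1 e.
Proof.
move=> [delta [d0 ud] le] kk; exists delta; first split=> // i ik.
  by rewrite addnS opprB addrA subrK ud//; apply: leq_trans kk; rewrite ltn_add2l.
apply: le_trans le; apply: ler_wpM2r; first by rewrite mulr_ge0// exprn_ge0// ler0n.
by rewrite ler_nat (leq_trans _ kk)// leq_addl.
Qed.

(** Passing through both [s] and [s + t], the grid splits into one for each of the two time
    intervals of the Markov property. *)
Lemma exists_grid (s t : R) D (e : R) : 0 <= s -> 0 <= t -> 0 < e ->
  exists u k1 k2, [/\ u 0%N = 0, u k1 = s, u (k1 + k2)%N = s + t,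
    increasing_upto u (k1 + k2) & fine_grid u D (k1 + k2) e].
Proof.
move=> s0 t0 e0; set c : R := #|` D|%:R ^+ 2.
set b : R := s + t + 1; have b0 : 0 < b by rewrite ltr_wpDl ?addr_ge0.
(* At most 2 N slabs of length at most b / N give the bound 2 c b ^ 2 / N in [fine_grid], which is
   below e for this N. *)
pose N := (Num.truncn (2 * c * b ^+ 2 / e)).+1.
have N0 : 0 < N%:R :> R by rewrite ltr0n.
have Nne : N%:R != 0 :> R by rewrite gt_eqF.
(* Grids are strictly increasing, so a time interval of length zero receives no slab at all. *)
pose k1 := if s == 0 then 0%N else N; pose k2 := if t == 0 then 0%N else N.
pose u (i : nat) : R := if (i < k1)%N then i%:R * (s / N%:R)
  else s + (i - k1)%:R * (t / N%:R).
have uk1 : u k1 = s by rewrite /u ltnn subnn mul0r addr0.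
have u0 : u 0%N = 0.
  rewrite /u /k1; case: eqP => [->|_] /=; first by rewrite sub0n mul0r addr0.
  by rewrite mul0r.
have uk2 : u (k1 + k2)%N = s + t.
  rewrite /u ltnNge leq_addr /= addKn /k2; case: eqP => [->|_].
    by rewrite mul0r.
  by congr (_ + _); field.
have du i : (i < k1 + k2)%N -> 0 < u i.+1 - u i /\ u i.+1 - u i <= b / N%:R.
  move=> ik; have [ik1|ik1] := ltnP i k1.
    have sp : 0 < s.
      by move: ik1; rewrite /k1 lt_neqAle s0 andbT eq_sym; case: eqP.
    have kN : k1 = N by rewrite /k1 gt_eqF.
    have -> : u i.+1 = i.+1%:R * (s / N%:R).
      have [h|h] := ltnP i.+1 k1; first by rewrite /u h.
      have -> : i.+1 = k1 by apply/eqP; rewrite eqn_leq ik1.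
      by rewrite uk1 kN; field.
    rewrite /u ik1 -mulrBl -natrB// subSnn mul1r; split; first by rewrite divr_gt0.
    by rewrite ler_pM2r ?invr_gt0// /b; lra.
  have k20 : (0 < k2)%N by move: ik; lia.
  have tp : 0 < t.
    by move: k20; rewrite /k2 lt_neqAle t0 andbT eq_sym; case: eqP.
  rewrite /u !ltnNge ik1 leqW//= opprD addrACA subrr add0r -mulrBl -natrB ?leq_sub//.
  have -> : (i.+1 - k1 - (i - k1))%N = 1%N by lia.
  rewrite mul1r; split; first by rewrite divr_gt0.
  by rewrite ler_pM2r ?invr_gt0// /b; lra.
have iu : increasing_upto u (k1 + k2).
  split=> [|i /du[+ _]]; first by rewrite u0.
  by rewrite subr_gt0.
exists u, k1, k2; split => //.
have bN : 0 <= b / N%:R by rewrite divr_ge0// ltW.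
exists (b / N%:R); first by split=> // i /du[].
rewrite -/c; apply: (@le_trans _ _ ((N + N)%:R * (c * (b / N%:R) ^+ 2))).
  apply: ler_wpM2r; first by rewrite mulr_ge0// exprn_ge0// ler0n.
  rewrite ler_nat; apply: leq_add; rewrite /k1 /k2; case: ifP => //.
have -> : (N + N)%:R * (c * (b / N%:R) ^+ 2) = 2 * c * b ^+ 2 / N%:R :> R.
  by rewrite natrD; field.
rewrite ler_pdivrMr// [leRHS]mulrC -ler_pdivrMr//; apply: ltW.
exact: truncnS_gt.
Qed.

Lemma measure_small0 (A : set T) :
  (forall e : R, 0 < e -> (P A <= e%:E)%E) -> P A = 0%E.
Proof.
move=> h; apply/eqP; rewrite -measure_le0; apply/lee_addgt0Pr => e e0.
by rewrite add0e; exact: h.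
Qed.

Lemma measurable_time_eq x n y m : measurable [set om | tau om x n = tau om y m].
Proof.
rewrite (_ : [set om | _] = setT `&` (fun om => tau om x n == tau om y m) @^-1` [set true]).
  by apply: measurable_fun_eqr => //; exact: (clock_measurable clocks).
by apply/seteqP; split => om /= => [->|[_ /eqP]//]; rewrite eqxx.
Qed.

(** A tie before time m contradicts sparsity of every grid of [0, m] for the sites concerned, and on
    fine grids the failure of sparsity is arbitrarily unlikely. *)
Lemma tie_negligible (p q : site d * nat) (m : nat) : p <> q -> P.-negligible
  [set om | tau om p.1 p.2 = tau om q.1 q.2 /\ 0 <= tau om p.1 p.2 < m%:R].
Proof.
move=> pq; set A := [set om | _].
have mA : measurable A.
  apply: measurable_and; first exact: measurable_time_eq.
  exact: (measurable_ring_time clocks).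
apply/negligibleP => //; apply: measure_small0 => e e0.
have [u [k1 [k2 [u0 _ uk iu ns]]]] :=
  exists_grid [fset p.1; q.1]%fset (lexx 0) (ler0n R m) e0.
apply: le_trans (fine_not_sparse iu ns); apply: (negligible_le (N := infinite_rings tau)) => //.
- exact: measurable_not_sparse.
- exact: (infinite_rings_negligible clocks).
- move=> om /infinite_ringsP lf [epq h] sp; apply: pq.
  have [_ anti] := grid_list_rings lf iu u0 sp.
  apply: anti; rewrite ?mem_rings_before// ?uk ?add0r ?inE ?eqxx ?orbT//=.
  - by rewrite -epq.
  - by rewrite /ring_le epq lexx.
Qed.

Definition irregular : set T := [set om | ~ regular (tau om)].

Lemma irregular_negligible : P.-negligible irregular.
Proof.
pose A (v : (site d * nat) * (site d * nat) * nat) := [set om | v.1.1 <> v.1.2 /\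
  (tau om v.1.1.1 v.1.1.2 = tau om v.1.2.1 v.1.2.2 /\
   0 <= tau om v.1.1.1 v.1.1.2 < v.2%:R)].
pose C (v : site d * nat) := [set om | forall n, reached n v.1 v.2 om].
apply: (@negligibleS _ _ _ _ (infinite_rings tau `|` (\bigcup_v A v `|` \bigcup_v C v))).
  move=> om nr; apply: contrapT => /not_orP[lf /not_orP[nt nu]]; apply: nr; split.
  - exact: infinite_ringsP.
  - move=> p q e; apply: contrapT => pq; apply: nt.
    exists (p, q, (Num.truncn (tau om p.1 p.2)).+1) => //; split => //; split => //=.
    by rewrite (clock_ge0 clocks) truncnS_gt.
  - move=> x k; apply: contrapT => h; apply: nu; exists (x, k) => // n /=.
    apply: contrapT => nh; apply: h; exists n => F Fc cF; apply: nh.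
    by exists F.
apply: negligibleU; first exact: (infinite_rings_negligible clocks).
apply: negligibleU; rewrite bigcup_count; apply: negligible_bigcup => i.
  case: (pickle_inv i) => [v|] /=; last exact: negligible_set0.
  have [e|e] := pselect (v.1.1 = v.1.2).
    by rewrite (_ : A v = set0); [exact: negligible_set0|apply/seteqP; split => // om []].
  by apply: negligibleS (tie_negligible v.2 e) => om [].
case: (pickle_inv i) => [v|] /=; last exact: negligible_set0.
have mC : measurable (C v).
  by apply: measurable_forall => n; exact: measurable_reached.
apply/negligibleP => //; apply: measure_small0 => e e0.
(* The bound 2 ^ k / 4 ^ n, with k = [v.2], is at most e because 4 ^ n >= n >= 2 ^ k / e. *)
pose n := (Num.truncn (2 ^+ v.2 / e)).+1.
apply: (@le_trans _ _ (P (reached n v.1 v.2))).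
  apply: le_measure; rewrite ?inE//; first exact: measurable_reached.
apply: le_trans (reached_le _ _ _) _; rewrite lee_fin.
rewrite ler_pdivrMr ?exprn_gt0// [leRHS]mulrC -ler_pdivrMr//.
apply: (@le_trans _ _ n%:R); first exact/ltW/truncnS_gt.
by rewrite -natrX ler_nat ltnW// ltn_expl.
Qed.

End almost_sure_regularity.

(** * Cylinders and the Borel sets of the height space *)

Section height_space_measurability.
Variable d : nat.
Implicit Type F : seq (site d * int).

Definition cylinder F : set (height_space d) :=
  [set eta | forall p, p \in F -> eta p.1 = p.2].

(** Agreement with [eta] on finite lists of sites defines a filter that converges to [eta] in every
    coordinate, hence in the product topology; so an open set around [eta] contains a member of
    it. *)
Lemma open_cylinder (U : set {ptws site d -> int}) (eta : {ptws site d -> int}) :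
  open U -> U eta ->
  exists xs : seq (site d), forall eta' : site d -> int, {in xs, eta' =1 eta} -> U eta'.
Proof.
move=> oU Ueta.
pose B (xs : seq (site d)) : set {ptws site d -> int} :=
  fun g : site d -> int => {in xs, g =1 (eta : site d -> int)}.
pose G := filter_from setT B.
have FG : Filter G.
  apply: filter_fromT_filter; first by exists [::].
  move=> xs ys; exists (xs ++ ys) => g /= h; split => x xin; apply: h;
    by rewrite mem_cat xin ?orbT.
have : G --> eta.
  apply/cvg_sup => x A; rewrite nbhsE => -[V [[W oW <-] Vx] VA].
  exists [:: x] => // g gx; apply: VA => /=.
  by rewrite gx ?inE.
move=> /(_ U); case; first by apply: open_nbhs_nbhs.
by move=> xs _ h; exists xs => eta' e; apply: h.
Qed.

(** There are only countably many tables [F], so this makes the coordinates generate the Borel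
    sigma-algebra. *)
Lemma open_bigcup_cylinder (U : set {ptws site d -> int}) : open U ->
  U = \bigcup_(F in [set F | cylinder F `<=` U]) cylinder F.
Proof.
move=> oU; apply/seteqP; split => eta.
  move=> Ueta; have [xs h] := open_cylinder oU Ueta.
  exists [seq (x, eta x) | x <- xs]; last by move=> p /mapP[x _ ->].
  move=> eta' c; apply: h => x xs1.
  by apply: (c (x, eta x)); apply/mapP; exists x.
by move=> [F FU cF]; exact: FU.
Qed.

Lemma dmeas_coord (x : site d) : dmeas (fun eta : height_space d => eta x).
Proof.
move=> v; apply: sub_sigma_algebra.
apply: (@open_comp {ptws site d -> int} int (fun f => f x) [set v]).
  by move=> f _; exact: (@proj_continuous (site d) (fun=> int) x f).
exact: discrete_open.
Qed.

Lemma measurable_cylinder F : measurable (cylinder F).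
Proof.
apply: measurable_forall => p; apply: measurable_imply; first exact: measurable_prop.
exact: dmeas_coord.
Qed.

Lemma measurable_height_space_fun (disp : measure_display) (T : measurableType disp)
    (f : T -> height_space d) : (forall x, dmeas (fun o => f o x)) ->
  measurable_fun setT f.
Proof.
move=> mf; apply: (@measurability _ _ _ _ setT f (@open {ptws site d -> int})) => //.
move=> _ [U oU <-]; rewrite setTI.
rewrite (_ : f @^-1` U = [set o | exists F, cylinder F `<=` U /\
    forall p, p \in F -> f o p.1 = p.2]).
  apply: measurable_exists => F; apply: measurable_and; first exact: measurable_prop.
  apply: measurable_forall => p; apply: measurable_imply; first exact: measurable_prop.
  exact: mf.
apply/seteqP; split => o /=; last by move=> [F [FU h]]; exact: FU.
by rewrite {1}(open_bigcup_cylinder oU) => -[F FU cF]; exists F.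
Qed.

(** Cylinders are stable under intersection, by concatenation of their tables, and generate the
    Borel sets by [open_bigcup_cylinder]. *)
Lemma height_space_measure_unique (R : realType)
    (m1 m2 : probability (height_space d) R) :
  (forall F, m1 (cylinder F) = m2 (cylinder F)) ->
  forall A, measurable A -> m1 A = m2 A.
Proof.
move=> m12 A mA.
apply: (@g_sigma_algebra_measure_unique _ R (height_space d) (range cylinder)
  _ (fun=> cylinder [::])).
- by move=> _ [F _ <-]; exact: measurable_cylinder.
- by move=> _; exists [::].
- by apply/seteqP; split => // eta _; exists 0%N.
- move=> _ _ [F _ <-] [F' _ <-]; exists (F ++ F') => //.
  apply/seteqP; split => eta.
    by move=> h; split => p pF; apply: h; rewrite mem_cat pF ?orbT.
  by move=> [h1 h2] p; rewrite mem_cat => /orP[/h1|/h2].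
- by move=> _ [F _ <-]; exact: m12.
- move=> k; apply: (@le_lt_trans _ _ 1%E); last exact: ltry.
  by apply: probability_le1; exact: measurable_cylinder.
move: A mA; apply: smallest_sub; first exact: smallest_sigma_algebra.
move=> U oU; rewrite (open_bigcup_cylinder oU).
rewrite bigcup_mkcond bigcup_count.
apply: (@sigma_algebra_bigcup _ _ _ (fun i => _)) => i.
case: (pickle_inv i) => [F|] /=; last exact: sigma_algebra0.
case: ifP => _; last exact: sigma_algebra0.
by apply: sub_sigma_algebra; exists F.
Qed.

End height_space_measurability.

Lemma eq_in_sort (T : eqType) (e e' : rel T) (s : seq T) :
  {in s &, e =2 e'} -> sort e s = sort e' s.
Proof.
move=> h; have := allss s => /all_sigP[s' sE]; rewrite sE !sort_map.
congr (map _ _); congr (sort _ _); apply/funext => x; apply/funext => y /=.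
by apply: h; [exact: (svalP x)|exact: (svalP y)].
Qed.

Section height_measurability.
Context {disp : measure_display} {T : measurableType disp}.
Variables (R : realType) (d : nat).
Variables (eta : T -> site d -> int) (tau : T -> site d -> nat -> R).
Hypothesis meta : forall x, dmeas (fun o => eta o x).
Hypothesis mle : forall p q : site d * nat,
  measurable [set o | tau o p.1 p.2 <= tau o q.1 q.2].
Hypothesis mwin : forall x n t, measurable [set o | 0 <= tau o x n < t].

Lemma dmeas_evolve l x : dmeas (fun o => evolve (eta o) l x).
Proof.
elim/last_ind: l x => [|l y IH] x; first exact: meta.
apply: (@dmeas_eq _ _ _ (fun o => if x == y then new_height (evolve (eta o) l) y
    else evolve (eta o) l x)).
  by move=> o; rewrite evolve_rcons.
case: (x == y); last exact: IH.
rewrite /new_height.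
apply: (@dmeas_eq _ _ _ (fun o => foldr Num.max (evolve (eta o) l y + 1)
  [seq Num.max (evolve (eta o) l (y + unit_vec i)) (evolve (eta o) l (y - unit_vec i))
     | i <- enum 'I_d])).
  by move=> o; rewrite foldrE big_map big_enum.
have mX : dmeas (fun o => evolve (eta o) l y + 1) by exact: (dmeas_comp (+%R^~ 1) (IH y)).
suff mY : dmeas (fun o => [seq Num.max (evolve (eta o) l (y + unit_vec i))
    (evolve (eta o) l (y - unit_vec i)) | i <- enum 'I_d]).
  exact: (dmeas_op (fun (a : int) (b : seq int) => foldr Num.max a b) mX mY).
by apply: dmeas_seq => i _; exact: (dmeas_op (fun a b : int => Num.max a b) (IH _) (IH _)).
Qed.

(** For a fixed finite set [F] of rings, sorting depends on the times only through the finite table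
    of comparisons within [F], which is a discrete variable. *)
Lemma dmeas_rings_before D t : dmeas (fun o => rings_before (tau o) D t).
Proof.
pose tab (F : seq (site d * nat)) (b : seq bool) p q :=
  nth false b (index (p, q) [seq (p, q) | p <- F, q <- F]).
pose bits (F : seq (site d * nat)) o :=
  [seq tau o v.1.1 v.1.2 <= tau o v.2.1 v.2.2 | v <- [seq (p, q) | p <- F, q <- F]].
apply: (@dmeas_eq _ _ _ (fun o => (fun F : {fset site d * nat} =>
    sort (ring_le (tau o)) F) (fset_set (ring_set (tau o) D t)))) => //.
apply: (dmeas_bind (Y := fun F o => sort (ring_le (tau o)) (F : {fset site d * nat}))).
  have mR p : measurable [set o | ring_set (tau o) D t p].
    apply: measurable_and; first exact: measurable_prop.
    exact: mwin.
  pose E F : set T := [set o | forall p, ring_set (tau o) D t p <-> p \in (F : {fset site d * nat})].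
  have mE F : measurable (E F).
    apply: measurable_forall => p; apply: measurable_and; apply: measurable_imply;
      solve [exact: mR|exact: measurable_prop].
  have EP F o : E F o -> fset_set (ring_set (tau o) D t) = F.
    move=> h; rewrite (_ : ring_set _ _ _ = [set` F]) ?set_fsetK//.
    by apply/seteqP; split => p /h.
  move=> F; rewrite (_ : [set o | _] = [set o | E F o \/ (F = fset0 /\ forall F', ~ E F' o)]).
    apply: measurable_or => //; apply: measurable_and; first exact: measurable_prop.
    by apply: measurable_forall => F'; apply: measurable_not.
  have hE o : finite_set (ring_set (tau o) D t) -> E (fset_set (ring_set (tau o) D t)) o.
    by move=> fi p; rewrite in_fset_set//; split => [h|/set_mem//]; exact/mem_set.
  apply/seteqP; split => o /=.
    have [fi|nf] := pselect (finite_set (ring_set (tau o) D t)).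
      by move=> <-; left; exact: hE.
    rewrite /fset_set; case: pselect => // _ <-; right; split => // F' h; apply: nf.
    apply/finite_fsetP; exists F'; apply/seteqP; split => p /h //.
  move=> [/EP//|[-> nE]].
  have [fi|nf] := pselect (finite_set (ring_set (tau o) D t)).
    by case: (nE _ (hE o fi)).
  by rewrite /fset_set; case: pselect.
move=> F; apply: (@dmeas_eq _ _ _ (fun o => sort (tab F (bits F o)) F)).
  move=> o; have e : {in F &, tab F (bits F o) =2 ring_le (tau o)}.
    move=> p q pF qF; have pq : (p, q) \in [seq (p, q) | p <- F, q <- F].
      by apply/allpairsP; exists (p, q).
    by rewrite /tab /bits (nth_map (p, q)) ?index_mem// nth_index.
  exact: eq_in_sort.
apply: (dmeas_comp (fun b => sort (tab F b) F)); apply: dmeas_seq => v _.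
apply: (@dmeas_eq _ _ _ (fun o => `[< tau o v.1.1 v.1.2 <= tau o v.2.1 v.2.2 >])).
  by move=> o; rewrite asboolb.
by apply: dmeas_asbool; exact: mle.
Qed.

Lemma dmeas_finite_height D t x : dmeas (fun o => finite_height (tau o) (eta o) D t x).
Proof.
apply: (@dmeas_eq _ _ _ (fun o => evolve (eta o) (ring_sites (tau o) D t) x)).
  by move=> o; rewrite finite_heightE.
apply: (dmeas_bind (Y := fun L o => evolve (eta o) (map fst L) x)).
  exact: dmeas_rings_before.
by move=> L; exact: dmeas_evolve.
Qed.

(** Being eventually constant over finite sets is a countable condition. Where it fails, [lim] has
    the default value [point]; thus measurability holds on the whole space and not merely up to a
    null event. *)
Lemma dmeas_height t x : dmeas (fun o => height (tau o) (eta o) t x).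
Proof.
pose E v : set T := [set o | exists D0 : {fset site d}, forall D, (D0 `<=` D)%fset ->
  finite_height (tau o) (eta o) D t x = v].
have mE v : measurable (E v).
  apply: measurable_exists => D0; apply: measurable_forall => D.
  by apply: measurable_imply; [exact: measurable_prop|exact: dmeas_finite_height].
have EP v o : E v o -> height (tau o) (eta o) t x = v by move=> [D0 /height_eq].
move=> v; rewrite (_ : [set o | _] = [set o | E v o \/ (v = point /\ forall v', ~ E v' o)]).
  apply: measurable_or => //; apply: measurable_and; first exact: measurable_prop.
  by apply: measurable_forall => v'; apply: measurable_not.
have hN o : (forall v', ~ E v' o) -> height (tau o) (eta o) t x = point.
  move=> nE; apply: dvgP => h.
  have [D0 hD0] := (cvg_totally_int (fun D => finite_height (tau o) (eta o) D t x) _).1 h.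
  by apply: (nE (lim ((fun D => finite_height (tau o) (eta o) D t x) @ totally))); exists D0.
apply/seteqP; split => o /=; last by case=> [/EP//|[-> /hN]].
have [[v' h]|h] := pselect (exists v', E v' o).
  by rewrite (EP _ _ h) => <-; left.
have nE v' : ~ E v' o by move=> ?; apply: h; exists v'.
by rewrite hN// => <-; right.
Qed.

End height_measurability.

(** * The Markov property *)

Section product_sections.
Context (R : realType) {d1 d2 : measure_display}.
Context {T1 : measurableType d1} {T2 : measurableType d2}.
Variables (P1 : probability T1 R) (P2 : probability T2 R).

Lemma measurable_on_fst (A : set T1) : measurable A ->
  measurable [set p : T1 * T2 | A p.1].
Proof.
move=> mA; rewrite (_ : [set p | _] = A `*` [set: T2]); first exact: measurableX.
by apply/seteqP; split => p //= [].
Qed.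

Lemma measurable_on_snd (A : set T2) : measurable A ->
  measurable [set p : T1 * T2 | A p.2].
Proof.
move=> mA; rewrite (_ : [set p | _] = [set: T1] `*` A); first exact: measurableX.
by apply/seteqP; split => p //= [].
Qed.

Lemma product_fst (A : set T1) : measurable A ->
  (P1 \x P2)%E [set p : T1 * T2 | A p.1] = P1 A.
Proof.
move=> mA; rewrite (_ : [set p | _] = A `*` [set: T2]).
  by rewrite product_measure1E//= probability_setT mule1.
by apply/seteqP; split => p //= [].
Qed.

Lemma product_snd (A : set T2) : measurable A ->
  (P1 \x P2)%E [set p : T1 * T2 | A p.2] = P2 A.
Proof.
move=> mA; rewrite (_ : [set p | _] = [set: T1] `*` A).
  by rewrite product_measure1E//= probability_setT mul1e.
by apply/seteqP; split => p //= [].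
Qed.

Lemma negligible_fst (A : set T1) : P1.-negligible A ->
  (P1 \x P2)%E.-negligible [set p : T1 * T2 | A p.1].
Proof.
move=> [N [mN N0 AN]]; exists [set p | N p.1]; split.
- exact: measurable_on_fst.
- by rewrite product_fst.
- by move=> p /AN.
Qed.

Lemma negligible_snd (A : set T2) : P2.-negligible A ->
  (P1 \x P2)%E.-negligible [set p : T1 * T2 | A p.2].
Proof.
move=> [N [mN N0 AN]]; exists [set p | N p.2]; split.
- exact: measurable_on_snd.
- by rewrite product_snd.
- by move=> p /AN.
Qed.

End product_sections.

(** * Approximation of heights by finitely many ring counts *)

Section approximation.
Context (R : realType) (disp : measure_display) (T : measurableType disp).
Variables (P : probability T R) (d : nat) (tau : T -> site d -> nat -> R).
Hypothesis clocks : poisson_clocks P tau.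
Implicit Types (u : nat -> R) (D : {fset site d}) (xs ys : seq (site d)).

Lemma clock_le (p q : site d * nat) :
  measurable [set om | tau om p.1 p.2 <= tau om q.1 q.2].
Proof.
rewrite (_ : [set om | _] = setT `&`
    (fun om => tau om p.1 p.2 <= tau om q.1 q.2) @^-1` [set true]).
  by apply: measurable_fun_ler => //; exact: (clock_measurable clocks).
by apply/seteqP; split => om //= [].
Qed.

(** In contrast to [regular_height], the finite sets [D0] and [ys] do not depend on the realization;
    the price is the exceptional event [B]. *)
Definition local_event D0 xs ys t (B : set T) := forall om, ~ B om ->
  locally_finite (tau om) -> forall D, (D0 `<=` D)%fset ->
  {in rings_before (tau om) D t &, antisymmetric (ring_le (tau om))} ->
  forall eta eta' : site d -> int, {in ys, eta =1 eta'} ->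
  {in xs, height (tau om) eta t =1 evolve eta' (ring_sites (tau om) D t)}.

Lemma exists_local_event xs t (e : R) : 0 < e -> exists D0 ys B,
  [/\ measurable B, (P B <= e%:E)%E & local_event D0 xs ys t B].
Proof.
move=> e0; have [k tk] := exists_slabs d t.
(* Adding one to the number of sites keeps b positive. The union bound over [xs] is at most b / 4 ^
   n, and 4 ^ n >= n >= b / e. *)
pose b : R := (size xs).+1%:R * 2 ^+ k; have b0 : 0 < b by rewrite mulr_gt0// exprn_gt0.
pose n := (Num.truncn (b / e)).+1.
exists [fset y in flatten [seq reach n x | x <- xs]]%fset.
exists (flatten [seq reach n x | x <- xs]).
exists [set om | exists2 x, x \in xs & reached tau n x k om]; split.
- by apply: measurable_has => x _; exact: (measurable_reached clocks).
- apply: le_trans (@le_has _ _ _ _ _ xs _ (2 ^+ k / 4 ^+ n)%:E _ _) _.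
  + by move=> x _; exact: (measurable_reached clocks).
  + by move=> x _; exact: (reached_le clocks).
  rewrite sumEFin lee_fin big_const_seq count_predT iter_addr_0.
  rewrite -[X in X <= _]mulr_natl mulrA ler_pdivrMr ?exprn_gt0//.
  apply: (@le_trans _ _ b); first by rewrite ler_pM2r ?exprn_gt0// ler_nat.
  rewrite [leRHS]mulrC -ler_pdivrMr//; apply: (@le_trans _ _ n%:R).
    exact/ltW/truncnS_gt.
  by rewrite -natrX ler_nat ltnW// ltn_expl.
- move=> om nB lf D /fsubsetP sD anti eta eta' e' x xxs.
  have un : unreached (tau om) n x k.
    by move=> F Fc cF; apply: nB; exists x => //; exists F.
  have nc := unreached_no_chain (D := D) lf tk un.
  have sub : {subset reach n x <= flatten [seq reach n y | y <- xs]}.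
    by move=> z zx; apply/flatten_mapP; exists x.
  rewrite (height_local eta lf anti tk un); last first.
    by move=> z /sub zs; apply: sD; rewrite inE.
  by apply: (evolve_dep nc) => z /sub/e'.
Qed.

Definition listing (cs : seq (site d * nat)) (ks : seq nat) : seq (site d) :=
  flatten [seq nseq p.2 p.1.1 | p <- zip cs ks].

Definition cells D k0 k1 : seq (site d * nat) :=
  flatten [seq [seq (x, i) | x <- D] | i <- iota k0 k1].

Lemma cellsD D k0 k1 k2 : cells D k0 (k1 + k2) = cells D k0 k1 ++ cells D (k0 + k1) k2.
Proof. by rewrite /cells iotaD map_cat flatten_cat. Qed.

Lemma mem_cells D k0 k1 c :
  (c \in cells D k0 k1) = (c.1 \in D) && (k0 <= c.2 < k0 + k1)%N.
Proof.
apply/flatten_mapP/andP => [[i]|[cD ck]].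
  by rewrite mem_iota => ik /mapP[x xD ->].
exists c.2; first by rewrite mem_iota.
by apply/mapP; exists c.1 => //; case: (c).
Qed.

Lemma uniq_cells D k0 k1 : uniq (cells D k0 k1).
Proof.
rewrite /cells; elim: k1 k0 => //= k1 IH k0; rewrite cat_uniq IH andbT.
rewrite map_inj_uniq ?fset_uniq/=; last by move=> x y [].
apply/hasPn => c; rewrite -/(cells D k0.+1 k1) mem_cells => /andP[_ /andP[ck _]].
by apply/mapP => -[x _ cE]; move: ck; rewrite cE /= ltnn.
Qed.

Lemma below_cells D k0 k1 : below (k0 + k1) (cells D k0 k1).
Proof. by apply/allP => c; rewrite mem_cells => /andP[_ /andP[]]. Qed.

Lemma grid_listE r u D k0 k1 : grid_list r u D k0 k1 =
  listing (cells D k0 k1) [seq cell_count r u c | c <- cells D k0 k1].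
Proof.
rewrite /listing -{1}(map_id (cells D k0 k1)) zip_map -map_comp /grid_list /cells.
elim: (iota k0 k1) => //= i s IH; rewrite map_cat flatten_cat IH; congr (_ ++ _).
by rewrite -map_comp.
Qed.

(** A listing forgets slab numbers, so the second half of a grid can be renumbered from zero. *)
Lemma listing_shift D k0 k0' k1 ks :
  listing (cells D k0 k1) ks = listing (cells D k0' k1) ks.
Proof.
suff e : map fst (cells D k0 k1) = map fst (cells D k0' k1).
  have h cs : listing cs ks = flatten [seq nseq p.2 p.1 | p <- zip (map fst cs) ks].
    by rewrite /listing; congr flatten; elim: cs (ks) => [|c cs IH] [|k ks'] //=; rewrite IH.
  by rewrite !h e.
rewrite /cells; elim: k1 k0 k0' => //= k1 IH k0 k0'.
by rewrite !map_cat -!map_comp (IH k0.+1 k0'.+1).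
Qed.

Lemma height_grid D0 D xs ys t B u k om : local_event D0 xs ys t B ->
  ~ B om -> locally_finite (tau om) -> (D0 `<=` D)%fset ->
  increasing_upto u k -> u 0%N = 0 -> u k = t -> ~ not_sparse tau u D k om ->
  forall eta eta' : site d -> int, {in ys, eta =1 eta'} ->
  {in xs, height (tau om) eta t =1 evolve eta' (listing (cells D 0 k)
    (counts tau u (cells D 0 k) om))}.
Proof.
move=> loc nB lf DD iu u0 uk /contrapT sp eta eta' e x xxs.
have [gl anti] := grid_list_rings lf iu u0 sp.
rewrite /counts -grid_listE -gl uk; rewrite uk in anti.
exact: loc.
Qed.

(** Counts in disjoint blocks of cells are independent, and the law of a block depends only on its
    slab lengths. So the second block may be moved in time and driven by an independent copy of the
    clocks. *)
Lemma decoupling u v K K' (cs1 cs2 cs2' : seq (site d * nat)) :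
  increasing_upto u K -> increasing_upto v K' ->
  uniq (cs1 ++ cs2) -> below K (cs1 ++ cs2) -> uniq cs2' -> below K' cs2' ->
  size cs2 = size cs2' ->
  (forall ks, pmf_prod u cs2 ks = pmf_prod v cs2' ks) ->
  forall B : set (seq nat * seq nat),
  P [set om | B (counts tau u cs1 om, counts tau u cs2 om)] =
  (P \x P)%E [set p | B (counts tau u cs1 p.1, counts tau v cs2' p.2)].
Proof.
move=> iu iv; rewrite cat_uniq => /and3P[u1 u12 u2].
rewrite /below all_cat => /andP[b1 b2] u2' b2' ss pp B.
have mX : dmeas (fun om => (counts tau u cs1 om, counts tau u cs2 om)).
  exact: (dmeas_op pair (dmeas_counts clocks u cs1) (dmeas_counts clocks u cs2)).
have m1 w cs : dmeas (fun p : T * T => counts tau w cs p.1).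
  by move=> k; exact: measurable_on_fst (dmeas_counts clocks w cs k).
have m2 w cs : dmeas (fun p : T * T => counts tau w cs p.2).
  by move=> k; exact: measurable_on_snd (dmeas_counts clocks w cs k).
have mY : dmeas (fun p : T * T => (counts tau u cs1 p.1, counts tau v cs2' p.2)).
  exact: (dmeas_op pair (m1 u cs1) (m2 v cs2')).
apply: (law_eq mX mY) => -[a b].
rewrite (_ : [set p : T * T | _] = [set om | counts tau u cs1 om = a] `*`
    [set om | counts tau v cs2' om = b]); last first.
  by apply/seteqP; split => p /=; [case|case=> -> ->].
transitivity (P [set om | counts tau u cs1 om = a] *
    P [set om | counts tau v cs2' om = b])%E; last first.
  by symmetry; apply: product_measure1E; exact: (dmeas_counts clocks).
have -> : [set om | (counts tau u cs1 om, counts tau u cs2 om) = (a, b)] =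
   [set om | size a = size cs1 /\ counts tau u (cs1 ++ cs2) om = a ++ b].
  apply/seteqP; split => om /=; first by case=> <- <-; rewrite size_map /counts map_cat.
  rewrite /counts map_cat => -[sa] /eqP; rewrite eqseq_cat ?size_map//.
  by move=> /andP[/eqP-> /eqP->].
rewrite !(law_counts clocks _ iu)// (law_counts clocks _ iv)// -ss.
have [sa|/eqP sa] := eqVneq (size a) (size cs1); last first.
  rewrite mul0e (_ : [set om | _] = set0) ?measure0//.
  by apply/seteqP; split => om // [].
rewrite (_ : [set om | _] = [set om | counts tau u (cs1 ++ cs2) om = a ++ b]); last first.
  by apply/seteqP; split => om /= => [[]|].
have u12' : uniq (cs1 ++ cs2) by rewrite cat_uniq u1 u12 u2.
have b12 : below K (cs1 ++ cs2) by rewrite /below all_cat b1.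
apply: etrans (law_counts clocks (a ++ b) iu u12' b12) _.
rewrite !size_cat sa eqn_add2l; case: eqP => // _; last by rewrite mule0.
by rewrite -EFinM /pmf_prod zip_cat// big_cat /= -/(pmf_prod u cs2 b) pp.
Qed.

End approximation.

Section approximate_equality.
Local Open Scope ereal_scope.
Context (R : realType) (disp : measure_display) (T : measurableType disp).
Variable m : {measure set T -> \bar R}.

Lemma le_bad (E E' B N : set T) (e : \bar R) :
  measurable E -> measurable E' -> measurable B -> m B <= e -> m.-negligible N ->
  (forall o, ~ N o -> ~ B o -> E o -> E' o) -> m E <= m E' + e.
Proof.
move=> mE mE' mB Be hN EE'; apply: (@le_trans _ _ (m (E' `|` B))).
  apply: (negligible_le mE (measurableU _ _ mE' mB) hN) => o nN Eo.
  by have [Bo|nB] := pselect (B o); [right|left; exact: EE'].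
apply: (@le_trans _ _ (m E' + m B)); first exact: measureU2.
exact: leeD.
Qed.

Lemma close_bad (E E' B N : set T) (e : \bar R) :
  measurable E -> measurable E' -> measurable B -> m B <= e -> m.-negligible N ->
  (forall o, ~ N o -> ~ B o -> E o <-> E' o) ->
  m E <= m E' + e /\ m E' <= m E + e.
Proof.
move=> mE mE' mB Be hN EE'; split; apply: (le_bad _ _ mB Be hN) => // o nN nB;
  by case: (EE' o nN nB).
Qed.

Lemma eq_close (x y : \bar R) :
  (forall e : R, (0 < e)%R -> exists z, [/\ x <= z + e%:E, z <= x + e%:E,
    y <= z + e%:E & z <= y + e%:E]) -> x = y.
Proof.
move=> h; apply/eqP; rewrite eq_le; apply/andP; split; apply/lee_addgt0Pr => e e0;
  have e20 : (0 < e / 2)%R by [rewrite divr_gt0|];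
  have [z [h1 h2 h3 h4]] := h _ e20; rewrite (splitr e) EFinD addeA.
  by apply: le_trans h1 _; rewrite leeD2r.
by apply: le_trans h3 _; rewrite leeD2r.
Qed.

End approximate_equality.

Section laws_of_heights.
Context (R : realType) (disp : measure_display) (T : measurableType disp).
Variables (P : probability T R) (d : nat) (tau : T -> site d -> nat -> R).
Hypothesis clocks : poisson_clocks P tau.
Implicit Types (xs : seq (site d)) (D : {fset site d}).

Definition heights eta t xs (om : T) : seq int :=
  [seq height (tau om) eta t x | x <- xs].

Lemma dmeas_height_fst (d' : measure_display) (S : measurableType d')
    (eta : S -> site d -> int) t x : (forall x, dmeas (fun o => eta o x)) ->
  dmeas (fun p : S * T => height (tau p.2) (eta p.1) t x).
Proof.
move=> meta; apply: (@dmeas_height _ _ _ _ (fun p => eta p.1) (fun p => tau p.2)).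
- by move=> y v; exact: (measurable_on_fst (meta y v)).
- by move=> p q; exact: (measurable_on_snd (clock_le clocks p q)).
- by move=> y n s; exact: (measurable_on_snd (measurable_ring_time clocks y n 0 s)).
Qed.

Lemma dmeas_height_cst eta t x : dmeas (fun om => height (tau om) eta t x).
Proof.
apply: (@dmeas_height _ _ _ _ (fun=> eta) tau).
- by move=> y; exact: dmeas_cst.
- exact: clock_le clocks.
- by move=> y n s; exact: (measurable_ring_time clocks).
Qed.

Lemma dmeas_heights eta t xs : dmeas (heights eta t xs).
Proof. by apply: dmeas_seq => x _; exact: dmeas_height_cst. Qed.

Definition grid_heights (eta : site d -> int) D u k xs om :=
  [seq evolve eta (listing (cells D 0 k) (counts tau u (cells D 0 k) om)) x | x <- xs].

Lemma dmeas_grid_heights eta D u k xs : dmeas (grid_heights eta D u k xs).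
Proof.
exact: (dmeas_comp (fun ks => [seq evolve eta (listing (cells D 0 k) ks) x | x <- xs])
  (dmeas_counts clocks u _)).
Qed.

(** The exceptional event is chosen before the initial states, so that a random initial state may be
    inserted afterwards. *)
Lemma heights_close xs ys t D0 D B u k (e : R) : local_event tau D0 xs ys t B ->
  measurable B -> (P B <= (e / 2)%:E)%E -> (D0 `<=` D)%fset ->
  increasing_upto u k -> u 0%N = 0 -> u k = t -> fine_grid u D k (e / 2) ->
  exists B', [/\ measurable B', (P B' <= e%:E)%E &
    forall om, ~ B' om -> locally_finite (tau om) ->
    forall eta eta' : site d -> int, {in ys, eta =1 eta'} ->
    heights eta t xs om = grid_heights eta' D u k xs om].
Proof.
move=> loc mB Be DD iu u0 uk fu; exists (B `|` not_sparse tau u D k); split.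
- apply: measurableU => //; exact: (measurable_not_sparse clocks).
- rewrite (splitr e) EFinD; apply: le_trans (measureU2 _ mB _) _.
    exact: (measurable_not_sparse clocks).
  apply: leeD => //; exact: (fine_not_sparse clocks).
move=> om /not_orP[nB ns] lf eta eta' ee; apply/eq_in_map => x xxs.
exact: (height_grid loc nB lf DD iu u0 uk ns ee).
Qed.

End laws_of_heights.

Section two_clocks.
Context (R : realType) (disp1 disp2 : measure_display).
Context (T1 : measurableType disp1) (T2 : measurableType disp2).
Variables (P1 : probability T1 R) (P2 : probability T2 R) (d : nat).
Variables (tau1 : T1 -> site d -> nat -> R) (tau2 : T2 -> site d -> nat -> R).
Hypothesis clocks1 : poisson_clocks P1 tau1.
Hypothesis clocks2 : poisson_clocks P2 tau2.

(** Up to small probability, both families of heights are the same function of ring counts on a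
    common grid, and [poisson_clocks] prescribes the law of these counts. *)
Lemma law_unique (eta : site d -> int) t xs (A : set (seq int)) : 0 <= t ->
  P1 [set om | A (heights tau1 eta t xs om)] = P2 [set om | A (heights tau2 eta t xs om)].
Proof.
move=> t0; apply: eq_close => e e0; have e20 : 0 < e / 2 by rewrite divr_gt0.
have [D1 [ys1 [B1 [mB1 B1e loc1]]]] := exists_local_event clocks1 xs t e20.
have [D2 [ys2 [B2 [mB2 B2e loc2]]]] := exists_local_event clocks2 xs t e20.
pose D := (D1 `|` D2)%fset.
have [u [k1 [k2 [u0 _ uk iu fu]]]] := exists_grid D (lexx 0) t0 e20.
rewrite add0r in uk; set k := (k1 + k2)%N in uk iu fu.
have [B1' [mB1' B1e' h1]] :=
  heights_close clocks1 loc1 mB1 B1e (fsubsetUl D1 D2) iu u0 uk fu.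
have [B2' [mB2' B2e' h2]] :=
  heights_close clocks2 loc2 mB2 B2e (fsubsetUr D1 D2) iu u0 uk fu.
have mA1 := dmeas_set A (dmeas_heights clocks1 eta t xs).
have mA2 := dmeas_set A (dmeas_heights clocks2 eta t xs).
have mG1 := dmeas_set A (dmeas_grid_heights clocks1 eta D u k xs).
have mG2 := dmeas_set A (dmeas_grid_heights clocks2 eta D u k xs).
have [c1 c2] := close_bad mA1 mG1 mB1' B1e' (infinite_rings_negligible clocks1)
  (fun om lf nB => eq_ind_r (fun z => A z <-> A (grid_heights tau1 eta D u k xs om))
     (iff_refl _) (h1 om nB (infinite_ringsP lf) eta eta (fun _ _ => erefl))).
have [c3 c4] := close_bad mA2 mG2 mB2' B2e' (infinite_rings_negligible clocks2)
  (fun om lf nB => eq_ind_r (fun z => A z <-> A (grid_heights tau2 eta D u k xs om))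
     (iff_refl _) (h2 om nB (infinite_ringsP lf) eta eta (fun _ _ => erefl))).
exists (P1 [set om | A (grid_heights tau1 eta D u k xs om)]).
have eg : P1 [set om | A (grid_heights tau1 eta D u k xs om)] =
    P2 [set om | A (grid_heights tau2 eta D u k xs om)].
  pose Q := [set ks | A [seq evolve eta (listing (cells D 0 k) ks) x | x <- xs]].
  apply: (law_eq (dmeas_counts clocks1 u (cells D 0 k))
    (dmeas_counts clocks2 u (cells D 0 k)) _ Q) => ks.
  have iu' : increasing_upto u (0 + k) by [].
  apply: etrans (law_counts clocks1 ks iu' (uniq_cells _ _ _) (below_cells _ _ _)) _.
  by apply: esym (law_counts clocks2 ks iu' (uniq_cells _ _ _) (below_cells _ _ _)).
by split=> //; rewrite eg.
Qed.

End two_clocks.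

Section markov_property.
Context (R : realType) (disp : measure_display) (T : measurableType disp).
Variables (P : probability T R) (d : nat) (tau : T -> site d -> nat -> R).
Hypothesis clocks : poisson_clocks P tau.

(** The state at time [s] matters only on the sites [ys] that influence [xs] during a time [t]. On a
    grid through [s], both sides become the same function of the counts before and after [s], and
    [decoupling] exchanges the later counts for independent ones. *)
Lemma markov_heights (eta : site d -> int) s t xs (A : set (seq int)) :
  0 <= s -> 0 <= t ->
  (P \x P)%E [set p : T * T | A (heights tau (height (tau p.1) eta s) t xs p.2)] =
  P [set om | A (heights tau eta (s + t) xs om)].
Proof.
move=> s0 t0; have st0 : 0 <= s + t by rewrite addr_ge0.
apply: eq_close => e e0.
have e20 : 0 < e / 2 by rewrite divr_gt0.
have e40 : 0 < e / 2 / 2 by rewrite divr_gt0.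
have [D1 [ys [B1 [mB1 B1e loc1]]]] := exists_local_event clocks xs t e40.
have [D2 [zs [B2 [mB2 B2e loc2]]]] := exists_local_event clocks ys s e40.
have [D3 [vs [B3 [mB3 B3e loc3]]]] := exists_local_event clocks xs (s + t) e20.
pose D := (D1 `|` D2 `|` D3)%fset.
have D1D : (D1 `<=` D)%fset by rewrite /D -fsetUA fsubsetUl.
have D2D : (D2 `<=` D)%fset by rewrite /D fsetUAC fsubsetUr.
have D3D : (D3 `<=` D)%fset by rewrite /D fsubsetUr.
have [u [k1 [k2 [u0 uk1 uk2 iu fu]]]] := exists_grid D s0 t0 e40.
pose v i := u (k1 + i)%N - s.
have iu1 : increasing_upto u k1.
  by split=> [|i ik]; [exact: iu.1|apply: iu.2; rewrite (leq_trans ik)// leq_addr].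
have iv : increasing_upto v k2.
  split=> [|i ik]; first by rewrite /v addn0 uk1 subrr.
  by rewrite /v addnS ltrD2r iu.2// ltn_add2l.
have v0 : v 0%N = 0 by rewrite /v addn0 uk1 subrr.
have vk : v k2 = t by rewrite /v uk2 addrC addKr.
have fu1 : fine_grid u D k1 (e / 2 / 2).
  have := fine_grid_sub (k0 := 0%N) (k1 := k1) 0 fu (leq_addr _ _).
  by congr (fine_grid _ _ _ _); apply/funext => i; rewrite subr0.
have fv : fine_grid v D k2 (e / 2 / 2) by exact: fine_grid_sub fu _.
have fu3 : fine_grid u D (k1 + k2) (e / 2).
  case: fu => delta ud le; exists delta => //; apply: le_trans le _.
  by rewrite ler_pdivrMr// ler_peMr ?ler1n// ltW.
have [B1' [mB1' B1e' h1]] :=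
  heights_close clocks loc1 mB1 B1e D1D iv v0 vk fv.
have [B2' [mB2' B2e' h2]] := heights_close clocks loc2 mB2 B2e D2D iu1 u0 uk1 fu1.
have [B3' [mB3' B3e' h3]] := heights_close clocks loc3 mB3 B3e D3D iu u0 uk2 fu3.
pose C1 := cells D 0 k1; pose C2 := cells D 0 k2; pose C2' := cells D k1 k2.
pose Q (q : seq nat * seq nat) :=
  A [seq evolve (evolve eta (listing C1 q.1)) (listing C2 q.2) x | x <- xs].
pose G1 := [set om | Q (counts tau u C1 om, counts tau u C2' om)].
pose G2 := [set p : T * T | Q (counts tau u C1 p.1, counts tau v C2 p.2)].
have C2E : C2' = [seq (c.1, (k1 + c.2)%N) | c <- C2].
  rewrite /C2' /C2 /cells map_flatten -!map_comp -{1}(addn0 k1) iotaDl -map_comp.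
  by congr flatten; apply: eq_map => i /=; rewrite -map_comp.
have CC : C1 ++ C2' = cells D 0 (k1 + k2) by rewrite cellsD add0n.
have G12 : P G1 = (P \x P)%E G2.
  apply: (decoupling clocks iu iv (K' := k2)).
  - rewrite CC; exact: uniq_cells.
  - rewrite CC; exact: (below_cells D 0 (k1 + k2)).
  - exact: uniq_cells.
  - exact: (below_cells D 0 k2).
  - by rewrite C2E size_map.
  - move=> ks; rewrite C2E /pmf_prod; elim: (C2) ks => [|c cs IH] [|k ks] /=; rewrite ?big_nil//.
    rewrite !big_cons IH /=; congr (poisson_pmf _ _ * _).
    by rewrite /v addnS opprB addrA subrK.
have gridE om : grid_heights tau eta D u (k1 + k2) xs om =
    [seq evolve (evolve eta (listing C1 (counts tau u C1 om)))
      (listing C2 (counts tau u C2' om)) x | x <- xs].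
  rewrite /grid_heights cellsD add0n; apply: eq_map => x.
  rewrite /counts map_cat /listing zip_cat ?size_map// map_cat flatten_cat evolve_cat.
  congr (evolve _ _ x); exact: (listing_shift D k1 0 k2).
have mC w C : dmeas (counts tau w C) := dmeas_counts clocks w C.
have mG1 : measurable G1.
  exact: (dmeas_set Q (dmeas_op pair (mC u C1) (mC u C2'))).
have m1 w C : dmeas (fun p : T * T => counts tau w C p.1).
  by move=> k; exact: measurable_on_fst (mC w C k).
have m2 w C : dmeas (fun p : T * T => counts tau w C p.2).
  by move=> k; exact: measurable_on_snd (mC w C k).
have mG2 : measurable G2.
  exact: (dmeas_set Q (dmeas_op pair (m1 u C1) (m2 v C2))).
have mA1 := dmeas_set A (dmeas_heights clocks eta (s + t) xs).
have mA2 : measurable [set p : T * T | A (heights tau (height (tau p.1) eta s) t xs p.2)].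
  apply: (dmeas_set (X := fun p : T * T =>
    heights tau (height (tau p.1) eta s) t xs p.2) A); apply: dmeas_seq => x _.
  have mh y : dmeas (fun om => height (tau om) eta s y) := dmeas_height_cst clocks eta s y.
  exact: (dmeas_height_fst clocks t x mh).
have hinf := infinite_rings_negligible clocks.
have [c1 c2] : (P [set om | A (heights tau eta (s + t) xs om)] <= P G1 + e%:E /\
    P G1 <= P [set om | A (heights tau eta (s + t) xs om)] + e%:E)%E.
  apply: (close_bad mA1 mG1 mB3' B3e' hinf) => om /infinite_ringsP lf nB /=.
  by rewrite (h3 om nB lf eta eta)// gridE.
have [c3 c4] : ((P \x P) [set p : T * T |
      A (heights tau (height (tau p.1) eta s) t xs p.2)] <= (P \x P) G2 + e%:E /\
    (P \x P) G2 <= (P \x P) [set p : T * T |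
      A (heights tau (height (tau p.1) eta s) t xs p.2)] + e%:E)%E.
  apply: (close_bad mA2 mG2 (B := [set p | B1' p.2] `|` [set p | B2' p.1])
    (N := [set p | infinite_rings tau p.2] `|` [set p | infinite_rings tau p.1])).
  - exact: measurableU (measurable_on_snd mB1') (measurable_on_fst mB2').
  - rewrite (splitr e) EFinD.
    apply: le_trans (measureU2 _ (measurable_on_snd mB1') (measurable_on_fst mB2')) _.
    apply: leeD.
      exact: (eq_ind_r (fun z => (z <= (e / 2)%:E)%E) B1e' (product_snd P P mB1')).
    exact: (eq_ind_r (fun z => (z <= (e / 2)%:E)%E) B2e' (product_fst P P mB2')).
  - apply: negligibleU; [exact: (negligible_snd P hinf)|exact: (negligible_fst P hinf)].
  move=> p /not_orP[/(@infinite_ringsP _ _ _ _ tau) lf2 /(@infinite_ringsP _ _ _ _ tau) lf1].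
  move=> /not_orP[/= nB1 nB2]; rewrite /G2 /Q /=.
  rewrite (h1 p.2 nB1 lf2 _ (evolve eta (listing C1 (counts tau u C1 p.1)))) //.
  exact/eq_in_map/(h2 p.1 nB2 lf1 eta eta).
by exists (P G1); split => //; rewrite G12.
Qed.

(** Subtracting the height at 0 from the state at time [s] shifts all later heights by the same
    constant, which cancels in relative heights. *)
Lemma rel_heights_markov (eta : site d -> int) s t xs (A : set (seq int)) :
  0 <= s -> 0 <= t ->
  (P \x P)%E [set p : T * T |
    A [seq rel_height (tau p.2) (rel_height (tau p.1) eta s) t x | x <- xs]] =
  P [set om | A [seq rel_height (tau om) eta (s + t) x | x <- xs]].
Proof.
move=> s0 t0; pose A' := [set v | A [seq z - head 0 v | z <- behead v]].
have -> : P [set om | A [seq rel_height (tau om) eta (s + t) x | x <- xs]] =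
    P [set om | A' (heights tau eta (s + t) (0 :: xs) om)].
  by congr (P _); apply/seteqP; split => om; rewrite /A' /= -map_comp.
rewrite -markov_heights//; apply: (negligible_eq (N := [set p | irregular tau p.2])).
- apply: (dmeas_set (X := fun p : T * T => [seq rel_height (tau p.2)
    (rel_height (tau p.1) eta s) t x | x <- xs]) A); apply: dmeas_seq => x _.
  have mw y : dmeas (fun om => rel_height (tau om) eta s y).
    exact: (dmeas_op (fun a b : int => a - b) (dmeas_height_cst clocks eta s y)
      (dmeas_height_cst clocks eta s 0)).
  exact: (dmeas_op (fun a b : int => a - b) (dmeas_height_fst clocks t x mw)
    (dmeas_height_fst clocks t 0 mw)).
- apply: (dmeas_set (X := fun p : T * T =>
    heights tau (height (tau p.1) eta s) t (0 :: xs) p.2) A'); apply: dmeas_seq => x _.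
  have mh y : dmeas (fun om => height (tau om) eta s y) := dmeas_height_cst clocks eta s y.
  exact: (dmeas_height_fst clocks t x mh).
- exact: negligible_snd (irregular_negligible clocks).
move=> p /= /contrapT reg; rewrite /A' /= -map_comp.
rewrite (_ : [seq _ | x <- xs] = [seq height (tau p.2) (height (tau p.1) eta s) t x -
   height (tau p.2) (height (tau p.1) eta s) t 0 | x <- xs]) //.
apply: eq_map => x; rewrite /rel_height.
have h y : height (tau p.2) (rel_height (tau p.1) eta s) t y =
   height (tau p.2) (height (tau p.1) eta s) t y - height (tau p.1) eta s 0.
  exact: (height_addc _ t y (- height (tau p.1) eta s 0) reg).
by rewrite -[X in height _ X _ x]/(rel_height (tau p.1) eta s)
  -[X in _ - height _ X _ 0]/(rel_height (tau p.1) eta s) !h; ring.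
Qed.

End markov_property.

(** * Growth of the mean height *)

Section integrals.
Local Open Scope ereal_scope.
Context (R : realType) (disp : measure_display) (T : measurableType disp).
Variable m : {measure set T -> \bar R}.

(** The comparison goes through the supremum over simple functions below the integrand; it serves
    for expectations as functions of time, whose measurability is not established. *)
Lemma ge0_le_integral_any (D : set T) (f g : T -> \bar R) :
  (forall x, D x -> 0 <= f x) -> (forall x, D x -> f x <= g x) ->
  \int[m]_(x in D) f x <= \int[m]_(x in D) g x.
Proof.
move=> f0 fg.
have g0 x : D x -> 0 <= g x by move=> Dx; apply: le_trans (f0 x Dx) (fg x Dx).
rewrite !ge0_integralE//; apply: ereal_sup_le => _ [h hf <-]; exists h => // x.
apply: le_trans (hf x) _; rewrite /patch; case: ifPn => // /set_mem.
exact: fg.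
Qed.

Lemma measurable_natE (X : T -> nat) : dmeas X ->
  measurable_fun setT (fun o => (X o)%:R%:E : \bar R).
Proof.
move=> mX _ A _; rewrite setTI.
exact: (dmeas_set [set n : nat | A (n%:R%:E)] mX).
Qed.

(** The layer cake formula: comparisons of expectations become comparisons of probabilities, which
    can be transported along equalities in law. *)
Lemma integral_nat (X : T -> nat) : dmeas X ->
  \int[m]_o (X o)%:R%:E = \sum_(k <oo) m [set o | (k < X o)%N].
Proof.
move=> mX; have mk k : measurable [set o | (k < X o)%N].
  exact: (dmeas_set (fun n => k < n)%N mX).
transitivity (\int[m]_o (\sum_(k <oo) (\1_[set o | (k < X o)%N] o)%:E)).
  apply: eq_integral => o _; apply/esym.
  rewrite (nneseries_split 0 (X o)); last by move=> k _; rewrite lee_fin.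
  rewrite add0n eseries0 ?adde0; last first.
    move=> k Xk _; rewrite indicE; case: (boolP (_ \in _)) => // /set_mem /=.
    by rewrite ltnNge Xk.
  under eq_big_nat => k /andP[_ kX].
    rewrite indicE (_ : (o \in _) = true); last by apply/mem_set.
    over.
  by rewrite sumEFin big_const_nat subn0 iter_addr_0.
rewrite integral_nneseries//.
- by apply: eq_eseriesr => k _; rewrite integral_indic// setIT.
- by move=> k; apply/measurable_EFinP; exact: measurable_indic.
Qed.

Lemma integral_natD (X Y : T -> nat) : dmeas X -> dmeas Y ->
  \int[m]_o (X o + Y o)%:R%:E = \int[m]_o (X o)%:R%:E + \int[m]_o (Y o)%:R%:E.
Proof.
move=> mX mY; rewrite -ge0_integralD//; try exact: measurable_natE.
by apply: eq_integral => o _; rewrite natrD EFinD.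
Qed.

Lemma integral_nat_le (X Y : T -> nat) (N : set T) : dmeas X -> dmeas Y ->
  m.-negligible N -> (forall o, ~ N o -> (X o <= Y o)%N) ->
  \int[m]_o (X o)%:R%:E <= \int[m]_o (Y o)%:R%:E.
Proof.
move=> mX mY nN XY; rewrite !integral_nat//; apply: lee_nneseries => k _ //.
apply: (negligible_le _ _ nN); [exact: (dmeas_set (fun n => k < n)%N)|
  exact: (dmeas_set (fun n => k < n)%N)|].
by move=> o /XY h /= kX; exact: leq_trans h.
Qed.

Lemma integral_natM (X : T -> nat) c : dmeas X ->
  \int[m]_o (c * X o)%:R%:E = c%:R%:E * \int[m]_o (X o)%:R%:E.
Proof.
move=> mX; rewrite -ge0_integralZl_EFin//; last exact: measurable_natE.
by apply: eq_integral => o _; rewrite natrM EFinM.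
Qed.

End integrals.

(** * Lattice symmetries and relabelled clocks *)

Section symmetry.
Context (R : realType) (disp : measure_display) (T : measurableType disp).
Variables (P : probability T R) (d : nat) (tau : T -> site d -> nat -> R).
Hypothesis clocks : poisson_clocks P tau.

Lemma clocks_inj (s : site d -> site d) : injective s ->
  poisson_clocks P (fun om y => tau om (s y)).
Proof.
move=> s_inj; split.
- by move=> x n; exact: (clock_measurable clocks).
- by move=> om x n; exact: (clock_ge0 clocks).
- by move=> om x n; exact: (clock_lt clocks).
- move=> n x b c k bc ij.
  apply: (@clock_law _ _ _ _ _ _ clocks n (fun i => s (x i)) b c k bc).
  by move=> i j /ij h /s_inj.
Qed.

(** Clocks relabelled by [s] are again Poisson clocks. [height_sym] compares the two systems
    realization by realization, and [law_unique] returns to the original clocks. *)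
Lemma symmetry_law (s s' : site d -> site d) eta t xs (A : set (seq int)) :
  cancel s s' -> cancel s' s ->
  (forall x z, z \in adj (s x) <-> exists2 y, y \in adj x & z = s y) -> 0 <= t ->
  P [set om | A (heights tau eta t [seq s x | x <- xs] om)] =
  P [set om | A (heights tau (eta \o s) t xs om)].
Proof.
move=> ss' s's sadj t0; pose tau' om y := tau om (s y).
have c' : poisson_clocks P tau' := clocks_inj (can_inj ss').
transitivity (P [set om | A (heights tau' (eta \o s) t xs om)]); last first.
  exact: (law_unique c' clocks).
apply: (negligible_eq (N := irregular tau `|` irregular tau')).
- exact: (dmeas_set A (dmeas_heights clocks _ _ _)).
- exact: (dmeas_set A (dmeas_heights c' _ _ _)).
- by apply: negligibleU; exact: irregular_negligible.
move=> om /not_orP[/contrapT r1 /contrapT r2] /=.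
rewrite (_ : heights tau eta t [seq s x | x <- xs] om = heights tau' (eta \o s) t xs om)//.
rewrite /heights -map_comp; apply: eq_map => x /=.
exact/esym/(height_sym eta t x ss' s's sadj r1 r2).
Qed.

End symmetry.

Section tilted_growth.
Context (R : realType) (disp : measure_display) (T : measurableType disp).
Variables (P : probability T R) (d : nat) (tau : T -> site d -> nat -> R).
Hypothesis clocks : poisson_clocks P tau.
Variable first : 'I_d.

Definition tilt (x : site d) : int := x 0 first.

Lemma tiltD x y : tilt (x + y) = tilt x + tilt y.
Proof. by rewrite /tilt mxE. Qed.

Lemma tiltN x : tilt (- x) = - tilt x.
Proof. by rewrite /tilt mxE. Qed.

Lemma tilt_unit i : tilt (unit_vec i) = (first == i)%:R.
Proof. by rewrite /tilt /unit_vec mxE eqxx. Qed.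

Lemma tilt_lip u v : v \in adj u -> tilt v <= tilt u + 1.
Proof.
case/adjP => [->|[i ->]|[i ->]]; rewrite ?tiltD ?tiltN ?tilt_unit.
- by lia.
- by case: (first == i) => /=; lia.
- by case: (first == i) => /=; lia.
Qed.

Local Notation h t x := (fun om => height (tau om) tilt t x).

Lemma dmeas_h t x : dmeas (h t x). Proof. exact: (dmeas_height_cst clocks). Qed.

Lemma adj_translate (a x z : site d) :
  z \in adj (x + a) <-> exists2 y, y \in adj x & z = y + a.
Proof.
split=> [/adjP[->|[i ->]|[i ->]]|[y /adjP[->|[i ->]|[i ->]] ->]].
- by exists x => //; exact: adj_refl.
- by exists (x + unit_vec i); [exact: adj_add|rewrite addrAC].
- by exists (x - unit_vec i); [exact: adj_sub|rewrite addrAC].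
- exact: adj_refl.
- by rewrite addrAC; exact: adj_add.
- by rewrite addrAC; exact: adj_sub.
Qed.

(** The tilted initial state is additive, so translation by [a] changes it only by the constant
    [tilt a]. *)
Lemma translation_law t xs (a : site d) (A : set (seq int)) : 0 <= t ->
  P [set om | A (heights tau tilt t [seq x + a | x <- xs] om)] =
  P [set om | A [seq z + tilt a | z <- heights tau tilt t xs om]].
Proof.
move=> t0; pose A' := [set v | A [seq z + tilt a | z <- v]].
apply: etrans (symmetry_law clocks tilt xs A (addrK a) (subrK a) (adj_translate a) t0) _.
apply: (negligible_eq (N := irregular tau)).
- exact: (dmeas_set A (dmeas_heights clocks _ _ _)).
- exact: (dmeas_set A' (dmeas_heights clocks _ _ _)).
- exact: irregular_negligible.
move=> om /contrapT reg /=.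
rewrite (_ : heights tau _ t xs om = [seq z + tilt a | z <- heights tau tilt t xs om])//.
rewrite /heights -map_comp; apply: eq_map => x /=.
rewrite -height_addc//; congr (height _ _ _ _).
by apply/funext => y /=; rewrite tiltD.
Qed.

(** The tilted state vanishes at 0 and heights do not decrease, so at 0 the absolute value is almost
    surely the height itself. Natural values give access to [integral_nat]. *)
Definition height_nat t x om : nat := `|height (tau om) tilt t x|%N.

Lemma dmeas_height_nat t x : dmeas (height_nat t x).
Proof. exact: (dmeas_comp absz (dmeas_h t x)). Qed.

Definition mean_height t : \bar R := (\int[P]_om (height_nat t 0 om)%:R%:E)%E.

(** The probability of a height above n is at most 1 for n < k. For n >= k it is at most 2 ^ k / 4 ^
    (n + 1), as such a height needs a long chain, and this is at most 1 / 2 ^ (n + 1). The tails add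
    up to k + 1. *)
Lemma mean_height_le k t : t <= k%:R * @mesh R d -> (mean_height t <= k.+1%:R%:E)%E.
Proof.
move=> tk; rewrite /mean_height integral_nat; last exact: dmeas_height_nat.
have b n : (P [set om | (n < height_nat t 0 om)%N] <=
    (n < k)%N%:R%:E + (1 / (2 ^ n.+1)%:R)%:E)%E.
  have mE : measurable [set om | (n < height_nat t 0 om)%N].
    exact: (dmeas_set (fun j => n < j)%N (dmeas_height_nat t 0)).
  have [nk|nk] := ltnP n k.
    apply: le_trans (probability_le1 _ mE) _.
    by rewrite -EFinD lee_fin lerDl divr_ge0.
  rewrite add0e; apply: (@le_trans _ _ (P (reached tau n.+1 0 k))).
    apply: (negligible_le mE (measurable_reached clocks _ _ _) (irregular_negligible clocks)).
    move=> om /contrapT reg /= nh; apply: contrapT => nr.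
    have un : unreached (tau om) n.+1 0 k by move=> F Fc cF; apply: nr; exists F.
    have := height_unreached reg tk tilt_lip un.
    have := height_ge tilt t 0 reg; rewrite /tilt mxE.
    by move: nh; rewrite /height_nat /tilt; lia.
  apply: le_trans (reached_le clocks _ _ _) _; rewrite lee_fin.
  rewrite ler_pdivrMr ?exprn_gt0// mulrAC ler_pdivlMr ?ltr0n ?expn_gt0//.
  rewrite mul1r natrX -exprD (_ : 4 = 2 ^+ 2 :> R); last by rewrite -natrX.
  rewrite -exprM.
  by apply: ler_weXn2l; [rewrite ler1n|lia].
apply: (@le_trans _ _ (\sum_(n <oo) ((n < k)%N%:R%:E + (1 / (2 ^ n.+1)%:R)%:E))%E).
  by apply: lee_nneseries => n *; [exact: measure_ge0|exact: b].
rewrite nneseriesD; last 2 first.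
- by move=> n _ _; rewrite lee_fin ler0n.
- by move=> n _ _; rewrite lee_fin divr_ge0.
rewrite (_ : k.+1%:R%:E = k%:R%:E + 1%:E :> \bar R)%E; last by rewrite -EFinD natr1.
apply: leeD.
  rewrite (nneseries_split 0 k)//.
  rewrite add0n eseries0 ?adde0; last by move=> n kn _; rewrite ltnNge kn.
  under eq_big_nat => n /andP[_ ->] do over.
  by rewrite sumEFin big_const_nat subn0 iter_addr_0.
have := @cvg_geometric_eseries_half R 1 0.
rewrite expr0 divr1 => /cvg_lim <-//; rewrite le_eqVlt; apply/orP; left; apply/eqP.
by apply: congr_lim; apply/funext => n; apply: eq_bigr => i _; rewrite addn1.
Qed.

End tilted_growth.

Section tilted_moments.
Context (R : realType) (disp : measure_display) (T : measurableType disp).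
Variables (P : probability T R) (d : nat) (tau : T -> site d -> nat -> R).
Hypothesis clocks : poisson_clocks P tau.
Variable first : 'I_d.

Local Notation w0 := (tilt first).
Local Notation h t x om := (height (tau om) w0 t x).
Local Notation hN := (height_nat tau first).
Local Notation H := (mean_height P tau first).

Let mh t x : dmeas (fun om => h t x om) := dmeas_h clocks first t x.
Let mhN t x : dmeas (hN t x) := dmeas_height_nat clocks first t x.

Definition incr t x om : int := h t x om - h t 0 om.

Lemma dmeas_incr t x : dmeas (incr t x).
Proof. exact: (dmeas_op (fun a b : int => a - b) (mh t x) (mh t 0)). Qed.

Definition incr_pos t x om : nat := `|(Num.max 0 (incr t x om))%R|%N.

Lemma dmeas_incr_pos t x : dmeas (incr_pos t x).
Proof. exact: (dmeas_comp (fun z : int => `|(Num.max 0 z)%R|%N) (dmeas_incr t x)). Qed.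

Definition ring_prob : R := 1 - expR (- 1).

Lemma ring_prob_gt0 : 0 < ring_prob.
Proof. by rewrite subr_gt0 expR_lt1 ltrN10. Qed.

Lemma ring_probE x :
  P [set om | (0 < nrings (tau om) x 0 1)%N] = ring_prob%:E.
Proof.
pose u i : R := i%:R; have iu : increasing_upto u 1 by split=> // i _; rewrite ltr_nat.
have mz : measurable [set om | nrings (tau om) x 0 1 = 0%N] by exact: (dmeas_nrings clocks).
have e0 : P [set om | nrings (tau om) x 0 1 = 0%N] = (expR (- 1))%:E.
  have := law_counts clocks [:: 0%N] iu (cs := [:: (x, 0%N)]) isT isT.
  rewrite /pmf_prod /= big_seq1 /poisson_pmf /u subr0 ltr01 !mul1r invr1 mul1r.
  by move=> <-; congr (P _); apply/seteqP; split => om; rewrite /counts /cell_count /=; [move=> ->|case].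
have -> : [set om | (0 < nrings (tau om) x 0 1)%N] = ~` [set om | nrings (tau om) x 0 1 = 0%N].
  by apply/seteqP; split => om /=; rewrite lt0n => /eqP.
by rewrite probability_setC// e0.
Qed.

Lemma tilt0 : w0 0 = 0. Proof. by rewrite /tilt mxE. Qed.

(** Restart at time [t] with independent clocks: with probability [ring_prob] the clock at 0 rings
    within unit time and lifts the height at 0 at least to the neighbour's height at time [t];
    otherwise the height at 0 does not decrease. *)
Lemma growth t i : 0 <= t ->
  (H t + ring_prob%:E * \int[P]_om (incr_pos t (unit_vec i) om)%:R%:E <= H (t + 1))%E.
Proof.
move=> t0; set e := unit_vec i; pose N om := nrings (tau om) 0 0 1.
pose Z (p : T * T) := height (tau p.2) (fun x => h t x p.1) 1 0.
pose Y (p : T * T) := if (0 < N p.2)%N then incr_pos t e p.1 else 0%N.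
have mN : dmeas N by exact: (dmeas_nrings clocks).
have mZ : dmeas (fun p => `|Z p|%N).
  exact: (dmeas_comp absz (dmeas_height_fst clocks 1 0 (mh t))).
have m0 : dmeas (fun p : T * T => hN t 0 p.1).
  by move=> k; exact: measurable_on_fst (mhN t 0 k).
have mY : dmeas Y.
  apply: (dmeas_op (fun n k => if (0 < n)%N then k else 0%N)) => k.
    exact: measurable_on_snd (mN k).
  exact: measurable_on_fst (dmeas_incr_pos t e k).
have HE : (H t = \int[P \x P]_p (hN t 0 p.1)%:R%:E)%E.
  rewrite /mean_height !integral_nat//; apply: eq_eseriesr => k _.
  exact: esym (product_fst P P (dmeas_set (fun n => k < n)%N (mhN t 0))).
have -> : (ring_prob%:E * \int[P]_om (incr_pos t e om)%:R%:E =
    \int[P \x P]_p (Y p)%:R%:E)%E.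
  rewrite !integral_nat//; last exact: dmeas_incr_pos.
  rewrite -nneseriesZl//; apply: eq_eseriesr => k _; rewrite -(ring_probE 0) muleC.
  have -> : [set p | (k < Y p)%N] =
      [set om | (k < incr_pos t e om)%N] `*` [set om | (0 < N om)%N].
    by apply/seteqP; split => p; rewrite /Y /=; case: ifP => // _ [].
  apply/esym/product_measure1E; first exact: (dmeas_set (fun n => k < n)%N (dmeas_incr_pos t e)).
  exact: (dmeas_set (fun n => 0 < n)%N mN).
have -> : (H (t + 1) = \int[P \x P]_p (`|Z p|%N)%:R%:E)%E.
  rewrite /mean_height !integral_nat//; apply: eq_eseriesr => k _; apply/esym.
  exact: (markov_heights clocks w0 [:: 0] (fun v => (k < `|(nth 0 v 0)%R|)%N) t0 ler01).
rewrite HE -(integral_natD (P \x P)%E m0 mY).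
have irr := irregular_negligible clocks.
apply: (integral_nat_le (dmeas_op addn m0 mY) mZ
  (negligibleU (negligible_fst P irr) (negligible_snd P irr))).
move=> p /not_orP[/contrapT /= reg1 /contrapT /= reg2].
have q := height_ge w0 t 0 reg1; rewrite tilt0 in q.
have q' : h t 0 p.1 <= Z p := height_ge (fun x => h t x p.1) 1 0 reg2.
rewrite /Y; case: ifP => [N0|_]; last first.
  by rewrite addn0 /height_nat; move: q q'; move: (h t 0 p.1) (Z p) => a b; lia.
have [n hn] : exists n, 0 <= tau p.2 0 n < 1.
  move: N0; rewrite /N /nrings cardfs_gt0 => /fset0Pn[n].
  by rewrite in_fset_set; [move=> /set_mem; exists n|exact: (regular_finite reg2)].
have he : e \in adj (0 : site d) by rewrite -[e]add0r adj_add.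
have hr : h t e p.1 <= Z p := height_ring (fun x => h t x p.1) reg2 hn he.
rewrite /incr_pos /incr /height_nat; move: q q' hr.
by move: (h t 0 p.1) (h t e p.1) (Z p) => a b c; lia.
Qed.

Definition mean t : R := fine (H t).

Lemma mean_bound t : (H t <= (`|t| / @mesh R d + 2)%:E)%E.
Proof.
have m0 : 0 < @mesh R d by exact: mesh_gt0.
pose k := (Num.truncn (`|t| / @mesh R d)).+1.
apply: (@le_trans _ _ k.+1%:R%:E).
  apply: (mean_height_le clocks); rewrite -ler_pdivrMr//.
  apply: (@le_trans _ _ (`|t| / @mesh R d)); last exact/ltW/truncnS_gt.
  by rewrite ler_pM2r ?invr_gt0// ler_norm.
have a0 : 0 <= `|t| / @mesh R d by rewrite divr_ge0// ltW.
have /andP[tr _] := truncn_itv a0.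
by rewrite lee_fin /k -addn2 natrD lerD.
Qed.

Lemma H_ge0 t : (0 <= H t)%E.
Proof. by apply: integral_ge0 => om _; rewrite lee_fin ler0n. Qed.

Lemma meanE t : H t = (mean t)%:E.
Proof.
rewrite fineK// ge0_fin_numE ?H_ge0//; apply: le_lt_trans (mean_bound t) _.
exact: ltry.
Qed.

Lemma mean_ge0 t : 0 <= mean t.
Proof. by rewrite -lee_fin -meanE H_ge0. Qed.

Lemma mean_le t : 0 <= t -> mean t <= t / @mesh R d + 2.
Proof. by move=> t0; rewrite -lee_fin -meanE -{2}(ger0_norm t0) mean_bound. Qed.

Lemma mean_mono s t : s <= t -> mean s <= mean t.
Proof.
move=> st; rewrite -lee_fin -!meanE.
apply: (integral_nat_le (mhN _ _) (mhN _ _) (irregular_negligible clocks)).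
move=> om /contrapT reg; have m := height_mono w0 0 reg st.
have p := height_ge w0 s 0 reg; rewrite tilt0 in p.
by rewrite /height_nat; move: m p; lia.
Qed.

Lemma incr_pos_le t i : 0 <= t ->
  (\int[P]_om (incr_pos t (unit_vec i) om)%:R%:E <=
   ((mean (t + 1) - mean t) / ring_prob)%:E)%E.
Proof.
move=> t0; have := growth i t0; rewrite !meanE -leeBrDl// -EFinB.
set I := (\int[P]_om _)%E => le.
rewrite mulrC EFinM lee_pdivlMl ?ring_prob_gt0//.
Qed.

Lemma height_nat_translate t a k : 0 <= t ->
  P [set om | (k < hN t a om)%N] = P [set om | (k < `|(h t 0 om + w0 a)%R|)%N].
Proof.
move=> t0; pose A := [set v : seq int | (k < `|nth 0%R v 0|)%N].
have := translation_law clocks first [:: 0] a A t0.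
by rewrite /heights /A /= add0r.
Qed.

(** In law, the height at [unit_vec i] is the height at 0 plus a tilt, which is 0 or 1. *)
Lemma height_nat_unit_ge t i : 0 <= t ->
  (H t <= \int[P]_om (hN t (unit_vec i) om)%:R%:E)%E.
Proof.
move=> t0; rewrite /mean_height !integral_nat//; try exact: mhN.
apply: lee_nneseries => k *; first exact: measure_ge0.
refine (eq_ind_r (fun z => (_ <= z)%E) _ (height_nat_translate (unit_vec i) k t0)).
apply: (negligible_le _ _ (irregular_negligible clocks)).
- exact: (dmeas_set (fun n => k < n)%N (mhN t 0)).
- exact: (dmeas_set (fun z : int => k < `|(z + w0 (unit_vec i))%R|)%N (mh t 0)).
move=> om /contrapT reg; have p := height_ge w0 t 0 reg; rewrite tilt0 in p.
by rewrite /= /height_nat tilt_unit; move: p; case: (first == i) => /=; lia.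
Qed.

Definition wN t x om : nat := `|incr t x om|%N.

Lemma dmeas_wN t x : dmeas (wN t x).
Proof. exact: (dmeas_comp absz (dmeas_incr t x)). Qed.

Definition incr_bound x := exists2 C : R, 0 <= C & forall t, 0 <= t ->
  (\int[P]_om (wN t x om)%:R%:E <= (C * (mean (t + 1) - mean t))%:E)%E.

Lemma incr_bound_unit i : incr_bound (unit_vec i).
Proof.
exists (2 / ring_prob); first by rewrite divr_ge0// ltW// ring_prob_gt0.
move=> t t0; set e := unit_vec i.
(* For the increment w, |w| + h(e) = 2 w^+ + h(0). As E h(e) >= E h(0), cancelling the finite [H t]
   leaves E|w| <= 2 E w^+. *)
have : (\int[P]_om (wN t e om)%:R%:E + H t <=
    \int[P]_om (2 * incr_pos t e om)%:R%:E + H t)%E.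
  apply: (@le_trans _ _ (\int[P]_om (wN t e om + hN t e om)%:R%:E)%E).
    rewrite integral_natD; [|exact: dmeas_wN|exact: mhN].
    by rewrite leeD2l// height_nat_unit_ge.
  have m2 : dmeas (fun om => (2 * incr_pos t e om)%N).
    exact: (dmeas_comp (muln 2) (dmeas_incr_pos t e)).
  rewrite -integral_natD//.
  apply: (integral_nat_le _ _ (irregular_negligible clocks)).
  - exact: (dmeas_op addn (dmeas_wN t e) (mhN t e)).
  - exact: (dmeas_op addn m2 (mhN t 0)).
  move=> om /contrapT reg.
  have p := height_ge w0 t 0 reg; rewrite tilt0 in p.
  have q := height_ge w0 t e reg; rewrite tilt_unit in q.
  have {}q : 0 <= h t e om by apply: le_trans q; case: (first == i).
  by rewrite /wN /incr_pos /incr /height_nat; move: p q; lia.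
rewrite meanE leeD2rE// => le; apply: le_trans le _.
rewrite integral_natM; last exact: dmeas_incr_pos.
rewrite -mulrA (mulrC ring_prob^-1) EFinM lee_pmul2l//; first exact: incr_pos_le.
Qed.

Lemma wN_translate t a x k : 0 <= t ->
  P [set om | (k < `|(h t (x + a) om - h t a om)%R|)%N] = P [set om | (k < wN t x om)%N].
Proof.
move=> t0; pose A := [set v : seq int | (k < `|(nth 0%R v 1 - nth 0%R v 0)%R|)%N].
have := translation_law clocks first [:: 0; x] a A t0.
rewrite /heights /A /= add0r => ->; congr (P _); apply/seteqP.
by split => om /=; rewrite /wN /incr opprD addrACA subrr addr0.
Qed.

Lemma wN_translate_int t a x : 0 <= t ->
  (\int[P]_om (`|(h t (x + a) om - h t a om)%R|%N)%:R%:E =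
   \int[P]_om (wN t x om)%:R%:E)%E.
Proof.
move=> t0; rewrite !integral_nat.
- by apply: eq_eseriesr => k _; exact: wN_translate.
- exact: dmeas_wN.
- exact: (dmeas_op (fun a b : int => `|(a - b)%R|%N) (mh t (x + a)) (mh t a)).
Qed.

(** The triangle inequality along 0, x, x + y; by translation the second increment has the law of
    the one from 0 to y. *)
Lemma incr_boundD x y : incr_bound x -> incr_bound y -> incr_bound (x + y).
Proof.
move=> [C C0 hx] [C' C'0 hy]; exists (C + C') => [|t t0]; first exact: addr_ge0.
pose d1 om := `|(h t (y + x) om - h t x om)%R|%N.
have md1 : dmeas d1 := dmeas_op (fun a b : int => `|(a - b)%R|%N) (mh t (y + x)) (mh t x).
apply: (@le_trans _ _ (\int[P]_om (d1 om + wN t x om)%:R%:E)%E).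
  apply: (integral_nat_le (dmeas_wN t _) _ (negligible_set0 _)).
    exact: (dmeas_op addn md1 (dmeas_wN t x)).
  move=> om _; rewrite /d1 /wN /incr (addrC x y).
  move: (h t (y + x) om) (h t x om) (h t 0 om) => a b c; lia.
rewrite integral_natD//; last exact: dmeas_wN.
rewrite wN_translate_int// addeC mulrDl EFinD; apply: leeD; [exact: hx|exact: hy].
Qed.

Lemma incr_boundN x : incr_bound x -> incr_bound (- x).
Proof.
move=> [C C0 hx]; exists C => // t t0.
apply: le_trans (hx t t0); rewrite -(wN_translate_int (- x) x t0) subrr.
apply: (integral_nat_le (dmeas_wN t _) _ (negligible_set0 _)).
  exact: (dmeas_op (fun a b : int => `|(a - b)%R|%N) (mh t 0) (mh t (- x))).
by move=> om _; rewrite /wN /incr; move: (h t 0 om) (h t (- x) om) => a b; lia.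
Qed.

Lemma incr_bound0 : incr_bound 0.
Proof.
exists 0 => // t t0; rewrite mul0r le_eqVlt; apply/orP; left; apply/eqP.
by apply: integral0_eq => om _; rewrite /wN /incr subrr.
Qed.

Lemma incr_bound_all x : incr_bound x.
Proof.
have Dsum (I : Type) (s : seq I) F : (forall i, incr_bound (F i)) ->
    incr_bound (\sum_(i <- s) F i).
  move=> hF; elim: s => [|i s IH]; first by rewrite big_nil; exact: incr_bound0.
  by rewrite big_cons; exact: incr_boundD.
rewrite (row_sum_delta x); apply: Dsum => i.
have nat_case n : incr_bound (n%:Z *: unit_vec i).
  rewrite -natz scaler_nat; elim: n => [|n IH]; first by rewrite mulr0n; exact: incr_bound0.
  by rewrite mulrS; apply: incr_boundD => //; exact: incr_bound_unit.
case: (x 0 i) => n; first exact: nat_case.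
by rewrite NegzE scaleNr; apply: incr_boundN; exact: nat_case.
Qed.

(* Mean one of [incr t e] for e in the tilt direction, with the truncation of
   [incr t e] at level k written as a sum of indicators. *)
Lemma truncation t k : 0 <= t ->
  ((1 + k%:R)%:E <= \sum_(j < k + k) P [set om | (j%:Z - k%:Z < incr t (unit_vec first) om)%R] +
   \int[P]_om (if (k <= wN t (unit_vec first) om)%N then wN t (unit_vec first) om
     else 0%N)%:R%:E)%E.
Proof.
move=> t0; set e := unit_vec first.
pose tail om := if (k <= wN t e om)%N then wN t e om else 0%N.
have mt : dmeas tail := dmeas_comp (fun n => if (k <= n)%N then n else 0%N) (dmeas_wN t e).
(* Shifted by k, the truncated increment has values in 0, ..., 2 k, so its layer cake has [k + k]
   terms. *)
pose phi om := `|(Num.max (- k%:Z) (Num.min k%:Z (incr t e om)) + k%:Z)%R|%N.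
have mphi : dmeas phi := dmeas_comp
  (fun z : int => `|(Num.max (- k%:Z) (Num.min k%:Z z) + k%:Z)%R|%N) (dmeas_incr t e).
have phiE : (\int[P]_om (phi om)%:R%:E =
    \sum_(j < k + k) P [set om | (j%:Z - k%:Z < incr t e om)%R])%E.
  rewrite integral_nat// (nneseries_split 0 (k + k)); last by move=> *; exact: measure_ge0.
  rewrite add0n eseries0 ?adde0; last first.
    move=> j kj _; rewrite (_ : [set om | _] = set0) ?measure0//.
    by apply/seteqP; split => om //=; rewrite /phi; move: kj; lia.
  rewrite big_mkord; apply: eq_bigr => j _; congr (P _); apply/seteqP.
  by split => om /=; rewrite /phi; have := ltn_ord j; lia.
rewrite -phiE.
(* Moving h(0) to the right keeps all terms natural: h(e) + k <= h(0) + phi + tail pointwise, while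
   E h(e) = E h(0) + 1 by translation. *)
have : (H t + (1 + k%:R)%:E <= H t + (\int[P]_om (phi om)%:R%:E + \int[P]_om (tail om)%:R%:E))%E.
  have he : (\int[P]_om (hN t e om)%:R%:E = H t + 1)%E.
    have -> : (H t + 1 = \int[P]_om (hN t 0 om + 1)%:R%:E)%E.
      rewrite integral_natD//; last exact: (dmeas_cst 1%N).
      by rewrite integral_cst//= probability_setT mule1.
    rewrite !integral_nat//; last first.
      exact: (dmeas_comp (addn^~ 1%N) (mhN t 0)).
    apply: eq_eseriesr => j _; apply: etrans (height_nat_translate e j t0) _.
    apply: (negligible_eq _ _ (irregular_negligible clocks)).
    - exact: (dmeas_set (fun z : int => j < `|(z + w0 e)%R|)%N (mh t 0)).
    - exact: (dmeas_set (fun n => j < n + 1)%N (mhN t 0)).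
    move=> om /contrapT reg; have p := height_ge w0 t 0 reg; rewrite tilt0 in p.
    by rewrite /= /height_nat tilt_unit eqxx; move: p; lia.
  have -> : (H t + (1 + k%:R)%:E = \int[P]_om (hN t e om + k)%:R%:E)%E.
    rewrite integral_natD//; last exact: (dmeas_cst k).
    by rewrite he integral_cst//= probability_setT mule1 EFinD addeA.
  rewrite -!integral_natD//; last exact: (dmeas_op addn mphi mt).
  apply: (integral_nat_le _ _ (irregular_negligible clocks)).
  - exact: (dmeas_comp (addn^~ k) (mhN t e)).
  - exact: (dmeas_op addn (mhN t 0) (dmeas_op addn mphi mt)).
  move=> om /contrapT reg.
  have p := height_ge w0 t 0 reg; rewrite tilt0 in p.
  have q := height_ge w0 t e reg; rewrite tilt_unit eqxx /= in q.
  rewrite /phi /tail /wN /incr /height_nat.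
  by case: ifP; move: p q; lia.
by rewrite meanE leeD2lE.
Qed.

End tilted_moments.

(** * Time averages *)

Section time_averages.
Context (R : realType).
Local Notation mu := (@lebesgue_measure R).
Implicit Types (f g : R -> R) (S s t M : R).

Definition bounded_measurable f :=
  measurable_fun setT f /\ exists M, forall t, `|f t| <= M.

Lemma monotone_measurable f : {homo f : s t / s <= t} -> measurable_fun setT f.
Proof.
move=> mf; apply: (measurability _ (RGenOInfty.measurableE R)) => //.
move=> _ [_ [a ->] <-]; rewrite setTI; apply: is_interval_measurable.
move=> x y /= + fy z /andP[xz zy]; rewrite !in_itv /= !andbT => ax.
by apply: lt_le_trans ax _; exact: mf.
Qed.

(** Adding [L * t] makes the function nondecreasing, and monotone functions are Borel. *)
Lemma lipschitz_measurable f L : (forall s t, s <= t -> f s <= f t + L * (t - s)) ->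
  measurable_fun setT f.
Proof.
move=> lip; rewrite (_ : f = (fun t => f t + L * t) \- (fun t => L * t)); last first.
  by apply/funext => t /=; rewrite addrK.
apply: measurable_funB; last exact: measurable_funM.
apply: monotone_measurable => s t st; have := lip s t st.
by rewrite mulrBr; lra.
Qed.

Lemma bounded_measurableD f g : bounded_measurable f -> bounded_measurable g ->
  bounded_measurable (fun t => f t + g t).
Proof.
move=> [mf [M fM]] [mg [N gN]]; split; first exact: measurable_funD.
by exists (M + N) => t; apply: le_trans (ler_normD _ _) _; rewrite lerD.
Qed.

Lemma bounded_measurableZ c f : bounded_measurable f -> bounded_measurable (fun t => c * f t).
Proof.
move=> [mf [M fM]]; split; first exact: measurable_funM.
by exists (`|c| * M) => t; rewrite normrM ler_wpM2l.
Qed.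

Lemma bounded_measurable_cst c : bounded_measurable (fun=> c).
Proof. by split; [exact: measurable_cst|exists `|c|]. Qed.

Lemma bounded_measurable_sum (I : Type) (r : seq I) (F : I -> R -> R) :
  (forall i, bounded_measurable (F i)) -> bounded_measurable (fun t => \sum_(i <- r) F i t).
Proof.
move=> bF; elim: r => [|i r IH].
  rewrite (_ : (fun t => _) = (fun=> 0)); first exact: bounded_measurable_cst.
  by apply/funext => t; rewrite big_nil.
rewrite (_ : (fun t => _) = (fun t => F i t + \sum_(j <- r) F j t)).
  exact: bounded_measurableD.
by apply/funext => t; rewrite big_cons.
Qed.

Lemma bounded_measurable_shift f s : bounded_measurable f ->
  bounded_measurable (fun t => f (t + s)).
Proof.
move=> [mf [M fM]]; split; last by exists M.
by apply: (measurableT_comp mf); exact: measurable_funD.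
Qed.

Lemma bounded_integrable f S : bounded_measurable f -> mu.-integrable `[0, S] (EFin \o f).
Proof.
move=> [mf [M fM]]; apply: measurable_bounded_integrable => //.
- by rewrite /= lebesgue_measure_itv /=; case: ifP => // _; rewrite -EFinB ltry.
- exact: measurable_funS mf.
- exists M; split; first exact: num_real.
  by move=> N MN t _; apply: le_trans (fM t) (ltW MN).
Qed.

Definition avg S f : R := S^-1 * \int[mu]_(t in `[0%R, S]) f t.

Lemma avgD S f g : bounded_measurable f -> bounded_measurable g ->
  avg S (fun t => f t + g t) = avg S f + avg S g.
Proof.
by move=> bf bg; rewrite /avg -mulrDr RintegralD//; exact: bounded_integrable.
Qed.

Lemma avgZ S c f : bounded_measurable f -> avg S (fun t => c * f t) = c * avg S f.
Proof.
by move=> bf; rewrite /avg RintegralZl//; [rewrite mulrCA|exact: bounded_integrable].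
Qed.

Lemma avg_cst S c : 0 < S -> avg S (fun=> c) = c.
Proof.
move=> S0; rewrite /avg Rintegral_cst//= lebesgue_measure_itv /= lte_fin S0 -EFinB /= subr0.
by rewrite mulrC mulfK// gt_eqF.
Qed.

Lemma avg_sum S (I : Type) (r : seq I) (F : I -> R -> R) : 0 < S ->
  (forall i, bounded_measurable (F i)) ->
  avg S (fun t => \sum_(i <- r) F i t) = \sum_(i <- r) avg S (F i).
Proof.
move=> S0 bF; elim: r => [|i r IH].
  rewrite big_nil (_ : (fun t => _) = (fun=> 0)) ?avg_cst//.
  by apply/funext => t; rewrite big_nil.
rewrite big_cons -IH -avgD//; last exact: bounded_measurable_sum.
by congr avg; apply/funext => t; rewrite big_cons.
Qed.

Lemma avg_le S f g : 0 < S -> bounded_measurable f -> bounded_measurable g ->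
  (forall t, 0 <= t -> t <= S -> f t <= g t) -> avg S f <= avg S g.
Proof.
move=> S0 bf bg fg; rewrite /avg ler_pM2l ?invr_gt0//; apply: le_Rintegral => //.
- exact: bounded_integrable.
- exact: bounded_integrable.
- by move=> t; rewrite /= in_itv /= => /andP[t0 tS]; exact: fg.
Qed.

Lemma EFin_avg S f : bounded_measurable f ->
  (avg S f)%:E = (S^-1%:E * \int[mu]_(t in `[0%R, S]) (f t)%:E)%E.
Proof.
move=> bf; rewrite /avg EFinM /Rintegral fineK//.
by apply: integrable_fin_num => //; exact: bounded_integrable.
Qed.

Lemma lebesgue_measure_shift s (A : set R) : measurable A ->
  pushforward mu (fun t : measurableTypeR R => t + s : measurableTypeR R) A = mu A.
Proof.
move=> mA; have ms : measurable_fun setT (fun t : measurableTypeR R => t + s : measurableTypeR R).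
  exact: measurable_funD.
apply/esym/lebesgue_measure_unique => //= _ [[a b]] _ <-.
rewrite /pushforward.
rewrite (_ : _ @^-1` _ = `]a - s, b - s]%classic); last first.
  by apply/seteqP; split => t /=; rewrite !in_itv /= ltrBlDr lerBrDr.
rewrite !lebesgue_measure_itv /= !lte_fin ltrD2r; case: ifP => // _.
by rewrite -!EFinB; congr EFin; ring.
Qed.

Lemma integral_shift S s f : measurable_fun setT f -> (forall t, 0 <= f t) ->
  (\int[mu]_(t in `[0%R, S]) (f (t + s)%R)%:E = \int[mu]_(t in `[s, (S + s)%R]) (f t)%:E)%E.
Proof.
move=> mf f0.
have ms : measurable_fun setT (fun t : measurableTypeR R => t + s : measurableTypeR R).
  exact: measurable_funD.
have -> : `[0, S]%classic = (fun t : measurableTypeR R => t + s) @^-1` `[s, S + s].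
  by apply/seteqP; split => t /=; rewrite !in_itv /= lerDr lerD2r.
transitivity (\int[pushforward mu (fun t : measurableTypeR R => (t + s)%R : measurableTypeR R)]_(t in `[s, (S + s)%R]) (f t)%:E)%E.
  rewrite ge0_integral_pushforward//.
  - apply/measurable_EFinP; exact: measurable_funS mf.
  - by move=> t _; rewrite lee_fin.
apply: eq_measure_integral => A mA _; exact: lebesgue_measure_shift.
Qed.

(** The window [s, S + s] exceeds [0, S] by an interval of length s, over which the integral is at
    most s M. *)
Lemma avg_shift S s M f : 0 < S -> 0 <= s -> bounded_measurable f ->
  (forall t, 0 <= f t <= M) -> avg S (fun t => f (t + s)) <= avg S f + s * M / S.
Proof.
move=> S0 s0 bf fM; have f0 t : 0 <= f t by case/andP: (fM t).
have mf := bf.1; have bs := bounded_measurable_shift s bf.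
rewrite -lee_fin EFinD !EFin_avg// integral_shift//.
have mE (A : set R) : measurable_fun A (fun t => (f t)%:E).
  by apply/measurable_EFinP; exact: measurable_funS mf.
apply: (@le_trans _ _ (S^-1%:E * (\int[mu]_(t in `[0%R, S]) (f t)%:E + (M * s)%:E))%E).
  apply: lee_wpmul2l; first by rewrite lee_fin invr_ge0 ltW.
  apply: (@le_trans _ _ (\int[mu]_(t in `[0%R, S] `|` `]S, (S + s)%R]) (f t)%:E)%E).
    apply: ge0_subset_integral => //; [exact: measurableU|exact: mE|by move=> t _; rewrite lee_fin|].
    move=> t /=; rewrite !in_itv /= => /andP[st tS].
    have [tS1|tS1] := leP t S; first by left; rewrite (le_trans s0 st).
    by right; rewrite tS.
  rewrite ge0_integral_setU//; last 3 first.
  - exact: mE.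
  - by move=> t _; rewrite lee_fin.
  - apply/disj_setPS => t [] /=; rewrite !in_itv /= => /andP[_ h1] /andP[h2 _].
    by move: (lt_le_trans h2 h1); rewrite ltxx.
  apply: leeD => //; apply: (@le_trans _ _ (\int[mu]_(t in `]S, (S + s)%R]) M%:E)%E).
    apply: ge0_le_integral_any => t _; first by rewrite lee_fin.
    by rewrite lee_fin; case/andP: (fM t).
  rewrite integral_cst//= lebesgue_measure_itv /= lte_fin ltrDl; case: ifP => [_|/negbT].
    by rewrite -EFinB -EFinM addrAC subrr add0r.
  by rewrite -leNgt mule0 lee_fin => s1; rewrite mulr_ge0//; exact: le_trans (f0 0) (andP (fM 0)).2.
rewrite muleDr//; last exact: fin_num_adde_defl.
by rewrite leeD2l// -EFinM lee_fin mulrC (mulrC M).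
Qed.

End time_averages.

Lemma markov_nat (R : realType) (disp : measure_display) (T : measurableType disp)
    (m : {measure set T -> \bar R}) (X : T -> nat) k : dmeas X ->
  (m [set o | (k < X o)%N] * k%:R%:E <= \int[m]_o (X o)%:R%:E)%E.
Proof.
move=> mX; pose Y o : nat := (k < X o)%N.
have mY : dmeas Y := dmeas_comp (fun n : nat => (k < n)%N : nat) mX.
have <- : (\int[m]_o (Y o)%:R%:E = m [set o | (k < X o)%N])%E.
  have mk : measurable [set o | (k < X o)%N] := dmeas_set (fun n => k < n)%N mX.
  transitivity (\int[m]_o (\1_[set o | (k < X o)%N] o)%:E)%E; last by rewrite integral_indic// setIT.
  apply: eq_integral => o _.
  by rewrite indicE /Y; congr (nat_of_bool _)%:R%:E; apply/idP/idP => [h|/set_mem//]; exact/mem_set.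
rewrite muleC -integral_natM//.
apply: (integral_nat_le _ mX (negligible_set0 _)); first exact: (dmeas_comp (muln k)).
by move=> o _; rewrite /Y; case: ltnP => h; rewrite ?muln1 ?muln0// ltnW.
Qed.

(** The average of the unit increments telescopes to at most m (S + 1) / S, and linear growth bounds
    this by 2 a + 2 when S >= 1. *)
Lemma avg_increment (R : realType) (m : R -> R) a : 0 <= a -> (forall t, 0 <= m t) ->
  {homo m : s t / s <= t} -> (forall t, 0 <= t -> m t <= t * a + 2) ->
  exists2 K : R, 0 <= K & forall S, 1 <= S -> exists2 f,
  bounded_measurable f & avg S f <= K /\
    forall t, 0 <= t -> t <= S -> f t = m (t + 1) - m t.
Proof.
move=> a0 m0 mm ma; exists (2 * a + 2); first by rewrite addr_ge0// mulr_ge0.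
move=> S S1; have S0 : 0 < S by exact: lt_le_trans S1.
(* Stopping at time S + 1 makes [m] bounded and leaves its unit increments on [0, S] unchanged. *)
pose g t := m (Num.min t (S + 1)).
have gmono : {homo g : s t / s <= t}.
  by move=> s t st; apply: mm => //; rewrite le_min !ge_min st lexx orbT.
have g0 t : 0 <= g t <= m (S + 1).
  by rewrite m0 /=; apply: mm => //; rewrite ge_min lexx orbT.
have bg : bounded_measurable g.
  split; first exact: monotone_measurable.
  by exists (m (S + 1)) => t; have /andP[h1 h2] := g0 t; rewrite ger0_norm.
have bs := bounded_measurable_shift 1 bg.
exists (fun t => g (t + 1) + (-1) * g t).
  by apply: bounded_measurableD => //; exact: bounded_measurableZ.
split.
  rewrite avgD//; last exact: bounded_measurableZ.
  rewrite avgZ//; have h := avg_shift S0 ler01 bg g0.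
  apply: (@le_trans _ _ (m (S + 1) / S)); first by rewrite mul1r in h; lra.
  rewrite ler_pdivrMr//; apply: le_trans (ma _ _) _; first by lra.
  have : (S + 1) * a <= 2 * S * a by rewrite ler_wpM2r//; lra.
  by move=> h1; lra.
move=> t t0 tS; rewrite mulN1r /g; congr (m _ - m _).
  by apply/min_idPl; lra.
by apply/min_idPl; lra.
Qed.

(** * Events that depend on finitely many sites *)

Section local_sets.
Variable d : nat.
Implicit Types (C : set (height_space d)) (xs : seq (site d)).

Definition depends_on xs C := forall eta eta' : site d -> int,
  {in xs, eta =1 eta'} -> C eta -> C eta'.

Definition local C := exists xs, depends_on xs C.

Lemma local_map xs (A : set (seq int)) :
  local [set eta : height_space d | A (map (eta : site d -> int) xs)].
Proof. by exists xs => eta eta' /eq_in_map e /=; rewrite e. Qed.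

Lemma localE xs C : depends_on xs C -> exists A : set (seq int),
  C = [set eta : height_space d | A (map (eta : site d -> int) xs)].
Proof.
move=> dC; exists [set v | exists2 eta : site d -> int, C eta & v = map eta xs].
apply/seteqP; split => eta /=; first by exists eta.
by move=> [eta' Ceta' /esym/eq_in_map e]; exact: dC e Ceta'.
Qed.

Lemma localC C : local C -> local (~` C).
Proof. by move=> [xs /localE[A ->]]; exact: (local_map xs (~` A)). Qed.

Lemma localI C C' : local C -> local C' -> local (C `&` C').
Proof.
move=> [xs dC] [ys dC']; exists (xs ++ ys) => eta eta' e [h h'].
by split; [apply: dC h|apply: dC' h'] => x xin; apply: e; rewrite mem_cat xin ?orbT.
Qed.

Lemma local_setT : local [set: height_space d]. Proof. by exists [::]. Qed.

Lemma local_measurable (disp : measure_display) (T : measurableType disp)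
    (f : T -> height_space d) C : local C -> (forall x, dmeas (fun o => f o x)) ->
  measurable [set o | C (f o)].
Proof.
move=> [xs /localE[A ->]] mf.
exact: (dmeas_set A (@dmeas_seq _ _ _ _ xs (fun x o => f o x) (fun x _ => mf x))).
Qed.

Lemma measurable_local C : local C -> measurable C.
Proof. by move=> lC; apply: (local_measurable (f := id) lC); exact: dmeas_coord. Qed.

End local_sets.

Section time_laws.
Context (R : realType) (disp : measure_display) (T : measurableType disp).
Variables (P : probability T R) (d : nat) (tau : T -> site d -> nat -> R).
Hypothesis clocks : poisson_clocks P tau.
Variable first : 'I_d.
Local Notation w0 := (tilt first).
Implicit Type C : set (height_space d).

(** Freezing the process at negative times makes its laws Lipschitz on the whole line, as
    [lipschitz_measurable] asks. *)
Definition profile t om : height_space d := rel_height (tau om) w0 (Num.max 0 t).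

Lemma dmeas_profile t x : dmeas (fun om => profile t om x).
Proof. exact: (dmeas_incr clocks). Qed.

Lemma measurable_profile t C : local C -> measurable [set om | C (profile t om)].
Proof. by move=> lC; apply: local_measurable lC _ => x; exact: dmeas_profile. Qed.

Definition time_law C t : R := fine (P [set om | C (profile t om)]).

Lemma time_lawE C t : local C -> P [set om | C (profile t om)] = (time_law C t)%:E.
Proof.
move=> lC; rewrite fineK//; apply: fin_num_measure.
exact: measurable_profile.
Qed.

Lemma time_law_ge0 C t : local C -> 0 <= time_law C t.
Proof. by move=> lC; rewrite -lee_fin -time_lawE. Qed.

Lemma time_law_le1 C t : local C -> time_law C t <= 1.
Proof.
move=> lC; rewrite -lee_fin -time_lawE//; apply: probability_le1.
exact: measurable_profile.
Qed.

Lemma ring_le_prob x s t : 0 <= s -> s <= t ->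
  (P [set om | exists n, (s <= tau om x n < t)%R] <= (t - s)%:E)%E.
Proof.
move=> s0; rewrite le_eqVlt => /orP[/eqP<-|st].
  rewrite (_ : [set om | _] = set0) ?measure0 ?subrr//.
  by apply/seteqP; split => // om [n /andP[h1 h2]]; move: (le_lt_trans h1 h2); rewrite ltxx.
pose u i := s + i%:R * (t - s).
have iu : increasing_upto u 1.
  split=> [|[|i] //]; first by rewrite /u mul0r addr0.
  by rewrite /u mul0r addr0 mul1r addrC subrK.
have u0 : u 0%N = s by rewrite /u mul0r addr0.
have u1 : u 1%N = t by rewrite /u mul1r addrC subrK.
have := covers_le clocks iu (F := [:: (x, 0%N)]) (delta := t - s) isT.
rewrite expr1 => /(_ _ _)/[dup] _ h.
apply: le_trans (h _ _); last 2 first.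
- by move=> [|i]//; rewrite u0 u1.
- by rewrite subr_ge0 ltW.
apply: (negligible_le _ _ (infinite_rings_negligible clocks)).
- apply: measurable_exists => n; exact: (measurable_ring_time clocks).
- exact: (measurable_covers clocks).
move=> om /infinite_ringsP lf [n hn] c; rewrite inE => /eqP->.
rewrite /= eqxx /cell_count /= u0 u1 cardfs_gt0; apply/fset0Pn; exists n.
by rewrite in_fset_set; [exact/mem_set|exact: locally_finite_sub].
Qed.

(** The event can change between [s] and [t] only if a clock rings on [xs] or at 0, whose height is
    subtracted everywhere; hence the factor [(size xs).+1]. *)
Lemma time_law_lip C xs s t : depends_on xs C -> s <= t ->
  time_law C s <= time_law C t + (size xs).+1%:R * (t - s).
Proof.
move=> dC st; have lC : local C by exists xs.
pose s' := Num.max 0 s; pose t' := Num.max 0 t.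
have s'0 : 0 <= s' by rewrite le_max lexx.
have st' : s' <= t' by rewrite ge_max !le_max lexx st orbT.
have d' : t' - s' <= t - s.
  rewrite /t' /s'; case: (leP 0 s); case: (leP 0 t); move: st; lra.
apply: (@le_trans _ _ (time_law C t + (size xs).+1%:R * (t' - s'))); last first.
  by rewrite lerD2l ler_pM2l.
rewrite -lee_fin EFinD -!time_lawE//.
pose G x := [set om | exists n, s' <= tau om x n < t'].
have mG x : measurable (G x).
  by apply: measurable_exists => n; exact: (measurable_ring_time clocks).
apply: (le_bad (N := irregular tau) (B := [set om | exists2 x, x \in 0 :: xs & G x om])).
- exact: measurable_profile.
- exact: measurable_profile.
- exact: measurable_has.
- apply: (le_trans (@le_has _ _ _ _ _ (0 :: xs) G (t' - s')%:E (fun x _ => mG x) _)).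
    by move=> x _; exact: ring_le_prob.
  by rewrite sumEFin lee_fin big_const_seq count_predT iter_addr_0 -[X in X <= _]mulr_natl.
- exact: irregular_negligible.
move=> om /contrapT reg nB; apply: dC => x xxs; rewrite /profile /rel_height.
have still y : y \in 0 :: xs ->
    height (tau om) w0 t' y = height (tau om) w0 s' y.
  move=> yx; apply: height_still => // n hn; apply: nB; exists y => //.
  by exists n.
by rewrite -/s' -/t' !still// inE ?eqxx ?xxs ?orbT.
Qed.

Lemma time_law_measurable C : local C -> bounded_measurable (time_law C).
Proof.
move=> lC; split; last first.
  by exists 1 => t; rewrite ger0_norm ?time_law_ge0// time_law_le1.
have [xs dC] := lC.
exact: (@lipschitz_measurable _ _ (size xs).+1%:R (fun s t => time_law_lip dC)).
Qed.

Definition avg_law C S : R := avg S (time_law C).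

Lemma avg_law_itv C S : local C -> 0 < S -> 0 <= avg_law C S <= 1.
Proof.
move=> lC S0; have bC := time_law_measurable lC.
rewrite -{1}(avg_cst 0 S0) -(avg_cst 1 S0); apply/andP; split; apply: avg_le => //.
- exact: bounded_measurable_cst.
- by move=> t _ _; exact: time_law_ge0.
- exact: bounded_measurable_cst.
- by move=> t _ _; exact: time_law_le1.
Qed.

Lemma avg_lawT S : 0 < S -> avg_law setT S = 1.
Proof.
move=> S0; rewrite -(avg_cst 1 S0); congr avg; apply/funext => t.
by rewrite /time_law (_ : [set om | _] = setT) ?probability_setT//; apply/seteqP; split.
Qed.

Lemma time_lawID C C' t : local C -> local C' ->
  time_law C t = time_law (C `&` C') t + time_law (C `&` ~` C') t.
Proof.
move=> lC lC'.
have l1 := localI lC lC'; have l2 := localI lC (localC lC').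
have m1 := measurable_profile t l1; have m2 := measurable_profile t l2.
apply: EFin_inj; rewrite EFinD -!time_lawE// -measureU//.
- congr (P _); apply/seteqP; split => om /=; last by case=> [[]|[]].
  by move=> c; have [c'|c'] := pselect (C' (profile t om)); [left|right].
- by apply/seteqP; split => // om [[_ c] [_]].
Qed.

Lemma avg_lawID C C' S : local C -> local C' ->
  avg_law C S = avg_law (C `&` C') S + avg_law (C `&` ~` C') S.
Proof.
move=> lC lC'; rewrite -avgD; try apply: time_law_measurable.
- by congr avg; apply/funext => t; exact: time_lawID.
- exact: localI.
- exact: localI lC (localC lC').
Qed.

Lemma avg_law_shift C S s : local C -> 0 < S -> 0 <= s ->
  avg S (fun t => time_law C (t + s)) <= avg_law C S + s / S.
Proof.
move=> lC S0 s0; have := avg_shift S0 s0 (time_law_measurable lC) (M := 1).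
rewrite mulr1; apply => t; rewrite time_law_ge0// time_law_le1//.
Qed.

Local Notation m := (mean P tau first).

Lemma mean_avg : exists2 K : R, 0 <= K & forall S, 1 <= S -> exists2 f,
  bounded_measurable f & avg S f <= K /\
    forall t, 0 <= t -> t <= S -> f t = m (t + 1) - m t.
Proof.
apply: (@avg_increment _ m (@mesh R d)^-1); first by rewrite invr_ge0 ltW ?mesh_gt0.
- exact: mean_ge0.
- exact: mean_mono.
- exact: (mean_le clocks).
Qed.

(** Markov's inequality: the mean absolute increment is at most C times the unit growth of the mean
    height, whose time average is bounded by K uniformly in S. *)
Lemma tight x (e : R) : 0 < e -> exists M : nat, forall S, 1 <= S ->
  avg_law [set eta : height_space d | (M < `|(eta : site d -> int) x|)%N] S <= e.
Proof.
move=> e0; have [C C0 hx] := incr_bound_all clocks first x.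
have [K K0 hK] := mean_avg.
pose M := (Num.truncn (C * K / e)).+1.
have M0 : 0 < M%:R :> R by rewrite ltr0n.
exists M => S S1; have S0 : 0 < S by exact: lt_le_trans S1.
have [f bf [fK fE]] := hK S S1.
have lC : local [set eta : height_space d | (M < `|(eta : site d -> int) x|)%N].
  exact: (local_map [:: x] (fun v => (M < `|nth 0%R v 0|)%N)).
apply: (@le_trans _ _ (avg S (fun t => (C / M%:R) * f t))).
  apply: avg_le => //; [exact: time_law_measurable|exact: bounded_measurableZ|].
  move=> t t0 tS; rewrite fE// mulrAC ler_pdivlMr//.
  rewrite -lee_fin EFinM -time_lawE//.
  apply: le_trans (hx t t0); apply: le_trans (markov_nat P M (dmeas_wN clocks first t x)).
  suff -> : [set om | [set eta : height_space d | (M < `|(eta : site d -> int) x|)%N]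
      (profile t om)] = [set om | (M < wN tau first t x om)%N] by [].
  by apply/seteqP; split => om /=; rewrite /profile (max_idPr t0).
rewrite avgZ// mulrAC ler_pdivrMr//; apply: (@le_trans _ _ (C * K)).
  by rewrite ler_wpM2l.
by rewrite [leRHS]mulrC -ler_pdivrMr//; exact: (ltW (truncnS_gt _)).
Qed.

End time_laws.

(** * A measure with given cylinder probabilities *)

(* Words are stored in reverse order: [k :: s] extends the word [s] by the letter [k]. *)
Section interval_code.
Variables (R : realType) (p : seq nat -> R).
Hypothesis p_ge0 : forall s, 0 <= p s.
Hypothesis p_nil : p [::] = 1.
Hypothesis p_sum : forall s, (\sum_(j < n) p (nat_of_ord j :: s)) @[n --> \oo] --> p s.

(** Words of a given length index consecutive half-open intervals of lengths [p s] that partition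
    [0, 1); those of the words [k :: s] subdivide that of [s] in the order of k. *)
Fixpoint left_end (s : seq nat) : R :=
  if s is k :: s' then left_end s' + \sum_(j < k) p (nat_of_ord j :: s') else 0.

Definition in_cell s (u : R) := left_end s <= u < left_end s + p s.

Lemma partial_le s n : \sum_(j < n) p (nat_of_ord j :: s) <= p s.
Proof.
pose q n := \sum_(j < n) p (nat_of_ord j :: s).
have mq : nondecreasing_seq q.
  by apply/nondecreasing_seqP => m; rewrite /q big_ord_recr /= lerDl.
rewrite -(cvg_lim (@Rhausdorff R) (@p_sum s)).
by apply: (nondecreasing_cvgn_le mq); apply/cvg_ex; exists (p s); exact: p_sum.
Qed.

Lemma right_end k s :
  left_end (k :: s) + p (k :: s) = left_end s + \sum_(j < k.+1) p (nat_of_ord j :: s).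
Proof. by rewrite /= big_ord_recr /= addrA. Qed.

Lemma cell_behead k s u : in_cell (k :: s) u -> in_cell s u.
Proof.
rewrite /in_cell right_end => /andP[h1 h2]; apply/andP; split.
  by apply: le_trans h1; rewrite /= lerDl sumr_ge0.
by apply: lt_le_trans h2 _; rewrite lerD2l partial_le.
Qed.

Lemma cell_drop n s u : in_cell s u -> in_cell (drop n s) u.
Proof.
elim: n s => [|n IH] [|k s]//.
by move=> /cell_behead/IH.
Qed.

Lemma cell_inj s s' u : size s = size s' -> in_cell s u -> in_cell s' u -> s = s'.
Proof.
elim: s s' => [|k s IH] [|k' s']// [ss] c c'.
have e := IH _ ss (cell_behead c) (cell_behead c').
rewrite -{}e in c' *; congr (_ :: _); move: c c'.
wlog kk : k k' / (k < k')%N => [w c c'|].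
  by case: (ltngtP k k') => // h; [exact: w h c c'|apply/esym; exact: w h c' c].
rewrite /in_cell right_end => /andP[_ h1] /andP[h2 _].
have : left_end s + \sum_(j < k.+1) p (nat_of_ord j :: s) <= left_end (k' :: s).
  rewrite /= lerD2l -(subnKC kk) big_split_ord /= lerDl.
  by rewrite sumr_ge0.
by move=> h3; move: (lt_le_trans h1 (le_trans h3 h2)); rewrite ltxx.
Qed.

(** The letter is found at the first partial sum that passes u. By [p_sum] there is one: no mass
    escapes to infinite letters. *)
Lemma cell_extend s u : in_cell s u -> exists k, in_cell (k :: s) u.
Proof.
move=> /andP[h1 h2].
have ex : exists n, u < left_end s + \sum_(j < n) p (nat_of_ord j :: s).
  have lt : u - left_end s < p s by rewrite ltrBlDl.
  have [n _ /(_ n (leqnn n))] := cvgr_gt _ (@p_sum s) _ lt.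
  by exists n; rewrite -ltrBlDl.
case: (ex_minnP ex) => -[|k] hk mk.
  by move: hk; rewrite big_ord0 addr0 ltNge h1.
exists k; rewrite /in_cell right_end hk andbT /= leNgt; apply/negP => /mk.
by rewrite ltnn.
Qed.

Lemma left_end_ge0 s : 0 <= left_end s.
Proof. by elim: s => //= k s IH; rewrite addr_ge0// sumr_ge0. Qed.

Lemma right_end_le1 s : left_end s + p s <= 1.
Proof.
elim: s => [|k s IH]; first by rewrite p_nil add0r.
by rewrite right_end; apply: le_trans IH; rewrite lerD2l partial_le.
Qed.

Lemma cell_exists n u : 0 <= u < 1 -> exists s, size s = n /\ in_cell s u.
Proof.
move=> u01; elim: n => [|n [s [<- c]]].
  by exists [::]; rewrite /in_cell p_nil add0r.
by have [k ck] := cell_extend c; exists (k :: s).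
Qed.

(** Cells cover [0, 1) only; sending all other reals to 0 gives every real a code. *)
Definition clamp (u : R) := if 0 <= u < 1 then u else 0.

Definition code n u : seq nat := xget [::] [set s | size s = n /\ in_cell s (clamp u)].

Lemma codeP n u : size (code n u) = n /\ in_cell (code n u) (clamp u).
Proof.
have [|s hs] := @cell_exists n (clamp u).
  by rewrite /clamp; case: ifP => // _; rewrite lexx ltr01.
by apply: (@xgetPex _ [::] [set s | size s = n /\ in_cell s (clamp u)]); exists s.
Qed.

Lemma code_drop m n u : (m <= n)%N -> code m u = drop (n - m) (code n u).
Proof.
move=> mn; have [s1 c1] := codeP m u; have [s2 c2] := codeP n u.
by apply: cell_inj c1 (cell_drop _ c2); rewrite size_drop s2 subKn.
Qed.

Lemma code_eq s u : code (size s) u = s <-> in_cell s (clamp u).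
Proof.
have [s1 c1] := codeP (size s) u; split => [<-//|c].
exact: cell_inj c1 c.
Qed.

Lemma measurable_cell s : measurable [set u | in_cell s u].
Proof.
rewrite (_ : [set u | _] = `[left_end s, left_end s + p s[%classic)//.
Qed.

Lemma dmeas_code n : dmeas (code n).
Proof.
move=> s; have [ns|ns] := eqVneq (size s) n; last first.
  rewrite (_ : [set u | _] = set0)//; apply/seteqP; split => // u /= us.
  by have [h _] := codeP n u; move: ns; rewrite -us h eqxx.
rewrite (_ : [set u | _] = clamp @^-1` [set u | in_cell s u]); last first.
  by apply/seteqP; split => u /=; rewrite -ns => /code_eq.
rewrite -[X in measurable X]setTI; have mc : measurable_fun setT clamp.
  apply: measurable_fun_if => //=; apply: measurable_function.measurable_and => //.
  - exact: measurable_fun_ler.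
  - exact: measurable_fun_ltr.
exact: mc (measurable_cell s).
Qed.

Lemma code_law s :
  uniform_prob (@ltr01 R) [set u | code (size s) u = s] = (p s)%:E.
Proof.
set E := [set u | _]; have mE : measurable E := @dmeas_code (size s) s.
have mL : lebesgue_measure [set u | in_cell s u] = (p s)%:E.
  rewrite (_ : [set u | _] = `[left_end s, left_end s + p s[%classic); last first.
    by apply/seteqP; split => u /=; rewrite in_itv.
  rewrite lebesgue_measure_itv /= lte_fin -EFinB addrAC subrr add0r ltrDl.
  by case: ltgtP (p_ge0 s) => // <-.
have -> : uniform_prob (@ltr01 R) E = lebesgue_measure (E `&` `[0, 1]%classic).
  transitivity (\int[uniform_prob (@ltr01 R)]_u (\1_E u)%:E)%E.
    by rewrite integral_indic// setIT.
  rewrite integral_uniform//.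
  - by rewrite subr0 invr1 mul1e integral_indic.
  - exact/measurable_EFinP/measurable_indic.
apply/eqP; rewrite eq_le; apply/andP; split.
  (* Inside [0, 1] the event can differ from the cell only at the point 1, which is clamped to 0 and
     has measure zero. *)
  apply: (@le_trans _ _ (lebesgue_measure ([set u | in_cell s u] `|` [set 1]))).
    apply: le_measure; rewrite ?inE; [exact: measurableI|exact: measurableU (measurable_cell s) _|].
    move=> u [/code_eq cu]; rewrite /= in_itv /= => /andP[u0]; rewrite le_eqVlt => /orP[/eqP->|u1].
      by right.
    by left; move: cu; rewrite /clamp u0 u1.
  rewrite -mL -[leRHS]adde0 -(lebesgue_measure_set1 1).
  by apply: measureU2 => //; exact: measurable_cell.
rewrite -mL; apply: le_measure; rewrite ?inE; [exact: measurable_cell|exact: measurableI|].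
move=> u cu; have /andP[h1 h2] := cu.
have u0 := le_trans (left_end_ge0 s) h1; have u1 := lt_le_trans h2 (right_end_le1 s).
by split; [apply/code_eq; rewrite /clamp u0 u1|rewrite /= in_itv /= u0 ltW].
Qed.

End interval_code.

(** * Generalized limits along time averages *)

Section generalized_limit.
Variable R : realType.
Implicit Types f g : R -> R.

Definition ebounded f := exists M, \forall S \near +oo, `|f S| <= M.

(** Along an ultrafilter finer than the neighbourhoods of +oo, every eventually bounded function
    converges, by compactness of [-M, M]. The four properties are then those of ordinary limits. *)
Lemma exists_generalized_limit : exists Lim : (R -> R) -> R,
  [/\ forall c, Lim (fun=> c) = c,
      forall c f, ebounded f -> Lim (fun S => c * f S) = c * Lim f,
      forall f g, ebounded f -> ebounded g -> Lim (fun S => f S + g S) = Lim f + Lim g &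
      forall f g, ebounded f -> ebounded g -> (\forall S \near +oo, f S <= g S) ->
        Lim f <= Lim g].
Proof.
have [G [UG sG]] := @ultraFilterLemma R (pinfty_nbhs R) _.
have cf f : ebounded f -> f x @[x --> G] --> lim (f x @[x --> G]).
  move=> [M fM].
  have := @segment_compact R (- M) M (f x @[x --> G]) _; case.
    apply: sG; apply: filterS fM => S; rewrite ler_norml => h.
    by rewrite /= in_itv.
  move=> y [_ cy]; apply: (@cvgP _ _ y) => V Vy.
  have [//|nV] := in_ultra_setVsetC (f @^-1` V) UG.
  by have [z []] := cy (~` V) V nV Vy.
exists (fun f => lim (f x @[x --> G])); split.
- by move=> c; exact: lim_cst.
- by move=> c f /cf bf; apply: cvg_lim => //; exact: cvgM (cvg_cst c) bf.
- by move=> f g /cf bf /cf bg; apply: cvg_lim => //; exact: cvgD.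
- move=> f g /cf bf /cf bg fg; rewrite -subr_ge0.
  apply: cvgr_to_ge (cvgB bg bf) _; apply: sG.
  by apply: filterS fg => S; rewrite subr_ge0.
Qed.

End generalized_limit.

(** * From finitely additive laws of local sets to measures *)

Lemma exists_image_probability (R : realType) (d1 d2 : measure_display)
    (T1 : measurableType d1) (T2 : measurableType d2) (Q : probability T1 R) (f : T1 -> T2) :
  measurable_fun setT f ->
  exists mu : probability T2 R, forall A, mu A = Q (f @^-1` A).
Proof.
by move=> mf; exists (distribution Q (mfun_Sub (mem_set mf : f \in mfun))).
Qed.

Section local_extension.
Variables (R : realType) (d : nat) (m : set (height_space d) -> R).
Implicit Types C : set (height_space d).
Hypothesis m_ge0 : forall C, local C -> 0 <= m C.
Hypothesis mT : m setT = 1.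
Hypothesis mID : forall C C', local C -> local C' -> m C = m (C `&` C') + m (C `&` ~` C').
Hypothesis m_tight : forall x e, 0 < e -> exists M : nat,
  m [set eta : height_space d | (M < `|(eta : site d -> int) x|)%N] <= e.

Lemma local_mono C C' : local C -> local C' -> C `<=` C' -> m C <= m C'.
Proof.
move=> lC lC' sub; rewrite (mID lC' lC) setIidr// lerDl m_ge0//.
exact: localI lC' (localC lC).
Qed.

Lemma local_set0 : local (@set0 (height_space d)).
Proof. by rewrite -setCT; exact: localC (local_setT d). Qed.

Lemma m_set0 : m set0 = 0.
Proof.
have := mID local_set0 local_set0; rewrite setIid set0I => /eqP.
by rewrite -subr_eq subrr eq_sym => /eqP.
Qed.

Lemma local_sum_le C (E : nat -> set (height_space d)) n : local C ->
  (forall i, local (E i)) -> (forall i, E i `<=` C) ->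
  (forall i j eta, E i eta -> E j eta -> i = j) ->
  \sum_(i < n) m (E i) <= m C.
Proof.
elim: n C E => [|n IH] C E lC lE EC disj; first by rewrite big_ord0 m_ge0.
rewrite big_ord_recr /= (mID lC (lE n)) setIidr// addrC lerD2l.
set C' := C `&` ~` E n; have lC' : local C' by exact: localI lC (localC (lE n)).
pose E' (i : nat) := if i == n then set0 else E i.
rewrite (eq_bigr (fun i : 'I_n => m (E' i))); last first.
  by move=> i _; rewrite /E' ltn_eqF.
apply: IH => // [i|i eta|i j eta].
- by rewrite /E'; case: eqP => // _; exact: local_set0.
- rewrite /E'; case: eqP => // ni Ei; split; first exact: EC Ei.
  by move=> En; apply: ni; exact: disj Ei En.
- by rewrite /E'; case: eqP => // _; case: eqP => // _; exact: disj.
Qed.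

(** Numbers that encode no site give the site 0, so one coordinate may be read several times;
    contradictory words then have an empty [word_set]. *)
Definition site_of i : site d := odflt 0 (pickle_inv i).

Lemma site_ofK x : site_of (choice.pickle x) = x.
Proof. by rewrite /site_of pickleK_inv. Qed.

Fixpoint word_set (s : seq nat) : set (height_space d) :=
  if s is k :: s' then word_set s' `&`
    [set eta | choice.pickle ((eta : site d -> int) (site_of (size s'))) = k]
  else setT.

Lemma local_word s : local (word_set s).
Proof.
elim: s => [|k s IH] /=; first exact: local_setT.
apply: localI => //.
exact: (local_map [:: site_of (size s)] (fun v => choice.pickle (nth 0 v 0) = k)).
Qed.

Lemma word_set_inj s s' eta : size s = size s' ->
  word_set s eta -> word_set s' eta -> s = s'.
Proof.
elim: s s' => [|k s IH] [|k' s']// [ss] /= [w1 <-] [w2 <-].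
by rewrite (IH _ ss w1 w2).
Qed.

Definition decode (k : nat) : int := odflt 0 (choice.unpickle k).

Definition word_config (s : seq nat) : site d -> int :=
  fun x => decode (nth 0%N s (size s - (choice.pickle x).+1)).

Lemma word_configE s (eta : site d -> int) x : word_set s eta ->
  (choice.pickle x < size s)%N -> eta x = word_config s x.
Proof.
rewrite /word_config; elim: s => [//|k s IH] /= [w <-].
rewrite ltnS leq_eqVlt => /orP[/eqP xs|xs].
  by rewrite -xs subnn /= site_ofK /decode choice.pickleK.
by rewrite IH// subSS -(subnSK xs).
Qed.

Definition word_law s := m (word_set s).

Lemma word_law_partial s n : \sum_(j < n) word_law (nat_of_ord j :: s) =
  word_law s - m (word_set s `&`
    [set eta | (n <= choice.pickle ((eta : site d -> int) (site_of (size s))))%N]).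
Proof.
pose G n : set (height_space d) :=
  [set eta | (n <= choice.pickle ((eta : site d -> int) (site_of (size s))))%N].
have lG k : local (word_set s `&` G k).
  apply: localI; first exact: local_word.
  exact: (local_map [:: site_of (size s)] (fun v => k <= choice.pickle (nth 0%R v 0))%N).
rewrite -/(G n); elim: n => [|n IH].
  by rewrite big_ord0 (_ : G 0%N = setT) ?setIT ?subrr//; apply/seteqP; split.
rewrite big_ord_recr /= IH (mID (lG n) (local_word (n :: s))).
rewrite (_ : _ `&` _ `&` word_set _ = word_set (n :: s)); last first.
  by apply/seteqP; split => eta /=; [case|move=> [w e]; split => //; split => //; rewrite /G /= e].
rewrite (_ : _ `&` _ `&` ~` _ = word_set s `&` G n.+1); last first.
  apply/seteqP; split => eta /= [].
    move=> [w h] nw; split => //; rewrite /G /= ltn_neqAle (h : (n <= _)%N) andbT.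
    by apply/eqP => e; apply: nw.
  by move=> w h; split; [split => //; exact: ltnW h|move=> [_ e]; move: h; rewrite /G /= e ltnn].
by rewrite /word_law; lra.
Qed.

(** Here tightness enters: letters from n on correspond to large heights when n is large, so the
    remainder in [word_law_partial] vanishes and finite additivity becomes countable in each
    coordinate. *)
Lemma word_law_sum s :
  (\sum_(j < n) word_law (nat_of_ord j :: s)) @[n --> \oo] --> word_law s.
Proof.
apply/cvgrPdist_le => e e0; have [M hM] := m_tight (site_of (size s)) e0.
pose vs : seq int := [seq (i%:Z) | i <- iota 0 M.+1] ++ [seq (- i%:Z)%R | i <- iota 0 M.+1].
(* Beyond the codes of all integers of absolute value at most M, a letter forces a height above
   M. *)
exists (\max_(v <- vs) choice.pickle v).+1 => // n /= hn.
rewrite word_law_partial opprB addrC subrK.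
set C := _ `&` _; have lC : local C.
  apply: localI; first exact: local_word.
  exact: (local_map [:: site_of (size s)] (fun v => n <= choice.pickle (nth 0%R v 0))%N).
rewrite ger0_norm ?m_ge0//; apply: le_trans hM; apply: local_mono => //.
  exact: (local_map [:: site_of (size s)] (fun v => M < `|nth 0%R v 0|)%N).
move=> eta [_ /=]; apply: contraPltn => le; apply/negP; rewrite -ltnNge.
apply: leq_ltn_trans hn; apply: leq_bigmax_seq => //; rewrite mem_cat.
move: ((eta : site d -> int) (site_of (size s))) le => [i|i] le.
  by apply/orP; left; apply/mapP; exists i => //; rewrite mem_iota add0n ltnS.
by apply/orP; right; apply/mapP; exists i.+1 => //; rewrite mem_iota add0n ltnS.
Qed.

Lemma word_law_ge0 s : 0 <= word_law s.
Proof. exact: m_ge0 (local_word s). Qed.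

Local Notation code := (code word_law).
Let cs := code_law word_law_ge0 mT word_law_sum.
Let dcs := dmeas_code word_law_ge0 mT word_law_sum.

Definition limit_state (u : R) : height_space d :=
  fun x => decode (head 0%N (code (choice.pickle x).+1 u)).

Lemma limit_stateE n u x : (choice.pickle x < n)%N ->
  limit_state u x = word_config (code n u) x.
Proof.
move=> xn; have [sn _] := codeP mT word_law_sum n u.
rewrite /limit_state /word_config sn.
by rewrite (code_drop word_law_ge0 mT word_law_sum u xn) -nth0 nth_drop addn0.
Qed.

Lemma dmeas_limit_state x : dmeas (fun u => limit_state u x).
Proof. exact: (dmeas_comp (fun s => decode (head 0%N s)) (dcs (choice.pickle x).+1)). Qed.

(** The event is a countable disjoint union over words of length n, and every finite part of the sum
    is at most [m C] by [local_sum_le]. An inequality suffices, as it also applies to the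
    complement. *)
Lemma limit_state_le C : local C ->
  (uniform_prob (@ltr01 R) [set u | C (limit_state u)] <= (m C)%:E)%E.
Proof.
move=> lC; have [xs dC] := lC; pose n := (\max_(x <- xs) choice.pickle x).+1.
have xn x : x \in xs -> (choice.pickle x < n)%N.
  by move=> xxs; rewrite ltnS; exact: leq_bigmax_seq.
pose B : set (seq nat) := [set s | C (word_config s)].
have -> : [set u | C (limit_state u)] = [set u | B (code n u)].
  by apply/seteqP; split => u /=; apply: dC => x /xn xk; rewrite (limit_stateE u xk).
refine (eq_ind_r (fun z => (z <= _)%E) _ (law_sum (uniform_prob (@ltr01 R)) B (dcs n))).
pose E i : set (height_space d) :=
  oapp (fun s => if (size s == n) && (s \in B) then word_set s else set0) set0 (pickle_inv i).
have lE i : local (E i).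
  rewrite /E; case: pickle_inv => [s|] /=; last exact: local_set0.
  by case: ifP => _; [exact: local_word|exact: local_set0].
apply: lime_le => /=.
  apply: is_cvg_nneseries => i _ _.
  by case: pickle_inv => [s|] //=; case: ifP.
apply: nearW => k; rewrite big_mkord.
apply: (@le_trans _ _ (\sum_(i < k) m (E i))%:E); last first.
  rewrite lee_fin; apply: local_sum_le => // [i eta|i j eta].
    rewrite /E; case: pickle_inv => [s|] //=; case: ifP => // /andP[/eqP sn sB] ws.
    by apply: dC (set_mem sB) => x /xn xk; rewrite (word_configE ws)// sn.
  rewrite /E; have := @pickle_invK (seq nat) i; have := @pickle_invK (seq nat) j.
  case: pickle_inv => [s|] //= <-; case: pickle_inv => [s'|] //= <-.
  case: ifP => // /andP[/eqP sn _] ws; case: ifP => // /andP[/eqP s'n _] ws'.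
  by congr choice.pickle; apply: word_set_inj ws ws'; rewrite sn s'n.
rewrite -sumEFin; apply: lee_sum => i _; rewrite /E.
case: pickle_inv => [s|] /=; last by rewrite m_set0.
case: (boolP (s \in B)) => sB; last by rewrite andbF m_set0.
rewrite andbT; case: eqP => [<-|ns]; first by rewrite cs.
rewrite m_set0 (_ : [set u | _] = set0) ?measure0//; apply/seteqP; split => // u /= us.
by apply: ns; rewrite -us; have [] := codeP mT word_law_sum n u.
Qed.

Theorem exists_local_extension : exists mu : probability (height_space d) R,
  forall C, local C -> mu C = (m C)%:E.
Proof.
have mX : measurable_fun setT limit_state.
  exact: measurable_height_space_fun dmeas_limit_state.
have [mu muE] := exists_image_probability (uniform_prob (@ltr01 R)) mX.
exists mu => C lC; have lC' := localC lC.
have le C' : local C' -> (mu C' <= (m C')%:E)%E.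
  by move=> lC''; rewrite muE; exact: limit_state_le.
apply/eqP; rewrite eq_le le//=.
have fC : mu C \is a fin_num by apply: fin_num_measure; exact: measurable_local.
have := le _ lC'; rewrite (probability_setC mu (measurable_local lC)).
rewrite -(fineK fC) -EFinB !lee_fin.
by have := mID (local_setT d) lC; rewrite mT !setTI; lra.
Qed.

End local_extension.

(** * Invariance of the limit law *)

Section countable_splitting.
Context (R : realType) (disp : measure_display) (T : measurableType disp).
Variables (K : countType) (X : T -> K).
Hypothesis mX : dmeas X.

Lemma measure_split_list (m : {measure set T -> \bar R}) (s : seq K) (E : K -> set T) :
  uniq s -> (forall k, measurable (E k)) ->
  m [set o | X o \in s /\ E (X o) o] = (\sum_(k <- s) m [set o | X o = k /\ E k o])%E.
Proof.
move=> + mE; elim: s => [_|k s IH /= /andP[ks us]].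
  by rewrite big_nil (_ : [set o | _] = set0) ?measure0//; apply/seteqP; split => // o [].
rewrite big_cons -IH// -measureU.
- congr (m _); apply/seteqP; split => o /=.
    by rewrite inE => -[/orP[/eqP<-|xs] Eo]; [left|right].
  by case=> [[<- Eo]|[xs Eo]]; rewrite inE ?eqxx ?xs ?orbT.
- exact: measurable_and (mX k) (mE k).
- rewrite (_ : [set o | _] = [set o | exists2 k, k \in s & X o = k /\ E k o]).
    by apply: measurable_has => j _; exact: measurable_and (mX j) (mE j).
  apply/seteqP; split => o /=; first by move=> [xs Eo]; exists (X o).
  by move=> [j js [xj Eo]]; rewrite xj.
- by apply/seteqP; split => // o [[Xk _] [h _]]; move: ks; rewrite -Xk h.
Qed.

Lemma exists_finite_support (P : probability T R) (e : R) : 0 < e ->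
  exists2 s : seq K, uniq s & (P [set o | X o \notin s] <= e%:E)%E.
Proof.
move=> e0; pose s n := pmap pickle_inv (iota 0 n) : seq K.
pose G n := [set o | X o \notin s n].
have mG n : measurable (G n) := dmeas_set (fun k => k \notin s n) mX.
have : P (G n) @[n --> \oo] --> P (\bigcap_n G n).
  apply: nonincreasing_cvg_mu => //.
  - by apply: le_lt_trans (probability_le1 P (mG 0%N)) _; exact: ltry.
  - exact: bigcapT_measurable.
  move=> m n mn; apply/subsetPset => o; rewrite /G /=; apply: contra.
  rewrite !mem_pmap => /mapP[i]; rewrite mem_iota => im ->.
  by apply: map_f; rewrite mem_iota; lia.
rewrite (_ : \bigcap_n G n = set0) ?measure0; last first.
  apply/seteqP; split => // o /(_ (choice.pickle (X o)).+1 Logic.I); rewrite /G /=.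
  move/negP; apply; rewrite mem_pmap -pickleK_inv; apply: map_f.
  by rewrite mem_iota /=.
move=> /fine_cvgP[fin /cvgrPdist_le/(_ e e0) [n _ /(_ n (leqnn n))]] /= h.
exists (undup (s n)); first exact: undup_uniq.
rewrite (_ : [set o | _] = G n); last first.
  by apply/seteqP; split => o; rewrite /G /= mem_undup.
have f : P (G n) \is a fin_num by exact: fin_num_measure.
by rewrite -(fineK f) lee_fin; move: h; rewrite sub0r normrN ger0_norm// fine_ge0.
Qed.

End countable_splitting.

(** A chain is never longer than the list of updates, so a fixed list reads the initial state at
    finitely many sites only. *)
Lemma evolve_finite_range d (l : seq (site d)) (eta eta' : site d -> int) x :
  {in reach (size l).+1 x, eta =1 eta'} -> evolve eta l x = evolve eta' l x.
Proof.
apply: evolve_dep => -[p [sp] _ /size_subseq]; rewrite size_rev sp.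
by rewrite ltnn.
Qed.

Section transition.
Context (R : realType) (disp : measure_display) (T : measurableType disp).
Variables (P : probability T R) (d : nat) (tau : T -> site d -> nat -> R).
Hypothesis clocks : poisson_clocks P tau.
Implicit Type C : set (height_space d).

Lemma dmeas_transition (d1 : measure_display) (T1 : measurableType d1)
    (Y : T1 -> height_space d) t x : (forall x, dmeas (fun o => Y o x)) ->
  dmeas (fun p : T1 * T => rel_height (tau p.2) (Y p.1) t x).
Proof.
move=> mY; exact: (dmeas_op (fun a b : int => a - b) (dmeas_height_fst clocks t x mY)
  (dmeas_height_fst clocks t 0 mY)).
Qed.

(* Up to a small error the dynamics choose one of finitely many lists of updates,
   independently of the initial state. *)
Lemma transition_approx t C (e : R) : 0 <= t -> local C -> 0 < e ->
  exists (s : seq (seq nat)) (q : seq nat -> R) (K : seq nat -> set (height_space d)),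
  [/\ forall ks, 0 <= q ks, forall ks, local (K ks) &
  forall (d1 : measure_display) (T1 : measurableType d1) (Q : probability T1 R)
    (Y : T1 -> height_space d), (forall x, dmeas (fun o => Y o x)) ->
    ((Q \x P) [set p | C (rel_height (tau p.2) (Y p.1) t)] <=
      (\sum_(ks <- s) q ks * fine (Q [set o | K ks (Y o)]))%:E + e%:E /\
    (\sum_(ks <- s) q ks * fine (Q [set o | K ks (Y o)]))%:E <=
      (Q \x P) [set p | C (rel_height (tau p.2) (Y p.1) t)] + e%:E)%E].
Proof.
move=> t0 [xs /localE[A ->]] e0.
have e20 : 0 < e / 2 by rewrite divr_gt0.
have e40 : 0 < e / 2 / 2 by rewrite divr_gt0.
have [D [ys [B [mB Be loc]]]] := exists_local_event clocks (0 :: xs) t e40.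
have [u [k1 [k2 [u0 _ uk iu fu]]]] := exists_grid D (lexx 0) t0 e40.
rewrite add0r in uk; set k := (k1 + k2)%N in uk iu fu.
have [B' [mB' B'e hB]] := heights_close clocks loc mB Be (fsubset_refl D) iu u0 uk fu.
pose N := counts tau u (cells D 0 k).
have mN : dmeas N := dmeas_counts clocks u _.
have [s us sP] := exists_finite_support mN P e20.
pose A' := [set v | A [seq z - head 0 v | z <- behead v]].
(* The event, for the initial state, that the updates listed by the counts [ks] lead into the given
   local set. *)
pose K ks : set (height_space d) := [set eta | A' [seq evolve (eta : site d -> int)
  (listing (cells D 0 k) ks) x | x <- 0 :: xs]].
have lK ks : local (K ks).
  exists (flatten [seq reach (size (listing (cells D 0 k) ks)).+1 x | x <- 0 :: xs]).
  move=> eta eta' ee; rewrite /K /mkset; congr (A' _).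
  apply/eq_in_map => x xxs; apply: evolve_finite_range => y yx; apply: ee.
  by apply/flatten_mapP; exists x.
exists s, (fun ks => fine (P [set om | N om = ks])), K; split => //.
  by move=> ks; exact: fine_ge0.
move=> d1 T1 Q Y mY.
set E1 := [set p : T1 * T | _].
have mE1 : measurable E1.
  apply: (local_measurable (f := fun p : T1 * T =>
    rel_height (tau p.2) (Y p.1) t : height_space d)) (local_map xs A) _ => x.
  exact: dmeas_transition.
have mKY ks : measurable [set o | K ks (Y o)] by exact: local_measurable.
pose E2 := [set p : T1 * T | K (N p.2) (Y p.1)].
have mN2 : dmeas (fun p : T1 * T => N p.2).
  by move=> ks; exact: measurable_on_snd (mN ks).
have mKY2 ks : measurable [set p : T1 * T | K ks (Y p.1)] by exact: measurable_on_fst (mKY ks).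
have mE2 : measurable E2.
  rewrite (_ : E2 = [set p | exists ks, N p.2 = ks /\ K ks (Y p.1)]).
    by apply: measurable_exists => ks; exact: measurable_and (mN2 ks) (mKY2 ks).
  apply/seteqP; split => p /=; first by exists (N p.2).
  by move=> [ks [<-]].
(* Keeping only the finitely many likely count vectors turns [E2] into a finite disjoint union of
   products, at a cost of e / 2. *)
pose E3 := [set p : T1 * T | N p.2 \in s /\ K (N p.2) (Y p.1)].
have mE3 : measurable E3.
  rewrite (_ : E3 = [set p | N p.2 \in s] `&` E2)//.
  by apply: measurableI => //; exact: (dmeas_set (fun ks => ks \in s) mN2).
have [h1 h2] : ((Q \x P) E1 <= (Q \x P) E2 + (e / 2)%:E /\
    (Q \x P) E2 <= (Q \x P) E1 + (e / 2)%:E)%E.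
  apply: (close_bad (B := [set p | B' p.2]) (N := [set p | infinite_rings tau p.2])) => //.
  - exact: measurable_on_snd.
  - exact: (eq_ind_r (fun z => (z <= (e / 2)%:E)%E) B'e (product_snd Q P mB')).
  - exact: (negligible_snd _ (infinite_rings_negligible clocks)).
  move=> p /= /(@infinite_ringsP _ _ _ _ tau) lf nB.
  have h := hB p.2 nB lf (Y p.1) (Y p.1) (fun _ _ => erefl).
  rewrite /E1 /E2 /K /mkset -/(N p.2) /A' -/(grid_heights _ _ _ _ _ _ _) -h /heights /mkset /=.
  by rewrite -map_comp.
have h3 : ((Q \x P) E2 <= (Q \x P) E3 + (e / 2)%:E)%E.
  apply: (@le_trans _ _ ((Q \x P) E3 + (Q \x P) [set p | N p.2 \notin s])%E).
    apply: le_or => //; first exact: (dmeas_set (fun ks => ks \notin s) mN2).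
    by move=> p Kp; case: (boolP (N p.2 \in s)) => h; [left|right].
  apply: leeD => //; apply: (eq_ind_r (fun z => (z <= (e / 2)%:E)%E) sP).
  by apply: product_snd; exact: (dmeas_set (fun ks => ks \notin s) mN).
have h4 : ((Q \x P) E3 <= (Q \x P) E2)%E.
  by apply: le_measure; rewrite ?inE// => p [].
have h5 : (Q \x P)%E E3 =
    (\sum_(ks <- s) fine (P [set om | N om = ks]) * fine (Q [set o | K ks (Y o)]))%:E.
  rewrite -sumEFin; apply: etrans (measure_split_list mN2 (Q \x P)%E us mKY2) _.
  apply: eq_bigr => ks _.
  have -> : [set p : T1 * T | N p.2 = ks /\ K ks (Y p.1)] =
      [set o | K ks (Y o)] `*` [set om | N om = ks].
    by apply/seteqP; split => p /=; case.
  apply: etrans (product_measure1E _ _ (mKY ks) (mN ks)) _.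
  by rewrite EFinM !fineK 1?muleC//; apply: fin_num_measure.
rewrite -h5; split.
  by apply: le_trans h1 _; rewrite [in leRHS](splitr e) EFinD addeA leeD2r.
apply: le_trans h4 _; apply: le_trans h2 _; rewrite leeD2l// lee_fin.
by rewrite ler_pdivrMr// ler_peMr ?ler1n// ltW.
Qed.

Lemma invariant_of_local (mu : probability (height_space d) R) :
  (forall t C, 0 <= t -> local C ->
    (mu \x P)%E [set p | C (rel_height (tau p.2) p.1 t)] = mu C) ->
  invariant_measure P tau mu.
Proof.
move=> h t t0 A mA.
pose Phi (p : height_space d * T) : height_space d := rel_height (tau p.2) p.1 t.
have mPhi : measurable_fun setT Phi.
  apply: measurable_height_space_fun => x.
  by apply: (dmeas_transition (Y := id)); exact: dmeas_coord.
have [nu nuE] := exists_image_probability (mu \x P)%E mPhi.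
rewrite -[LHS]/((mu \x P)%E (Phi @^-1` A)) -nuE.
apply: height_space_measure_unique => // F; rewrite nuE; apply: h => //.
exists [seq p.1 | p <- F] => eta eta' e c p pF.
by rewrite -e ?c//; apply: map_f.
Qed.

End transition.

Section stationary_limit.
Context (R : realType) (disp : measure_display) (T : measurableType disp).
Variables (P : probability T R) (d : nat) (tau : T -> site d -> nat -> R).
Hypothesis clocks : poisson_clocks P tau.
Variable first : 'I_d.
Implicit Type C : set (height_space d).

Local Notation time_law := (time_law P tau first).
Local Notation avg_law := (avg_law P tau first).

Lemma ebounded_avg_law C : local C -> ebounded (avg_law C).
Proof.
move=> lC; exists 1; apply: filterS (nbhs_pinfty_gt (num_real 0)) => S S0.
by have /andP[h1 h2] := avg_law_itv clocks first lC S0; rewrite ger0_norm.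
Qed.

Definition mean_functional (Lim : (R -> R) -> R) :=
  [/\ forall c, Lim (fun=> c) = c,
      forall c f, ebounded f -> Lim (fun S => c * f S) = c * Lim f,
      forall f g, ebounded f -> ebounded g -> Lim (fun S => f S + g S) = Lim f + Lim g &
      forall f g, ebounded f -> ebounded g -> (\forall S \near +oo, f S <= g S) ->
        Lim f <= Lim g].

Variable Lim : (R -> R) -> R.
Hypothesis hLim : mean_functional Lim.

Lemma ebounded_cst (c : R) : ebounded (fun=> c).
Proof. by exists `|c|; exact: nearW. Qed.

Lemma exists_limit_law : exists mu : probability (height_space d) R,
  forall C, local C -> mu C = (Lim (avg_law C))%:E.
Proof.
have [Lc LZ LD Lle] := hLim.
apply: exists_local_extension.
- move=> C lC; rewrite -(Lc 0); apply: Lle; [exact: ebounded_cst|exact: ebounded_avg_law|].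
  apply: filterS (nbhs_pinfty_gt (num_real 0)) => S S0.
  by have /andP[] := avg_law_itv clocks first lC S0.
- have lT := local_setT d; apply/eqP; rewrite eq_le -(Lc 1); apply/andP; split; apply: Lle;
    try exact: ebounded_cst; try exact: ebounded_avg_law;
    by apply: filterS (nbhs_pinfty_gt (num_real 0)) => S S0; rewrite avg_lawT.
- move=> C C' lC lC'; rewrite -LD.
  + by congr Lim; apply/funext => S; exact: avg_lawID.
  + by apply: ebounded_avg_law; exact: localI.
  + by apply: ebounded_avg_law; exact: localI lC (localC lC').
- move=> x e e0; have [M hM] := tight clocks first x e0.
  exists M; rewrite -[leRHS](Lc e); apply: Lle; [|exact: ebounded_cst|].
    by apply: ebounded_avg_law; exact: (local_map [:: x] (fun v => (M < `|nth 0%R v 0|)%N)).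
  by apply: filterS (nbhs_pinfty_ge (num_real 1)) => S S1; exact: hM.
Qed.

Variable mu : probability (height_space d) R.
Hypothesis muE : forall C, local C -> mu C = (Lim (avg_law C))%:E.

Lemma time_law_markov C s t : 0 <= s -> 0 <= t -> local C ->
  (P \x P)%E [set p : T * T | C (rel_height (tau p.2) (profile tau first s p.1) t)] =
  (time_law C (s + t))%:E.
Proof.
move=> s0 t0 lC; rewrite -time_lawE//; have [xs /localE[A ->]] := lC.
rewrite /profile (max_idPr s0) (max_idPr (addr_ge0 s0 t0)).
exact: (rel_heights_markov clocks (tilt first) xs A s0 t0).
Qed.

Lemma ebounded_sum (I : Type) (r : seq I) (q : I -> R) (f : I -> R -> R) :
  (forall i, ebounded (f i)) -> ebounded (fun S => \sum_(i <- r) q i * f i S) /\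
  Lim (fun S => \sum_(i <- r) q i * f i S) = \sum_(i <- r) q i * Lim (f i).
Proof.
have [Lc LZ LD Lle] := hLim; move=> bf; elim: r => [|i r [b IH]].
  rewrite big_nil (_ : (fun S => _) = (fun=> 0)); last first.
    by apply/funext => S; rewrite big_nil.
  by split; [exact: ebounded_cst|exact: Lc].
rewrite (_ : (fun S => _) = (fun S => q i * f i S + \sum_(j <- r) q j * f j S)); last first.
  by apply/funext => S; rewrite big_cons.
have bZ : ebounded (fun S => q i * f i S).
  have [M fM] := bf i; exists (`|q i| * M); apply: filterS fM => S h.
  by rewrite normrM ler_wpM2l.
split; last by rewrite big_cons LD// LZ// IH.
have [M1 h1] := bZ; have [M2 h2] := b; exists (M1 + M2).
apply: filterS2 h1 h2 => S h1 h2.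
by apply: le_trans (ler_normD _ _) _; rewrite lerD.
Qed.

(** [Lim] commutes with finite combinations of local probabilities. [transition_approx] replaces the
    transition by one such combination, which is used both under [mu] and under the laws at the
    times t' of the average. *)
Lemma limit_law_transition_le t C : 0 <= t -> local C ->
  ((mu \x P) [set p | C (rel_height (tau p.2) p.1 t)] <= mu C)%E.
Proof.
have [Lc LZ LD Lle] := hLim; move=> t0 lC; apply/lee_addgt0Pr => e' e'0.
(* Two errors come from the approximation, and a third, t / S <= e for large S, from shifting the
   time window by t. *)
pose e := e' / 3; have e0 : 0 < e by rewrite divr_gt0.
have [s [q [K [q0 lK hK]]]] := transition_approx clocks t0 lC e0.
have [h1 _] := hK _ _ mu id (@dmeas_coord d).
apply: (le_trans h1).
have -> : \sum_(ks <- s) q ks * fine (mu [set o | K ks (id o)]) =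
    Lim (fun S => \sum_(ks <- s) q ks * avg_law (K ks) S).
  have [_ ->] := @ebounded_sum _ s q _ (fun ks => ebounded_avg_law (lK ks)).
  by apply: eq_bigr => ks _; rewrite -[LHS]/(q ks * fine (mu (K ks))) muE.
rewrite muE// -!EFinD lee_fin.
suff : Lim (fun S => \sum_(ks <- s) q ks * avg_law (K ks) S) <=
    Lim (fun S => avg_law C S + (e + e)).
  rewrite LD; [|exact: ebounded_avg_law|exact: ebounded_cst].
  by rewrite Lc /e; lra.
have be : ebounded (fun S => avg_law C S + (e + e)).
  have [M h] := ebounded_avg_law lC; exists (M + `|e + e|); apply: filterS h => S h.
  by apply: le_trans (ler_normD _ _) _; rewrite lerD2r.
apply: Lle => //; first by have [] := @ebounded_sum _ s q _ (fun ks => ebounded_avg_law (lK ks)).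
apply: filterS2 (nbhs_pinfty_gt (num_real 0)) (nbhs_pinfty_ge (num_real (t / e))) => S S0 St.
have bK ks : bounded_measurable (time_law (K ks)) by exact: time_law_measurable.
have bqK ks : bounded_measurable (fun t' => q ks * time_law (K ks) t').
  exact: bounded_measurableZ.
have -> : \sum_(ks <- s) q ks * avg_law (K ks) S =
    avg S (fun t' => \sum_(ks <- s) q ks * time_law (K ks) t').
  by rewrite avg_sum//; apply: eq_bigr => ks _; rewrite avgZ.
have bs := bounded_measurable_shift t (time_law_measurable clocks first lC).
apply: (@le_trans _ _ (avg S (fun t' => time_law C (t' + t) + e))).
  apply: avg_le => //.
  - exact: bounded_measurable_sum.
  - by apply: bounded_measurableD => //; exact: bounded_measurable_cst.
  move=> t' t'0 _; have [_ h2] := hK _ _ P (profile tau first t') (dmeas_profile clocks first t').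
  by rewrite -lee_fin EFinD -time_law_markov.
rewrite avgD// ?avg_cst//; last exact: bounded_measurable_cst.
have te : t / S <= e by rewrite ler_pdivrMr// mulrC -ler_pdivrMr.
have := avg_law_shift clocks first lC S0 t0.
by move: (avg S _) (avg_law C S) => x y h; lra.
Qed.

(** The inequality for the complement of a local event is the reverse inequality for the event. *)
Lemma limit_law_invariant : invariant_measure P tau mu.
Proof.
apply: (invariant_of_local clocks) => t C t0 lC.
pose E := [set p : height_space d * T | C (rel_height (tau p.2) p.1 t)].
have mE : measurable E.
  apply: (local_measurable (f := fun p : height_space d * T =>
    rel_height (tau p.2) p.1 t : height_space d)) lC _ => x.
  by apply: (dmeas_transition clocks (Y := id)); exact: dmeas_coord.
rewrite -[LHS]/((mu \x P)%E E); apply/eqP; rewrite eq_le; apply/andP; split.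
  exact: limit_law_transition_le.
have h : (1 - (mu \x P) E <= 1 - mu C)%E.
  refine (eq_ind _ (fun z => (z <= _)%E) _ _ (probability_setC (mu \x P)%E mE)).
  refine (eq_ind _ (fun z => (_ <= z)%E) _ _ (probability_setC mu (measurable_local lC))).
  exact: (limit_law_transition_le t0 (localC lC)).
have f1 : mu C \is a fin_num by apply: fin_num_measure; exact: measurable_local.
have f2 : (mu \x P)%E E \is a fin_num.
  rewrite ge0_fin_numE ?measure_ge0//.
  by apply: le_lt_trans (probability_le1 (mu \x P)%E mE) _; exact: ltry.
move: f1 f2 h; move: ((mu \x P)%E E) (mu C) => [x| |] [y| |] //= _ _.
by rewrite -!EFinB !lee_fin => h; lra.
Qed.

End stationary_limit.

(** * Reflection and asymmetry *)

Section reflection.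
Context (R : realType) (disp : measure_display) (T : measurableType disp).
Variables (P : probability T R) (d : nat) (tau : T -> site d -> nat -> R).
Hypothesis clocks : poisson_clocks P tau.
Variable first : 'I_d.

Definition flip (x : site d) : site d :=
  \row_j (if j == first then - x 0 j else x 0 j).

Lemma flipK : involutive flip.
Proof.
by move=> x; apply/rowP => j; rewrite !mxE; case: eqP => // _; rewrite opprK.
Qed.

Lemma flipD x y : flip (x + y) = flip x + flip y.
Proof. by apply/rowP => j; rewrite !mxE; case: eqP => // _; rewrite opprD. Qed.

Lemma flipN x : flip (- x) = - flip x.
Proof. by apply/rowP => j; rewrite !mxE; case: eqP. Qed.

Lemma flip_unit i :
  flip (unit_vec i) = if i == first then - unit_vec i else unit_vec i.
Proof.
apply/rowP => j; rewrite !mxE /=; have [->|ni] := eqVneq i first; rewrite !mxE /=.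
  by case: eqP => // _; rewrite oppr0.
by case: (eqVneq j i) => [->|//]; [rewrite (negbTE ni)|case: ifP; rewrite ?oppr0].
Qed.

Lemma flip0 : flip 0 = 0.
Proof. by apply/rowP => j; rewrite !mxE; case: eqP; rewrite ?oppr0. Qed.

Lemma adj_flip x z : z \in adj (flip x) <-> exists2 y, y \in adj x & z = flip y.
Proof.
have h y u : u \in adj y -> flip u \in adj (flip y).
  case/adjP => [->|[i ->]|[i ->]]; first exact: adj_refl.
  - by rewrite flipD flip_unit; case: ifP => _; [exact: adj_sub|exact: adj_add].
  - rewrite flipD flipN flip_unit; case: ifP => _; last exact: adj_sub.
    by rewrite opprK; exact: adj_add.
split => [zx|[y yx ->]]; last exact: h.
by exists (flip z); rewrite ?flipK// -{1}(flipK x); exact: h.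
Qed.

Definition reflect_state (eta : height_space d) : height_space d := eta \o flip.

Lemma measurable_reflect : measurable_fun setT reflect_state.
Proof. by apply: measurable_height_space_fun => x; exact: dmeas_coord. Qed.

Lemma local_reflect C : local C -> local (reflect_state @^-1` C).
Proof.
move=> [xs dC]; exists (map flip xs) => eta eta' e; apply: dC => x xxs.
by apply: e; exact: map_f.
Qed.

Lemma transition_reflect t C (eta : height_space d) : 0 <= t -> local C ->
  P [set om | C (rel_height (tau om) (reflect_state eta) t)] =
  P [set om | C (reflect_state (rel_height (tau om) eta t))].
Proof.
move=> t0 [xs /localE[A ->]]; pose A' := [set v | A [seq z - head 0 v | z <- behead v]].
transitivity (P [set om | A' (heights tau (eta \o flip) t (0 :: xs) om)]).
  by congr (P _); apply/seteqP; split => om; rewrite /A' /= -map_comp.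
apply: etrans (esym (symmetry_law clocks (eta : site d -> int) (0 :: xs) A' flipK flipK adj_flip t0)) _.
congr (P _); apply/seteqP; split => om;
  by rewrite /A' /heights /mkset /= -!map_comp /= flip0.
Qed.

(** For each fixed initial state the transition commutes in law with the reflection; integrating
    over [mu] transfers invariance. *)
Lemma reflect_invariant (mu nu : probability (height_space d) R) :
  (forall A, nu A = mu (reflect_state @^-1` A)) ->
  invariant_measure P tau mu -> invariant_measure P tau nu.
Proof.
move=> nuE inv; apply: (invariant_of_local clocks) => t C t0 lC.
have lC' := local_reflect lC.
rewrite nuE -(inv t t0 _ (measurable_local lC')).
transitivity ((mu \x P)%E [set p : height_space d * T |
    C (rel_height (tau p.2) (reflect_state p.1) t)]).
  (* A change of variables: [transition_approx] gives one approximant for all initial laws, applied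
     to [nu] and to a state of law [mu] that is then reflected. *)
  apply: eq_close => e e0.
  have [s [q [K [q0 lK hK]]]] := transition_approx clocks t0 lC e0.
  have [h1 h2] := hK _ _ nu id (@dmeas_coord d).
  have [h3 h4] := hK _ _ mu reflect_state (fun x => @dmeas_coord d (flip x)).
  exists (\sum_(ks <- s) q ks * fine (nu [set o | K ks (id o)]))%:E; split => //.
    by under eq_bigr do rewrite nuE.
  by under eq_bigr do rewrite nuE.
rewrite /pushforward /product_measure1; apply: eq_integral => eta _ /=.
rewrite -[RHS]/(P _) -[LHS]/(P _) .
transitivity (P [set om | C (rel_height (tau om) (reflect_state eta) t)]).
  by congr (P _); apply/seteqP; split => om /=; rewrite /xsection /= inE.
rewrite transition_reflect//.
by congr (P _); apply/seteqP; split => om /=; rewrite /xsection /= inE.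
Qed.

(** Translation by -e_1 carries the pair (0, e_1) to (-e_1, 0), so w(e_1) has the law of
    -w(-e_1). *)
Lemma time_law_translate (B : set int) t :
  time_law P tau first [set eta : height_space d | B (eta (unit_vec first))] t =
  time_law P tau first [set eta : height_space d | B (- eta (- unit_vec first))] t.
Proof.
set e := unit_vec first; rewrite /time_law; congr fine.
set s := Num.max 0 t; have s0 : 0 <= s by rewrite le_max lexx.
pose A := [set v : seq int | B (nth 0 v 1 - nth 0 v 0)].
have := translation_law clocks first [:: 0; e] (- e) A s0.
rewrite /heights /A /= add0r subrr /mkset => h.
transitivity (P [set om | B (height (tau om) (tilt first) s e + tilt first (- e) -
    (height (tau om) (tilt first) s 0 + tilt first (- e)))]).
  congr (P _); apply/seteqP; split => om; rewrite /profile /rel_height /mkset -/s;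
    by rewrite opprD addrACA subrr addr0.
rewrite -h; congr (P _); apply/seteqP; split => om; rewrite /profile /rel_height /mkset -/s;
  by rewrite opprB.
Qed.

End reflection.

Section asymmetry.
Context (R : realType) (disp : measure_display) (T : measurableType disp).
Variables (P : probability T R) (d : nat) (tau : T -> site d -> nat -> R).
Hypothesis clocks : poisson_clocks P tau.
Variable first : 'I_d.

Local Notation e1 := (unit_vec first).
Local Notation time_law := (time_law P tau first).
Local Notation avg_law := (avg_law P tau first).
Local Notation wN := (wN tau first).

(** The indicators of these events, summed over j < 2 k, give the increment truncated to [-k, k],
    plus k. *)
Definition exceeds (k j : nat) : set (height_space d) :=
  [set eta | j%:Z - k%:Z < (eta : site d -> int) e1].

Lemma local_exceeds k j : local (exceeds k j).
Proof. exact: (local_map [:: e1] (fun v => j%:Z - k%:Z < nth 0 v 0)). Qed.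

(** Level j is paired with level 2 k - 1 - j: for an integer z, z <= j - k means -z > k - 1 - j, so
    by symmetry the two probabilities add up to one. *)
Lemma sum_symmetric (mu : probability (height_space d) R) k :
  (forall B : set int, mu [set eta : height_space d | B (eta e1)] =
    mu [set eta : height_space d | B (- eta e1)]) ->
  \sum_(j < k + k) fine (mu (exceeds k j)) = k%:R.
Proof.
move=> sym; set s := \sum_(j < _) _.
have fE (A : set int) : fine (mu [set eta : height_space d | A (eta e1)]) =
    1 - fine (mu [set eta : height_space d | ~ A (eta e1)]).
  have mA B : measurable [set eta : height_space d | B ((eta : site d -> int) e1)].
    exact: measurable_local (local_map [:: e1] (fun v => B (nth 0 v 0))).
  rewrite -[[set eta | ~ _]]/(~` [set eta : height_space d | A (eta e1)]).
  rewrite probability_setC//.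
  have : mu [set eta : height_space d | A (eta e1)] \is a fin_num by exact: fin_num_measure.
  by case: (mu _) => [x| |] //= _; lra.
have pair (j : 'I_(k + k)) :
    fine (mu (exceeds k j)) + fine (mu (exceeds k (k + k - j.+1)%N)) = 1.
  rewrite {1}/exceeds (fE (fun z => j%:Z - k%:Z < z)).
  rewrite /exceeds (sym (fun z => (k + k - j.+1)%N%:Z - k%:Z < z)).
  rewrite (_ : [set eta : height_space d | ~ _] = [set eta : height_space d |
    (k + k - j.+1)%N%:Z - k%:Z < - (eta : site d -> int) e1]) ?subrK//.
  by apply/seteqP; split => eta /=; have := ltn_ord j; lia.
have : s + s = (k + k)%:R.
  rewrite {2}/s (reindex_inj rev_ord_inj) /s -big_split /=.
  by rewrite (eq_bigr (fun=> 1)) ?sumr_const ?card_ord.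
by rewrite natrD; lra.
Qed.

Definition mean_tail k t : \bar R :=
  (\int[P]_om (if (k <= wN t e1 om)%N then wN t e1 om else 0%N)%:R%:E)%E.

Lemma exceeds_avg k S : 1 <= S -> (time_average (mean_tail k) S <= (1 / 2)%:E)%E ->
  1 / 2 + k%:R <= \sum_(j < k + k) avg_law (exceeds k j) S.
Proof.
move=> S1 hS; have S0 : 0 < S by exact: lt_le_trans S1.
pose f t := \sum_(j < k + k) time_law (exceeds k j) t.
have bC j : bounded_measurable (time_law (exceeds k j)).
  exact: (time_law_measurable clocks first (local_exceeds k j)).
have bf : bounded_measurable f by exact: bounded_measurable_sum.
(* The positive part provides the nonnegative integrand needed for the comparison with [mean_tail],
   and its average is no smaller. *)
pose g t := Num.max 0 (1 + k%:R + (-1) * f t).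
have bg' : bounded_measurable (fun t => 1 + k%:R + (-1) * f t).
  by apply: bounded_measurableD; [exact: bounded_measurable_cst|exact: bounded_measurableZ].
have bg : bounded_measurable g.
  case: bg' => mg [M gM]; split; first exact: measurable_maxr.
  exists M => t; have gMt := gM t; have M0 := le_trans (normr_ge0 _) gMt.
  by rewrite /g; case: (leP 0 (1 + k%:R + (-1) * f t)) => _; [exact: gMt|rewrite normr0].
have h1 : avg S g <= 1 / 2.
  rewrite -lee_fin; apply: le_trans hS; rewrite EFin_avg// /time_average.
  apply: lee_wpmul2l; first by rewrite lee_fin invr_ge0 ltW.
  apply: ge0_le_integral_any => t /=; first by move=> _; rewrite lee_fin le_max lexx.
  rewrite in_itv /= => /andP[t0 _].
  have h := truncation clocks first k t0.
  have -> : (g t)%:E = (maxe 0 ((1 + k%:R)%:E - (f t)%:E))%E.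
    by rewrite /g mulN1r EFin_max EFinB.
  rewrite ge_max integral_ge0 /=; last by move=> om _; rewrite lee_fin ler0n.
  rewrite EFinN leeBlDl//; apply: le_trans h _; rewrite leeD2r//.
  rewrite /f -sumEFin; apply: lee_sum => j _; rewrite -(time_lawE clocks); last exact: local_exceeds.
  by rewrite /profile (max_idPr t0).
have h2 : avg S (fun t => 1 + k%:R + (-1) * f t) <= avg S g.
  by apply: avg_le => // t _ _; rewrite /g le_max lexx orbT.
move: h2; rewrite avgD//; [|exact: bounded_measurable_cst|exact: bounded_measurableZ].
have fE : avg S f = \sum_(j < k + k) avg_law (exceeds k j) S.
  exact: (avg_sum _ S0 (fun j : 'I_(k + k) => bC j)).
rewrite avg_cst// avgZ// fE; move: h1.
by move: (avg S g) (\sum_(j < k + k) _) => x y; lra.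
Qed.

Lemma mean_wN_bound : exists2 K : R, 0 <= K & forall S, 1 <= S ->
  (time_average (fun t => \int[P]_om (wN t e1 om)%:R%:E)%E S <= K%:E)%E.
Proof.
have [C C0 hC] := incr_bound_all clocks first e1.
have [K K0 hK] := mean_avg clocks first.
exists (C * K); first exact: mulr_ge0.
move=> S S1; have S0 : 0 < S by exact: lt_le_trans S1.
have [f bf [fK fE]] := hK S S1.
apply: (@le_trans _ _ (avg S (fun t => C * f t))%:E); last first.
  by rewrite lee_fin avgZ// ler_wpM2l.
rewrite EFin_avg; last exact: bounded_measurableZ.
rewrite /time_average; apply: lee_wpmul2l; first by rewrite lee_fin invr_ge0 ltW.
apply: ge0_le_integral_any => t /=.
  by move=> _; apply: integral_ge0 => om _; rewrite lee_fin ler0n.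
by rewrite in_itv /= => /andP[t0 tS]; rewrite fE//; exact: hC.
Qed.

(* Under [mu] the increment in direction [first] is asymmetric, by uniform integrability. *)
Lemma two_invariant_measures k :
  (forall S, 1 <= S -> (time_average (mean_tail k) S <= (1 / 2)%:E)%E) ->
  exists mu nu : probability (height_space d) R,
    [/\ invariant_measure P tau mu, invariant_measure P tau nu &
        exists2 A : set (height_space d), measurable A & mu A != nu A].
Proof.
move=> tail; have [Lim hLim] := exists_generalized_limit R.
have [Lc LZ LD Lle] := hLim.
have [mu muE] := exists_limit_law clocks first hLim.
have [nu nuE] := exists_image_probability mu (measurable_reflect first).
have imu := limit_law_invariant clocks hLim muE.
exists mu, nu; split => //; first exact: reflect_invariant nuE imu.
apply: contrapT => same.
have {}same A : local A -> mu A = nu A.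
  move=> lA; apply: contrapT => ne; apply: same; exists A; last exact/eqP.
  exact: measurable_local.
have lB (x : site d) (B : set int) : local [set eta : height_space d | B (eta x)].
  exact: (local_map [:: x] (fun v => B (nth 0 v 0))).
have sym (B : set int) : mu [set eta : height_space d | B (eta e1)] =
    mu [set eta : height_space d | B (- eta e1)].
  have -> : mu [set eta : height_space d | B (eta e1)] =
      mu [set eta : height_space d | B (- eta (- e1))].
    rewrite (muE _ (lB e1 B)) (muE _ (lB (- e1) (fun z => B (- z)))); congr (Lim _)%:E.
    apply/funext => S; congr avg; apply/funext => t; exact: (time_law_translate clocks).
  rewrite (same _ (lB e1 (fun z => B (- z)))) nuE; congr (mu _); apply/seteqP.
  by split => eta; rewrite /reflect_state /= flip_unit eqxx.
have := sum_symmetric k sym.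
have lE j := local_exceeds k j.
have bE (j : 'I_(k + k)) := ebounded_avg_law clocks first (lE j).
have [b LS] := ebounded_sum hLim (index_enum 'I_(k + k)) (fun=> 1) bE.
(* Symmetry makes the sum equal to k, while the generalized limit of [exceeds_avg] makes it at least
   k + 1/2. *)
suff : 1 / 2 + k%:R <= \sum_(j < k + k) fine (mu (exceeds k j)) by move=> h e; move: h; rewrite e; lra.
rewrite (eq_bigr (fun j : 'I_(k + k) => 1 * Lim (avg_law (exceeds k j)))); last first.
  by move=> j _; rewrite mul1r muE.
rewrite -LS -(Lc (1 / 2 + k%:R)); apply: Lle => //; first exact: ebounded_cst.
apply: filterS (nbhs_pinfty_ge (num_real 1)) => S S1.
under eq_bigr do rewrite mul1r.
exact: exceeds_avg (tail S S1).
Qed.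

End asymmetry.

Theorem theorem1p6 (R : realType) (disp : measure_display)
    (T : measurableType disp) (P : probability T R)
    (d : nat) (hd : (1 <= d)%N)
    (tau : T -> 'rV[int]_d -> nat -> R) (clocks : poisson_clocks P tau) :
  let first : 'I_d := Ordinal hd in
  let w0 : 'rV[int]_d -> int := fun x => x 0 first in
  let w (t : R) (om : T) : int := rel_height (tau om) w0 t (unit_vec first) in
  let absw (t : R) (om : T) : R := `|w t om|%:~R in
  let absw_tail (K t : R) (om : T) : R :=
    absw t om * \1_[set om' | K <= absw t om'] om in
  (sup_time_average (fun t => ('E_P[absw t])%E) < +oo)%E /\
  (sup_time_average (fun t => ('E_P[absw_tail K t])%E) @[K --> +oo%R] --> 0%E ->
   exists mu nu : probability (height_space d) R,
     [/\ invariant_measure P tau mu, invariant_measure P tau nu &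
         exists2 A : set (height_space d), measurable A & mu A != nu A]).
Proof.
move=> first w0 w absw absw_tail.
have abswE t om : absw t om = (wN tau first t (unit_vec first) om)%:R.
  by rewrite /absw -abszE.
split.
  have [K K0 hK] := mean_wN_bound clocks first.
  apply: (@le_lt_trans _ _ K%:E); last exact: ltry.
  apply: ge_ereal_sup => _ [S /= S1 <-]; apply: le_trans (hK S S1).
  rewrite le_eqVlt; apply/orP; left; apply/eqP; congr time_average.
  by apply/funext => t; rewrite unlock; apply: eq_integral => om _; rewrite abswE.
move=> tail.
(* Any level strictly between 0 and the mean 1 of the increment would serve here; 1/2 is the one
   used in [exceeds_avg]. *)
have half : nbhs (0%E : \bar R) [set x | (x < (1 / 2)%:E)%E].
  by apply: open_nbhs_nbhs; split; [exact: open_ereal_lt_ereal|rewrite /= lte_fin].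
have [M [_ hM]] := tail _ half.
pose k := (Num.truncn `|M|).+1.
have Mk : M < k%:R by apply: le_lt_trans (ler_norm M) _; exact: truncnS_gt.
apply: (two_invariant_measures clocks (first := first) (k := k)) => S S1.
apply: le_trans (ltW (hM _ Mk)); apply: ereal_sup_ubound; exists S => //.
congr time_average; apply/funext => t; rewrite unlock; apply: eq_integral => om _.
rewrite /absw_tail indicE abswE; congr (_%:E).
have -> : (om \in [set om' | k%:R <= absw t om']) =
    (k <= wN tau first t (unit_vec first) om)%N.
  by apply/idP/idP => [/set_mem|h]; [|apply/mem_set]; rewrite /= abswE ler_nat.
by case: ifP => _; rewrite ?mulr1 ?mulr0.
Qed.
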